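(* For any $p\in(1,\infty)$ there exists $c>0$ such that for all $\theta\in(0,1/2]$ and all $\varepsilon>0$, $$\frac1c\,\theta^p\min\{1,(\varepsilon/\theta^p)^{p/(p+1)}\}\ \le\ \inf_{v\in\mathcal B} I^p_{\varepsilon,\theta}(v)\ \le\ c\,\theta^p\min\{1,(\varepsilon/\theta^p)^{p/(p+1)}\}.$$
   Context: For $p\in(1,\infty)$ let $$\mathcal B:=\{v\in W^{1,p}((0,1)^2):\ \partial_1 v,\ \partial_2 v\in BV((0,1)^2),\ v(0,\cdot)=0\},$$ where the boundary condition on $\{x_1=0\}$ is in the sense of traces and $\partial_j v:=\partial v/\partial x_j$. For $\theta\in(0,1/2]$, $\varepsilon>0$ and $v\in\mathcal B$ define $$I^p_{\varepsilon,\theta}(v):=\int_{(0,1)^2}\Big(|\partial_1 v|^p+\min\{|\partial_2 v+\theta|^p,\ |\partial_2 v-(1-\theta)|^p\}\Big)\,dx+\varepsilon\,|D^2v|((0,1)^2),$$ where $|D^2 v|$ denotes the total variation measure of the distributional second derivative $D^2v$ (a finite measure since $\partial_1v,\partial_2v\in BV$). *)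

(* Defs.v *)
From HB Require Import structures.
From mathcomp Require Import all_boot all_order all_algebra.
From mathcomp Require Import all_classical all_reals all_analysis.

Import Order.TTheory GRing.Theory Num.Theory.
Import numFieldNormedType.Exports.

Local Open Scope classical_set_scope.
Local Open Scope ring_scope.

(* All functions are total on the plane; only their values on the open unit
   square (on the closed one, for continuous functions) ever matter. *)

Notation plane R := (measurableTypeR R * measurableTypeR R)%type.

Notation leb2 R := (@lebesgue_measure R \x @lebesgue_measure R)%E.

Definition unit_interval (R : realType) : set (measurableTypeR R) := `]0, 1[.

Definition square (R : realType) : set (plane R) :=
  unit_interval R `*` unit_interval R.

Definition closed_square (R : realType) : set (plane R) :=
  `[0, 1] `*` `[0, 1].

Definition evec (R : realType) (i : 'I_2) : R * R :=
  if i == ord0 then (1, 0) else (0, 1).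

Set Implicit Arguments.
Unset Strict Implicit.
Unset Printing Implicit Defensive.

Definition Lp d (T : measurableType d) (R : realType)
    (mu : {measure set T -> \bar R}) (D : set T) (p : R) (f : T -> R) : Prop :=
  measurable_fun D f /\ (\int[mu]_(x in D) (`|f x| `^ p)%:E < +oo)%E.

(* C^1 functions with compact support in the open square; using C_c^1 instead
   of C_c^oo test functions is the convention of Evans-Gariepy for both weak
   and BV derivatives. *)
Definition test_fun (R : realType) (phi : R * R -> R) : Prop :=
  (forall i, (forall x, derivable phi x (evec R i)) /\
             continuous (fun x => 'D_(evec R i) phi x)) /\
  (exists2 K : set (R * R), compact K /\ K `<=` square R &
     forall x, ~ K x -> phi x = 0).

Definition weak_partial (R : realType) (i : 'I_2) (v g : plane R -> R) : Prop :=
  forall phi : R * R -> R, test_fun phi ->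
    (\int[leb2 R]_(x in square R) (v x * 'D_(evec R i) phi x)%:E =
     - \int[leb2 R]_(x in square R) (g x * phi x)%:E)%E.

Definition sobolev (R : realType) (p : R) (v : plane R -> R)
    (g : 'I_2 -> plane R -> R) : Prop :=
  Lp (leb2 R) (square R) p v /\
  forall i, Lp (leb2 R) (square R) p (g i) /\ weak_partial i v (g i).

(* Integral against a signed measure, through its Jordan decomposition (which
   does not depend on the chosen Hahn decomposition). *)
Definition cintegral d (T : measurableType d) (R : realType)
    (nu : {charge set T -> \bar R}) (D : set T) (f : T -> R) : \bar R :=
  let nuPN := svalP (cid (svalP (cid (Hahn_decomposition nu)))) in
  (\int[jordan_pos nuPN]_(x in D) (f x)%:E -
   \int[jordan_neg nuPN]_(x in D) (f x)%:E)%E.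

(* g is in BV of the square, and its distributional derivative is the
   vector-valued measure Dg restricted to the square (charges are finite). *)
Definition BV_derivative (R : realType) (g : plane R -> R)
    (Dg : 'I_2 -> {charge set (plane R) -> \bar R}) : Prop :=
  (leb2 R).-integrable (square R) (EFin \o g) /\
  forall i (phi : R * R -> R), test_fun phi ->
    (\int[leb2 R]_(x in square R) (g x * 'D_(evec R i) phi x)%:E =
     - cintegral (Dg i) (square R) phi)%E.

(* The total variation |nu|(A) of a matrix-valued measure, with the Euclidean
   (Frobenius) norm on matrices. *)
Definition total_variation d (T : measurableType d) (R : realType) (m n : nat)
    (nu : 'I_m -> 'I_n -> {charge set T -> \bar R}) (A : set T) : \bar R :=
  ereal_sup [set s | exists E : (set T)^nat,
    [/\ forall k, measurable (E k), trivIset setT E, \bigcup_k E k = A &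
        s = (\sum_(0 <= k <oo)
          (Num.sqrt (\sum_i \sum_j fine (nu i j (E k)) ^+ 2))%:E)%E]].

(* w is the trace on {x_1 = 0} of the W^{1,p} function v with weak gradient g:
   the trace operator is the extension by W^{1,p}-L^p continuity of the
   restriction operator on the W^{1,p} functions which are continuous up to the
   boundary (and dense in W^{1,p}). *)
Definition left_trace (R : realType) (p : R) (v : plane R -> R)
    (g : 'I_2 -> plane R -> R) (w : R -> R) : Prop :=
  Lp (@lebesgue_measure R) (unit_interval R) p w /\
  exists (u : nat -> plane R -> R) (du : nat -> 'I_2 -> plane R -> R),
    [/\ forall n, {within (closed_square R : set (R * R)),
                   continuous (u n : R * R -> R)} /\ sobolev p (u n) (du n),
        (\int[leb2 R]_(x in square R) (`|u n x - v x| `^ p)%:E)%E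
          @[n --> \oo] --> 0%E,
        forall i,
          (\int[leb2 R]_(x in square R) (`|du n i x - g i x| `^ p)%:E)%E
            @[n --> \oo] --> 0%E &
        (\int[@lebesgue_measure R]_(t in unit_interval R)
           (`|u n (0, t) - w t| `^ p)%:E)%E @[n --> \oo] --> 0%E].

(* The class B. A function v is bundled with its weak gradient (partials j is
   the derivative of v in the variable j) and with its distributional second
   derivative (hessian i j is the derivative of partials j in the variable i);
   v determines the former almost everywhere on the square, and the latter on
   the Borel subsets of the square. *)
Record classB (R : realType) (p : R) := ClassB {
  classB_fun :> plane R -> R;
  partials : 'I_2 -> plane R -> R;
  hessian : 'I_2 -> 'I_2 -> {charge set (plane R) -> \bar R};
  classB_sobolev : sobolev p classB_fun partials;
  classB_BV : forall j, BV_derivative (partials j) (hessian ^~ j);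
  classB_trace : left_trace p classB_fun partials (cst 0) }.

Definition energy (R : realType) (p eps theta : R) (v : classB p) : \bar R :=
  (\int[leb2 R]_(x in square R)
     (`|partials v ord0 x| `^ p +
      Num.min (`|partials v ord_max x + theta| `^ p)
              (`|partials v ord_max x - (1 - theta)| `^ p))%:E
   + eps%:E * total_variation (hessian v) (square R))%E.

(* Main.v *)
(* Lower bound. Divide the square into n strips of height 1/n in x_2. On almost
   every segment of a strip, the oscillation of f := d_2 v is controlled by the
   variation of d_22 v: either it is at least 1/4, or f stays close to -th, or
   close to 1 - th, or away from both wells. As 0 is at distance th from both
   wells, in each case th is bounded by the modulus of the average of f (against
   a spline supported in the segment), plus th^(1-p) times the average of the
   well, plus th times the oscillation. Since v = 0 on {x_1 = 0}, the averages
   of f integrate to at most the integral of n^2 |d_1 v| over the strip.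
   Summing over the strips, th <= C (n e + n e^(1-p) E_1 + th^(1-p) E_2 +
   th n^-1 V) where E_1, E_2 are the two elastic terms, V is the variation of
   the second derivative, and e ~ th / n comes from Young's inequality; take
   n ~ (th^p / eps)^(1/(p+1)).

   Upper bound. If eps >= th^p take v = 0. Otherwise v is a branching sawtooth
   in x_2: it has n ~ (th^p / eps)^(1/(p+1)) teeth at x_1 = 1, and passing from
   x_1 in [r l, l] to [r^2 l, r l] doubles their number; after N generations the
   teeth are interpolated to 0. For 2^(-p/(p-1)) < r < 1/2 the elastic and the
   surface energies of the generations are geometric series, up to the term in
   d_11 v, which is harmless as N is of order log n. Each interface is smoothed
   at a scale so small that its contribution to the wells is negligible, so that
   v is of class C^2 and its Hessian has a density. *)
From HB Require Import structures.
Require Import Defs.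
From mathcomp Require Import all_boot all_order all_algebra.
From mathcomp Require Import all_classical all_reals all_analysis.
From mathcomp Require Import measurable_realfun ring lra.
Import Order.TTheory GRing.Theory Num.Theory.
Import numFieldNormedType.Exports.
Local Open Scope classical_set_scope.
Local Open Scope ring_scope.
Set Implicit Arguments.
Unset Strict Implicit.
Unset Printing Implicit Defensive.

(** * Splines and test functions *)

(** One family of splines supplies every cut-off. In the lower bound, the average of d_2 v against a
    cubic B-spline in x_2 is minus the average of v against the derivative of the spline. That
    derivative then serves as a factor of a C^1 test function in the estimate by d_1 v, for which a
    quadratic spline would not be smooth enough. Neither v nor d_2 v has values on a given segment:
    relations between slices are tested with products and then read at Lebesgue points, by means of
    shrinking kernels. The variation of a measure only bounds its pairing with one test function of
    modulus at most 1, whereas an oscillation on almost every segment is wanted. Hence in each thin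
    cell of x_1 the best of finitely many bumps in x_2 is selected, the selections are summed along
    a partition of unity, and Fatou's lemma is applied twice: to the width of the cells, then to the
    grid of bumps. In the upper bound, a generation is glued to the finer ones by adding the change
    of its layer, so nothing is defined by cases in x_1. The surface bound is independent of the
    smoothing scale, as the kernels have mass 1; so that scale can be chosen last. *)

Section splines.
Context {R : realType}.
Implicit Types (t x y : R) (n : nat).

(** The truncated power, normalised so that differentiation lowers [n]. As [0 ^+ 0 = 1], [ppow 0] is
    the constant 1 and not a Heaviside function; vanishing for [t <= 0] is therefore claimed from
    index 1 on. *)
Definition ppow n t : R := Num.max t 0 ^+ n / n`!%:R.

Lemma ppow_le0 n t : t <= 0 -> ppow n.+1 t = 0.
Proof. by move=> t0; rewrite /ppow max_r// expr0n mul0r. Qed.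

Lemma ppow_ge0 n t : 0 <= t -> ppow n t = t ^+ n / n`!%:R.
Proof. by move=> t0; rewrite /ppow max_l. Qed.

Lemma continuous_ppow n : continuous (ppow n).
Proof.
move=> t; rewrite /ppow; apply: cvgMl.
have h : Num.max s 0 @[s --> t] --> Num.max t 0.
  by apply: continuous_max; [exact: cvg_id|exact: cvg_cst].
elim: n => [|n ih]; first by under eq_fun do rewrite expr0; exact: cvg_cst.
under eq_fun do rewrite exprS; rewrite exprS; exact: cvgM.
Qed.

Lemma is_derive_ppow n t : is_derive t 1 (ppow n.+2) (ppow n.+1 t).
Proof.
have [t0|t0|->] := ltgtP t 0.
- have E : \near t, cst 0 t = ppow n.+2 t.
    by near=> s; rewrite ppow_le0//; apply: ltW; near: s; exact: lt_nbhsl.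
  by apply: (near_eq_is_derive E); rewrite ppow_le0; [exact: is_derive_cst|exact: ltW].
- have E : \near t, (n.+2)`!%:R^-1 *: (@id R ^+ n.+2) t = ppow n.+2 t.
    near=> s; rewrite ppow_ge0; first by rewrite mulrC exprfctE.
    by apply: ltW; near: s; exact: lt_nbhsr.
  apply: (near_eq_is_derive E).
  have H := @is_deriveX R R id n.+2 t 1 1 (is_derive_id _ _).
  apply: is_derive_eq (is_deriveZ (n.+2)`!%:R^-1 H) _.
  rewrite ppow_ge0; last exact: ltW.
  rewrite /= /GRing.scale/= mulr1 factS natrM invfM mulrACA mulVf ?mul1r ?pnatr_eq0//.
  by rewrite mulrC.
- have H : h^-1 *: ((ppow n.+2 \o shift 0) (h *: 1) - ppow n.+2 0) @[h --> (0:R)^'] --> ppow n.+1 0.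
    rewrite !ppow_le0//.
    (* At the knot the difference quotient is [ppow n.+1 h / n.+2%:R] for both signs of [h]. *)
    apply: (@cvg_trans _ (ppow n.+1 h / n.+2%:R @[h --> (0:R)^'])).
      apply: near_eq_cvg; near=> h.
      have h0 : h != 0 by near: h; exact: nbhs_dnbhs_neq.
      rewrite /= addr0 subr0 /GRing.scale/= mulr1 /ppow (factS n.+1) natrM.
      have [h1|h1] := leP h 0; first by rewrite !expr0n/= !mul0r mulr0.
      by rewrite (exprS h n.+1) invfM !mulrA mulVf// mul1r mulrAC.
    have h0 : ppow n.+1 h @[h --> (0:R)^'] --> (0:R).
      have := @continuous_ppow n.+1 0; rewrite /continuous_at ppow_le0//.
      exact: cvg_within_filter.
    by have := cvgM h0 (cvg_cst (n.+2%:R^-1 : R)); rewrite mul0r; apply.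
  by apply: DeriveDef; [apply/cvg_ex; exists (ppow n.+1 0)|exact: cvg_lim].
Unshelve. all: end_near. Qed.

(* [spl 3] is the cubic B-spline with knots 0, ..., 4, and the other values of [n] give
   its derivatives and antiderivatives; thus [spl 4] is a smooth step from 0 to 1. *)
Definition spl n t : R :=
  ppow n t - 4 * ppow n (t - 1) + 6 * ppow n (t - 2) - 4 * ppow n (t - 3)
  + ppow n (t - 4).

Lemma is_derive_spl n t : is_derive t 1 (spl n.+2) (spl n.+1 t).
Proof.
have S (a : R) : is_derive t 1 (fun x => ppow n.+2 (x - a)) (ppow n.+1 (t - a)).
  have h : is_derive t 1 (fun x : R => x - a) 1.
    by apply: is_derive_eq (is_deriveB (is_derive_id _ _) (is_derive_cst a t 1)) _; rewrite subr0.
  by apply: is_derive_eq (is_derive1_comp (is_derive_ppow _ _) h) _; rewrite mulr1.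
have H := is_deriveD (is_deriveB (is_deriveD (is_deriveB (is_derive_ppow n t)
  (is_deriveZ 4 (S 1))) (is_deriveZ 6 (S 2))) (is_deriveZ 4 (S 3))) (S 4).
exact: is_derive_eq H _.
Qed.

Lemma continuous_spl n : continuous (spl n).
Proof.
move=> t.
have S (a : R) : {for t, continuous (fun x => ppow n (x - a))}.
  have h : x - a @[x --> t] --> t - a by apply: cvgB; [exact: cvg_id|exact: cvg_cst].
  exact: cvg_comp h (@continuous_ppow n _).
have Z (k a : R) : {for t, continuous (fun x => k * ppow n (x - a))}.
  by apply: cvgMr; exact: S.
by apply: cvgD; [apply: cvgB; [apply: cvgD; [apply: cvgB; [exact: continuous_ppow|]|]|]|];
  [exact: Z|exact: Z|exact: Z|exact: S].
Qed.

Lemma spl_le0 n t : t <= 0 -> spl n.+1 t = 0.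
Proof. by move=> t0; rewrite /spl !ppow_le0 ?mulr0 ?subr0 ?addr0//; lra. Qed.

(** Each polynomial piece is moved to [[0, 1]], where [spl01] to [spl34] give it explicitly and the
    sign of [t] and [1 - t] is at hand. *)
Let cases (P : R -> Prop) :
  (forall t, t <= 0 -> P t) -> (forall t, 0 <= t <= 1 -> P t) ->
  (forall t, 0 <= t <= 1 -> P (t + 1)) -> (forall t, 0 <= t <= 1 -> P (t + 2)) ->
  (forall t, 0 <= t <= 1 -> P (t + 3)) -> (forall t, 4 <= t -> P t) -> forall t, P t.
Proof.
move=> h h0 h1 h2 h3 h4 t.
have [t0|t0] := leP t 0; first exact: h.
have [t1|t1] := leP t 1; first by apply: h0; lra.
have [t2|t2] := leP t 2; first by rewrite (_ : t = t - 1 + 1); [apply: h1; lra|lra].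
have [t3|t3] := leP t 3; first by rewrite (_ : t = t - 2 + 2); [apply: h2; lra|lra].
have [t4|t4] := leP t 4; first by rewrite (_ : t = t - 3 + 3); [apply: h3; lra|lra].
by apply: h4; lra.
Qed.

(** The fourth difference of [t ^+ 4 / 4!] is 1. *)
Lemma spl4_ge t : 4 <= t -> spl 4 t = 1.
Proof. by move=> ?; rewrite /spl !ppow_ge0 ?factS ?fact0; [field|lra..]. Qed.

(** Fourth differences annihilate the polynomials of degree at most 3. *)
Lemma spl_ge n t : (n < 3)%N -> 4 <= t -> spl n.+1 t = 0.
Proof.
by move=> n3 ?; rewrite /spl !ppow_ge0; [|lra..];
  case: n n3 => [|[|[|//]]] _; rewrite ?factS ?fact0; field.
Qed.

Let spl01 n t : 0 <= t <= 1 -> spl n.+1 t = t ^+ n.+1 / (n.+1)`!%:R.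
Proof.
by move=> ?; rewrite /spl ppow_ge0 ?ppow_le0 ?mulr0 ?subr0 ?addr0//; lra. Qed.
Let spl12 n t : 0 <= t <= 1 ->
  spl n.+1 (t + 1) = ((t + 1) ^+ n.+1 - 4 * t ^+ n.+1) / (n.+1)`!%:R.
Proof.
move=> ?; rewrite /spl ppow_ge0 ?[ppow _ (_ - 1)]ppow_ge0 ?ppow_le0 ?mulr0 ?subr0 ?addr0; [|lra..].
by rewrite addrK mulrBl mulrA.
Qed.
Let spl23 n t : 0 <= t <= 1 ->
  spl n.+1 (t + 2) = ((t + 2) ^+ n.+1 - 4 * (t + 1) ^+ n.+1 + 6 * t ^+ n.+1) / (n.+1)`!%:R.
Proof.
move=> ?; rewrite /spl ppow_ge0 ?[ppow _ (_ - 1)]ppow_ge0 ?[ppow _ (_ - 2)]ppow_ge0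
  ?ppow_le0 ?mulr0 ?subr0 ?addr0; [|lra..].
by rewrite addrK (_ : t + 2 - 1 = t + 1) ?mulrDl ?mulNr ?mulrA//; lra.
Qed.
Let spl34 n t : 0 <= t <= 1 ->
  spl n.+1 (t + 3) = ((t + 3) ^+ n.+1 - 4 * (t + 2) ^+ n.+1 + 6 * (t + 1) ^+ n.+1
     - 4 * t ^+ n.+1) / (n.+1)`!%:R.
Proof.
move=> ?; rewrite /spl ppow_ge0 ?[ppow _ (_ - 1)]ppow_ge0 ?[ppow _ (_ - 2)]ppow_ge0
  ?[ppow _ (_ - 3)]ppow_ge0 ?ppow_le0 ?mulr0 ?subr0 ?addr0; [|lra..].
rewrite addrK (_ : t + 3 - 1 = t + 2) 1?(_ : t + 3 - 2 = t + 1) ?mulrDl ?mulNr ?mulrA//; lra.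
Qed.

Lemma spl4_01 t : 0 <= spl 4 t <= 1.
Proof.
elim/cases: t => t t01.
- by rewrite spl_le0// lexx ler01.
- by rewrite spl01// !factS fact0; have : t ^+ 4 <= 1 by [rewrite exprn_ile1//; lra|]; 
    have : 0 <= t ^+ 4 by [rewrite exprn_ge0//; lra|]; lra.
- rewrite spl12// !factS fact0; nra.
- rewrite spl23// !factS fact0.
  have p1 : 0 <= t * (1 - t ^+ 2) by apply: mulr_ge0; nra.
  have p2 : 0 <= (1 - t) ^+ 3 by rewrite exprn_ge0//; lra.
  have p3 : 0 <= (1 - t) ^+ 3 * t by apply: mulr_ge0; lra.
  have p4 : 0 <= t ^+ 4 by rewrite exprn_ge0//; lra.
  have p5 : 0 <= (1 - t) ^+ 2 by rewrite sqr_ge0.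
  by apply/andP; split; lra.
- rewrite spl34// !factS fact0.
  (* By symmetry, the last piece is [1 - (1 - t) ^+ 4 / 24]. *)
  have p1 : 0 <= (1 - t) ^+ 4 by rewrite exprn_ge0//; lra.
  have p2 : (1 - t) ^+ 4 <= 1 by rewrite exprn_ile1//; lra.
  by apply/andP; split; lra.
- by rewrite spl4_ge// lexx ler01.
Qed.

Lemma spl3_01 t : 0 <= spl 3 t <= 1.
Proof.
elim/cases: t => t t01.
- by rewrite spl_le0// lexx ler01.
- rewrite spl01// !factS fact0; nra.
- rewrite spl12// !factS fact0; nra.
- rewrite spl23// !factS fact0; nra.
- rewrite spl34// !factS fact0.
  have p1 : 0 <= (1 - t) ^+ 3 by rewrite exprn_ge0//; lra.
  have p2 : (1 - t) ^+ 3 <= 1 by rewrite exprn_ile1//; lra.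
  by apply/andP; split; lra.
- by rewrite spl_ge// lexx ler01.
Qed.

Lemma normr_spl2 t : `|spl 2 t| <= 1.
Proof.
rewrite ler_norml.
elim/cases: t => t t01.
- by rewrite spl_le0//; lra.
- rewrite spl01// !factS fact0; nra.
- rewrite spl12// !factS fact0; nra.
- rewrite spl23// !factS fact0; nra.
- rewrite spl34// !factS fact0; nra.
- by rewrite spl_ge//; lra.
Qed.

(** A fourth difference is a difference of third differences: [spl 3 t = r t - r (t - 1)] for the
    third difference [r] of [ppow 3]. The sum telescopes, and [r] has values in [[0, 1]]. *)
Lemma spl_sum_le1 m t : \sum_(i < m) spl 3 (t - i%:R) <= 1.
Proof.
pose r t := ppow 3 t - 3 * ppow 3 (t - 1) + 3 * ppow 3 (t - 2) - ppow 3 (t - 3).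
have r01 u : 0 <= r u <= 1.
  rewrite /r; elim/cases: u => u u01.
  - by rewrite !ppow_le0 ?mulr0 ?subr0 ?addr0 ?lexx ?ler01//; lra.
  - by rewrite ppow_ge0 ?ppow_le0 ?factS ?fact0; [nra|lra..].
  - rewrite ppow_ge0 ?[ppow _ (_ - 1)]ppow_ge0 ?ppow_le0 ?factS ?fact0; [|lra..].
    by nra.
  - rewrite ppow_ge0 ?[ppow _ (_ - 1)]ppow_ge0 ?[ppow _ (_ - 2)]ppow_ge0 ?ppow_le0
      ?factS ?fact0; [|lra..].
    have p1 : 0 <= (1 - u) ^+ 3 by rewrite exprn_ge0//; lra.
    have p2 : (1 - u) ^+ 3 <= 1 by rewrite exprn_ile1//; lra.
    by apply/andP; split; lra.
  - by rewrite !ppow_ge0 ?factS ?fact0; [lra..].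
  - by rewrite !ppow_ge0 ?factS ?fact0; [lra..].
suff -> : \sum_(i < m) spl 3 (t - i%:R) = r t - r (t - m%:R).
  by have /andP[_ +] := r01 t; have /andP[+ _] := r01 (t - m%:R); lra.
elim: m => [|m ih]; first by rewrite big_ord0 subr0 subrr.
rewrite big_ord_recr/= ih -natr1 /spl /r.
have -> : t - (m%:R + 1) = t - m%:R - 1 by lra.
set z := t - m%:R.
have [-> [-> ->]] : z - 1 - 1 = z - 2 /\ z - 1 - 2 = z - 3 /\ z - 1 - 3 = z - 4.
  by do !split; lra.
move: (ppow 3 (z - 4)) (ppow 3 (z - 3)) (ppow 3 (z - 2)) (ppow 3 (z - 1)) (ppow 3 z).
move: (_ - ppow 3 (t - 3)) => *; lra.
Qed.

End splines.

(** * Test functions of product form *)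

Section test_functions.
Context {R : realType}.
Implicit Types (phi psi : R * R -> R) (al be : R -> R).

Lemma derivable_evec0 phi (x : R * R) d :
  is_derive x.1 1 (fun t => phi (t, x.2)) d -> is_derive x (evec R ord0) phi d.
Proof.
move=> [h1 h2].
have E : (fun h : R => h^-1 *: ((phi \o shift x) (h *: evec R ord0) - phi x)) =
  (fun h : R => h^-1 *: (((fun t => phi (t, x.2)) \o shift x.1) (h *: 1) - phi (x.1, x.2))).
  apply/funext => h; rewrite /evec eqxx /=.
  congr (_ *: (phi _ - phi _)); last by case: x {h1 h2}.
  by rewrite (_ : h *: (1, 0) + x = (h *: 1 + x.1, h *: 0 + x.2))// scaler0 add0r.
by apply: DeriveDef; [rewrite /derivable E|rewrite /derive E].
Qed.

Lemma derivable_evec1 phi (x : R * R) d :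
  is_derive x.2 1 (fun t => phi (x.1, t)) d -> is_derive x (evec R ord_max) phi d.
Proof.
move=> [h1 h2].
have E : (fun h : R => h^-1 *: ((phi \o shift x) (h *: evec R ord_max) - phi x)) =
  (fun h : R => h^-1 *: (((fun t => phi (x.1, t)) \o shift x.2) (h *: 1) - phi (x.1, x.2))).
  apply/funext => h; rewrite /evec /=.
  congr (_ *: (phi _ - phi _)); last by case: x {h1 h2}.
  by rewrite (_ : h *: (0, 1) + x = (h *: 0 + x.1, h *: 1 + x.2))// scaler0 add0r.
by apply: DeriveDef; [rewrite /derivable E|rewrite /derive E].
Qed.

Definition C1c al (al' : R -> R) :=
  [/\ forall t : R, is_derive t 1 al (al' t), continuous al' &
      exists a b : R, [/\ 0 < a, b < 1 & forall t, ~ (a <= t <= b) -> al t = 0 /\ al' t = 0]].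

Lemma is_derive_continuous (f df : R -> R) : (forall t : R, is_derive t 1 f (df t)) -> continuous f.
Proof.
move=> h t; apply/differentiable_continuous/derivable1_diffP.
by case: (h t).
Qed.

Lemma ord2P (i : 'I_2) : i = ord0 \/ i = ord_max.
Proof. by case: i => [[|[|//]] ?]; [left|right]; apply/val_inj. Qed.

Lemma C1c_cont al (al' : R -> R) : C1c al al' -> continuous al.
Proof. by case=> h _ _; exact: is_derive_continuous h. Qed.

(** Products of this kind, and finite sums of them, are all the test functions that the lower bound
    uses. *)
Lemma C1c_prod al (al' : R -> R) be (be' : R -> R) (phi := fun x : R * R => al x.1 * be x.2) :
  C1c al al' -> C1c be be' ->
  [/\ test_fun phi, forall x, 'D_(evec R ord0) phi x = al' x.1 * be x.2 &
      forall x, 'D_(evec R ord_max) phi x = al x.1 * be' x.2].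
Proof.
move=> ha hb; have ca := C1c_cont ha; have cb := C1c_cont hb.
case: ha hb => [da ca' [a0 [a1 [a00 a11 asupp]]]] [db cb' [b0 [b1 [b00 b11 bsupp]]]].
have D0 x : is_derive x (evec R ord0) phi (al' x.1 * be x.2).
  apply: derivable_evec0; have H := is_deriveZ (be x.2) (da x.1).
  apply: is_derive_eq (_ : is_derive _ _ _ (be x.2 *: al' x.1)) _; last exact: mulrC.
  rewrite (_ : (fun t => _) = be x.2 \*: al)//.
  by apply/funext => t; rewrite /phi/= mulrC.
have D1 x : is_derive x (evec R ord_max) phi (al x.1 * be' x.2).
  apply: derivable_evec1; have H := is_deriveZ (al x.1) (db x.2).
  exact: is_derive_eq H _.
have E0 x : 'D_(evec R ord0) phi x = al' x.1 * be x.2 by case: (D0 x).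
have E1 x : 'D_(evec R ord_max) phi x = al x.1 * be' x.2 by case: (D1 x).
have C (f g : R -> R) : continuous f -> continuous g ->
    continuous (fun x : R * R => f x.1 * g x.2).
  move=> cf cg x.
  by apply: cvgM; apply: continuous_comp; [exact: cvg_fst|exact: cf|exact: cvg_snd|exact: cg].
split => //; split.
  move=> i; split=> [x|].
    by case: (ord2P i) => ->; [case: (D0 x)|case: (D1 x)].
  by case: (ord2P i) => ->; [rewrite (funext E0)|rewrite (funext E1)]; exact: C.
exists (`[a0, a1] `*` `[b0, b1]).
  split; first by apply: compact_setX; exact: segment_compact.
  by move=> [x y] [] /=; rewrite /square /unit_interval /= !in_itv/=; lra.
move=> [x y]; rewrite /= !in_itv/= => h; rewrite /phi/=.
have [hx|hx] := pselect (a0 <= x <= a1); last by rewrite (asupp _ hx).1 mul0r.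
by rewrite (bsupp y _).1 ?mulr0// => hy; apply: h.
Qed.

Lemma test_fun0 : test_fun (fun _ : R * R => 0 : R).
Proof.
split.
  move=> i; split=> [x|]; first by case: (is_derive_cst (0:R) x (evec R i)).
  have -> : 'D_(evec R i) (fun _ : R * R => 0 : R) = cst 0.
    by apply/funext => x; rewrite derive_cst.
  exact: cst_continuous.
by exists set0 => //; split; [exact: compact0|exact: sub0set].
Qed.

Lemma test_funD phi psi : test_fun phi -> test_fun psi -> test_fun (fun x => phi x + psi x).
Proof.
move=> [h1 [K1 [c1 s1] z1]] [h2 [K2 [c2 s2] z2]]; split.
  move=> i; have [d1 e1] := h1 i; have [d2 e2] := h2 i; split=> [x|].
    by apply: derivableD.
  rewrite (_ : (fun x => _) = (fun x => 'D_(evec R i) phi x + 'D_(evec R i) psi x)).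
    by move=> x; apply: cvgD; [exact: e1|exact: e2].
  by apply/funext => x; rewrite -deriveD.
exists (K1 `|` K2).
  by split; [exact: compactU|move=> x [/s1|/s2]].
by move=> x h; rewrite z1 ?z2 ?addr0// => ?; apply: h; [right|left].
Qed.

Lemma test_fun_sum (I : Type) (r : seq I) (F : I -> R * R -> R) :
  (forall i, test_fun (F i)) -> test_fun (fun x => \sum_(i <- r) F i x).
Proof.
move=> h; elim: r => [|i r ih].
  by under eq_fun do rewrite big_nil; exact: test_fun0.
by under eq_fun do rewrite big_cons; exact: test_funD.
Qed.

Lemma derive_test_sum (I : Type) (r : seq I) (F : I -> R * R -> R) j x :
  (forall i, test_fun (F i)) ->
  'D_(evec R j) (fun x => \sum_(i <- r) F i x) x =
  \sum_(i <- r) 'D_(evec R j) (F i) x.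
Proof.
move=> h; elim: r => [|i r ih].
  by under eq_fun do rewrite big_nil; rewrite big_nil derive_cst.
rewrite big_cons -ih; under eq_fun do rewrite big_cons.
rewrite deriveD//; first by have [/(_ j)[]] := h i.
by have [/(_ j)[]] := test_fun_sum r h.
Qed.

End test_functions.

(** * Restriction to slices *)

Section slices.
Context {R : realType}.
Local Notation mu := (@lebesgue_measure R).
Local Notation mu2 := (leb2 R).

Definition bounded_mfun d (T : measurableType d) (b : T -> R) :=
  measurable_fun setT b /\ exists M, forall t, `|b t| <= M.

Lemma integrableM_bounded d (T : measurableType d) (m : {measure set T -> \bar R})
    (D : set T) (f b : T -> R) : measurable D ->
  m.-integrable D (EFin \o f) -> bounded_mfun b ->
  m.-integrable D (EFin \o (fun x => f x * b x)).
Proof.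
move=> mD intf [mb [M hM]].
have := @integrableMl _ _ _ m D mD (EFin \o f) b intf.
rewrite (_ : ((EFin \o f) \* (EFin \o b))%E = EFin \o (fun x => f x * b x))//; apply.
  exact: measurable_funTS.
by exists M; split; [exact: num_real|move=> y My x _ /=; exact: le_trans (hM _) (ltW My)].
Qed.

Lemma bounded_mfunM d (T : measurableType d) (a b : T -> R) :
  bounded_mfun a -> bounded_mfun b -> bounded_mfun (fun x => a x * b x).
Proof.
move=> [ma [M hM]] [mb [N hN]]; split; first exact: measurable_funM.
by exists (M * N) => t; rewrite normrM ler_pM.
Qed.

Lemma bounded_mfun_fst (a : R -> R) : @bounded_mfun _ (measurableTypeR R) a ->
  bounded_mfun (fun z : plane R => a z.1).
Proof.
move=> [ma [M hM]]; split; last by exists M => ?.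
exact: measurableT_comp.
Qed.

Lemma bounded_mfun_snd (a : R -> R) : @bounded_mfun _ (measurableTypeR R) a ->
  bounded_mfun (fun z : plane R => a z.2).
Proof.
move=> [ma [M hM]]; split; last by exists M => ?.
exact: measurableT_comp.
Qed.

(** As [fine] sends infinite values to 0, passing to real values can only lower the modulus. *)
Lemma abse_fine_le (x : \bar R) : (`|(fine x)%:E| <= `|x|)%E.
Proof. by case: x => [r||] //=; rewrite ?lexx// normr0 leey. Qed.

(** The pairing with [b] on the vertical segment above [x]. As a real-valued integral it takes the
    value 0 where the extended integral is infinite, which for integrable [f] and bounded [b]
    happens on a null set only. *)
Definition slice (f : plane R -> R) (b : R -> R) (x : R) : R :=
  \int[mu]_y (f (x, y) * b y).

Lemma slice_integrable f b : mu2.-integrable setT (EFin \o f) ->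
  @bounded_mfun _ (measurableTypeR R) b -> mu.-integrable setT (EFin \o slice f b).
Proof.
move=> intf hb.
have h := integrable_fubini_F (integrableM_bounded measurableT intf (bounded_mfun_snd hb)).
apply: le_integrable (h) => //; last by move=> x _ /=; exact: abse_fine_le.
by apply/measurable_EFinP; exact: measurableT_comp (measurable_int _ h).
Qed.

(** Almost every section is integrable, and there the real-valued slice agrees with the inner
    integral of Fubini's theorem. *)
Lemma slice_fubini f a b : mu2.-integrable setT (EFin \o f) ->
  @bounded_mfun _ (measurableTypeR R) a -> @bounded_mfun _ (measurableTypeR R) b ->
  \int[mu]_x (slice f b x * a x) = \int[mu2]_z (f z * (a z.1 * b z.2)).
Proof.
move=> intf ha hb; rewrite /Rintegral; congr fine.
have i1 := integrableM_bounded measurableT intf (bounded_mfun_snd hb).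
have i2 := integrableM_bounded measurableT intf
  (bounded_mfunM (bounded_mfun_fst ha) (bounded_mfun_snd hb)).
rewrite -(integral12_prod_meas1 i2).
have ims := slice_integrable intf hb.
apply: ae_eq_integral => //.
- apply: measurable_int (integrableM_bounded measurableT ims ha).
- apply: measurable_int; exact: integrable_fubini_F i2.
have := ae_integrable1 i1; apply: filterS => x /= ix _.
rewrite /fubini_F /= /slice.
under [RHS]eq_integral do rewrite mulrCA EFinM.
rewrite integralZl// EFinM muleC; congr (_ * _)%E.
by rewrite fineK//; exact: integrable_fin_num ix.
Qed.

Lemma slice_abs f b : mu2.-integrable setT (EFin \o f) ->
  @bounded_mfun _ (measurableTypeR R) b ->
  (\int[mu]_x `|slice f b x|%:E <= \int[mu2]_z `|f z * b z.2|%:E)%E.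
Proof.
move=> intf hb.
have i1 := integrableM_bounded measurableT intf (bounded_mfun_snd hb).
have m1 := measurable_int _ i1.
have mabs : measurable_fun setT (fun z : plane R => `|f z * b z.2|%:E).
  by apply/measurable_EFinP; apply: measurableT_comp => //; exact/measurable_EFinP.
rewrite fubini_tonelli1//.
apply: ge0_le_integral => //.
- apply/measurable_EFinP; apply: measurableT_comp => //; apply/measurable_EFinP.
  exact: measurable_int (slice_integrable intf hb).
- exact: measurable_fun_fubini_tonelli_F.
move=> x _; rewrite /slice /Rintegral.
apply: (@le_trans _ _ `|\int[mu]_y (f (x, y) * b y)%:E|%E); first exact: abse_fine_le.
apply: le_trans (le_abse_integral _ _ _) _ => //.
by have := measurable_fun_pair2 x m1.
Qed.

Lemma abs_fine_integral d (T : measurableType d) (m : {measure set T -> \bar R}) (D : set T)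
    (f : T -> R) : measurable D -> measurable_fun D f ->
  (`|\int[m]_(x in D) f x|%:E <= \int[m]_(x in D) `|f x|%:E)%E.
Proof.
move=> mD mf; apply: le_trans (abse_fine_le _) _.
by apply: le_trans (le_abse_integral _ _ _) _ => //; exact/measurable_EFinP.
Qed.

Lemma integral_is_derive (F f : R -> R) a b : a < b ->
  (forall t : R, is_derive t 1 F (f t)) -> continuous f ->
  (forall t, ~ (a <= t <= b) -> f t = 0) ->
  (\int[mu]_x (f x)%:E = (F b - F a)%:E)%E.
Proof.
move=> ab dF cf f0.
rewrite EFinB -(@continuous_FTC2 _ f F a b ab); first last.
- by move=> t _; rewrite derive1E; case: (dF t).
- split.
  + by move=> t _; case: (dF t).
  + apply: cvg_at_right_filter; exact: (is_derive_continuous dF).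
  + apply: cvg_at_left_filter; exact: (is_derive_continuous dF).
- exact: continuous_subspaceT.
rewrite [RHS]integral_mkcond; apply: eq_integral => t _.
rewrite /= patchE; case: ifPn => // /negP h.
by rewrite f0// => tab; apply: h; rewrite inE/= in_itv.
Qed.

(** A bump of mass 1; [a] is the left end of its support, of length [4 / m], and not its centre. *)
Definition kernel (m a y : R) := m * spl 3 (m * (y - a)).

Definition ramp (m a y : R) := spl 4 (m * (y - a)).

Lemma is_derive_scaled n (m a y : R) :
  is_derive y 1 (fun y : R => spl n.+2 (m * (y - a))) (m * spl n.+1 (m * (y - a))).
Proof.
have h : is_derive y 1 (fun y : R => m * (y - a)) m.
  apply: is_derive_eq (is_deriveZ m (is_deriveB (is_derive_id _ _) (is_derive_cst a y 1))) _.
  by rewrite subr0 /GRing.scale/= mulr1.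
by apply: is_derive_eq (is_derive1_comp (is_derive_spl _ _) h) _; rewrite mulrC.
Qed.

Lemma is_derive_ramp m a (y : R) : is_derive y 1 (ramp m a) (kernel m a y).
Proof. exact: is_derive_scaled. Qed.

Lemma is_derive_kernel m a (y : R) :
  is_derive y 1 (kernel m a) (m ^+ 2 * spl 2 (m * (y - a))).
Proof. by apply: is_derive_eq (is_deriveZ m (is_derive_scaled 1 m a y)) _; rewrite expr2 -mulrA. Qed.

Lemma continuous_scaled n (m a : R) : continuous (fun y : R => spl n (m * (y - a))).
Proof.
move=> y.
have h : m * (z - a) @[z --> y] --> m * (y - a).
  by apply: cvgMr; apply: cvgB; [exact: cvg_id|exact: cvg_cst].
exact: (cvg_comp _ _ h (@continuous_spl _ _ _)).
Qed.

Lemma continuous_kernel m a : continuous (kernel m a).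
Proof. by move=> y; apply: cvgMr; exact: continuous_scaled. Qed.

Lemma spl_out n (t : R) : (n < 3)%N -> ~ (0 < t < 4) -> spl n.+1 t = 0.
Proof.
move=> n3 h; have [t0|t0] := leP t 0; first exact: spl_le0.
have [t4|t4] := leP 4 t; first exact: spl_ge.
by exfalso; apply: h; rewrite t0 t4.
Qed.

Lemma kernel_out m a y : 0 < m -> ~ (a < y < a + 4 / m) -> kernel m a y = 0.
Proof.
move=> m0 h; rewrite /kernel spl_out ?mulr0// => /andP[h1 h2]; apply: h.
rewrite pmulr_rgt0// in h1; rewrite -ltr_pdivlMl// mulrC in h2.
by apply/andP; split; lra.
Qed.

Lemma kernel_ge0 m a y : 0 < m -> 0 <= kernel m a y.
Proof. by move=> m0; rewrite mulr_ge0 ?(ltW m0)//; have /andP[] := spl3_01 (m * (y - a)). Qed.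

Lemma kernel_le m a y : 0 < m -> kernel m a y <= m.
Proof.
by move=> m0; rewrite /kernel ler_piMr ?(ltW m0)//; have /andP[] := spl3_01 (m * (y - a)).
Qed.

Lemma bounded_kernel m a : 0 < m -> @bounded_mfun _ (measurableTypeR R) (kernel m a).
Proof.
move=> m0; split; first by apply: continuous_measurable_fun; exact: continuous_kernel.
by exists m => t; rewrite ger0_norm ?kernel_ge0// kernel_le.
Qed.

Lemma integral_kernel m a : 0 < m -> (\int[mu]_x (kernel m a x)%:E = 1)%E.
Proof.
move=> m0.
have m4 : m * (a + 4 / m - a) = 4 by rewrite addrAC subrr add0r mulrCA divff ?gt_eqF// mulr1.
rewrite (integral_is_derive _ (is_derive_ramp m a) (@continuous_kernel m a)
  (b := a + 4 / m) (a := a)).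
- by rewrite /ramp m4 subrr mulr0 spl4_ge// spl_le0// subr0.
- by rewrite ltrDl divr_gt0.
by move=> t h; apply: kernel_out => // /andP[h1 h2]; apply: h; rewrite !ltW.
Qed.

(** The support of the kernel lies in the ball of radius [8 / m] around [x], whose length is
    [16 / m], and the kernel is at most [m]; hence the factor 16. *)
Lemma kernel_davg f x m a : mu.-integrable setT (EFin \o f) -> 0 < m ->
  x - 4 / m <= a <= x + 4 / m ->
  (`|\int[mu]_y (f y * kernel m a y) - f x|%:E <= 16%:E * davg f x (8 / m))%E.
Proof.
move=> intf m0 /andP[xa ax].
have r0 : 0 < 8 / m by rewrite divr_gt0.
have bk := bounded_kernel a m0.
have mf : measurable_fun setT f by apply/measurable_EFinP; exact: measurable_int intf.
have ik : mu.-integrable setT (EFin \o kernel m a).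
  apply/integrableP; split; first by apply/measurable_EFinP; case: bk.
  under eq_integral do rewrite /= ger0_norm ?kernel_ge0//.
  by rewrite integral_kernel// ltry.
have ifk := integrableM_bounded measurableT intf bk.
have -> : f x = \int[mu]_y (f x * kernel m a y).
  by rewrite RintegralZl// /Rintegral integral_kernel//= mulr1.
rewrite -RintegralB//; last first.
  by have := integrableZl measurableT (f x) ik; apply: eq_integrable.
under eq_Rintegral do rewrite -mulrBl.
have mfk : measurable_fun setT (fun y => (f y - f x) * kernel m a y).
  by apply: measurable_funM; [exact: measurable_funB|case: bk].
apply: le_trans (abs_fine_integral _ _ _) _ => //.
have mb : measurable (ball x (8 / m)) by exact: measurable_ball.
have mfx : measurable_fun setT (fun y => `|f y - f x|).
  by apply: measurableT_comp => //; exact: measurable_funB.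
apply: (@le_trans _ _ (\int[mu]_(y in ball x (8 / m)) (m%:E * `|f y - f x|%:E))%E).
  rewrite [leRHS]integral_mkcond; apply: ge0_le_integral => //.
  - by apply/measurable_EFinP; exact: measurableT_comp.
  - apply/(measurable_restrictT _ _).1 => //; apply: measurable_funTS.
    by apply: measurable_funeM; exact/measurable_EFinP.
  move=> y _; rewrite patchE; case: ifPn => [_|/negP yb].
    rewrite -EFinM lee_fin normrM mulrC (ger0_norm (kernel_ge0 _ _ m0)).
    by rewrite ler_wpM2r// kernel_le.
  rewrite kernel_out ?mulr0 ?normr0// => /andP[h1 h2]; apply: yb; rewrite inE/=.
  rewrite /ball/= ltr_norml; have -> : 8 / m = 4 / m + 4 / m by rewrite -mulrDl; congr (_ * _); lra.
  by apply/andP; split; lra.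
rewrite ge0_integralZl_EFin//; last 2 first.
  by apply: measurable_funTS; exact/measurable_EFinP.
  exact: ltW.
rewrite /davg /iavg (lebesgue_measure_ball _ (ltW r0)).
rewrite inver mulrn_eq0/= gt_eqF// muleA -EFinM.
rewrite (_ : 16 * _ = m)//.
by field; rewrite gt_eqF.
Qed.

(** The kernels may be off-centre by an amount comparable with their width, so that they can be
    placed on a grid. *)
Lemma kernel_cvg f x (a : nat -> R) : mu.-integrable setT (EFin \o f) -> lebesgue_pt f x ->
  (forall n, x - 4 / n.+1%:R <= a n <= x + 4 / n.+1%:R) ->
  (\int[mu]_y (f y * kernel n.+1%:R (a n) y)) @[n --> \oo] --> f x.
Proof.
move=> intf fx ax.
have h : (davg f x (8 / n.+1%:R) @[n --> \oo] --> 0)%E.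
  apply: (cvg_comp _ _ _ fx) => P [e /= e0 h].
  have e8 : 0 < e / 8 by rewrite divr_gt0.
  near=> n.
  apply: h => /=; last by rewrite divr_gt0.
  rewrite sub0r normrN gtr0_norm ?divr_gt0// -ltr_pdivlMl// mulrC.
  by near: n; have := near_infty_natSinv_lt (PosNum e8); apply: filterS => n /=.
have h16 : (16%:E * davg f x (8 / n.+1%:R) @[n --> \oo] --> 0)%E.
  by have := cvgeZl (isT : 16%:E \is a fin_num) h; rewrite mule0.
apply/cvgrPdist_le => e e0.
move/fine_cvgP : h16 => [fin /cvgrPdist_le/(_ e e0)].
apply: filterS2 fin => n fn; rewrite sub0r normrN => le.
rewrite distrC -lee_fin; apply: le_trans (kernel_davg intf _ (ax n)) _ => //.
by rewrite -(fineK fn) lee_fin; apply: le_trans (ler_norm _) le.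
Unshelve. all: end_near. Qed.

End slices.

(** * Weak derivatives on slices *)

Section weak_slices.
Context {R : realType}.
Local Notation mu := (@lebesgue_measure R).
Local Notation mu2 := (leb2 R).

Definition trunc (f : plane R -> R) : plane R -> R := f \_ (square R).

Lemma measurable_unit_interval : measurable (unit_interval R).
Proof. exact: measurable_itv. Qed.

Lemma lebesgue_unit_interval : mu (unit_interval R) = 1%E.
Proof. by rewrite lebesgue_measure_itv/= lte_fin ltr01 oppr0 addr0. Qed.

Lemma measurable_square : measurable (square R).
Proof. by apply: measurableX; exact: measurable_itv. Qed.

Lemma leb2_square : mu2 (square R) = 1%E.
Proof.
have mI := measurable_unit_interval.
apply: (eq_trans (@product_measure1E _ _ _ _ R mu mu _ _ mI mI)).
by rewrite -[RHS]mule1; congr (_ * _)%E; exact: lebesgue_unit_interval.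
Qed.

Lemma trunc_in f z : square R z -> trunc f z = f z.
Proof. by move=> sz; rewrite /trunc patchE mem_set. Qed.

Lemma trunc_out f z : ~ square R z -> trunc f z = 0.
Proof. by move=> sz; rewrite /trunc patchE memNset. Qed.

(** Pointwise, either [|f| <= e], or the factor [(|f| / e) ^ (p - 1)] is at least 1 and [|f|] is at
    most [e ^ (1 - p) |f| ^ p]. *)
Lemma L1_le_Lp d (T : measurableType d) (m : {measure set T -> \bar R}) (D : set T)
    (f : T -> R) (p e : R) : 1 < p -> 0 < e -> measurable D -> m D = 1%E -> measurable_fun D f ->
  (\int[m]_(x in D) `|f x|%:E <=
    e%:E + (e `^ (1 - p))%:E * \int[m]_(x in D) (`|f x| `^ p)%:E)%E.
Proof.
move=> p1 e0 mD mD1 mf.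
have mabs : measurable_fun D (fun x => `|f x|) by exact: measurableT_comp.
have mp : measurable_fun D (fun x => `|f x| `^ p).
  by apply: (measurableT_comp (measurable_powR p)).
apply: (@le_trans _ _ (\int[m]_(x in D) (e%:E + (e `^ (1 - p))%:E * (`|f x| `^ p)%:E)))%E.
  apply: ge0_le_integral => //.
  - exact/measurable_EFinP.
  - apply: emeasurable_funD; first exact: measurable_cst.
    by apply: measurable_funeM; exact/measurable_EFinP.
  move=> x Dx; rewrite -EFinM -EFinD lee_fin.
  have [fe|ef] := leP `|f x| e.
    by rewrite ler_wpDr// mulr_ge0// powR_ge0.
  have f0 : 0 < `|f x| by exact: lt_trans ef.
  rewrite ler_wpDl ?(ltW e0)//.
  have -> : `|f x| `^ p = `|f x| `^ (p - 1) * `|f x|.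
    rewrite -[X in _ = _ * X](powRr1 (ltW f0)) -powRD ?subrK//.
    by rewrite (gt_eqF f0) implybT.
  rewrite mulrA ler_peMl//.
  have -> : 1 - p = - (p - 1) by lra.
  rewrite powRN mulrC ler_pdivlMr ?powR_gt0// mul1r.
  by rewrite ge0_ler_powR// ?nnegrE; lra.
rewrite ge0_integralD//; last 3 first.
- by move=> x _; rewrite lee_fin ltW.
- by move=> x _; rewrite -EFinM lee_fin mulr_ge0// powR_ge0.
- by apply: measurable_funeM; exact/measurable_EFinP.
rewrite ge0_integralZl_EFin ?powR_ge0//; last exact/measurable_EFinP.
by rewrite integral_cst// mD1 mule1.
Qed.

Lemma Lp_integrable d (T : measurableType d) (m : {measure set T -> \bar R}) (D : set T)
    (f : T -> R) (p : R) : 1 < p -> measurable D -> m D = 1%E -> Lp m D p f ->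
  m.-integrable D (EFin \o f).
Proof.
move=> p1 mD mD1 [mf foo]; apply/integrableP; split; first exact/measurable_EFinP.
apply: le_lt_trans (L1_le_Lp p1 ltr01 mD mD1 mf) _.
by rewrite powR1 mul1e lte_add_pinfty ?ltry.
Qed.

Lemma trunc_integrable (f : plane R -> R) :
  mu2.-integrable (square R) (EFin \o f) -> mu2.-integrable setT (EFin \o trunc f).
Proof.
move=> /(integrable_mkcond _ measurable_square); apply: eq_integrable => // z _.
by rewrite /trunc /= !patchE; case: ifP.
Qed.

Lemma Rintegral_square (f h : plane R -> R) :
  \int[mu2]_(z in square R) (f z * h z) = \int[mu2]_z (trunc f z * h z).
Proof.
rewrite Rintegral_mkcond; apply: eq_Rintegral => z _.
by rewrite /trunc !patchE; case: ifP; rewrite ?mul0r.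
Qed.

Lemma bounded_compact_support (f : R -> R) a b : continuous f ->
  (forall t, ~ (a <= t <= b) -> f t = 0) -> @bounded_mfun R _ (measurableTypeR R) f.
Proof.
move=> cf f0; split; first exact: continuous_measurable_fun.
have [M [_ hM]] : bounded_set (f @` `[a, b]).
  apply: compact_bounded; apply: continuous_compact; last exact: segment_compact.
  exact: continuous_subspaceT.
exists (Num.max (M + 1) 0) => t; have [h|h] := pselect (a <= t <= b); last first.
  by rewrite f0// normr0 le_max lexx orbT.
rewrite le_max; apply/orP; left; apply: (hM (M + 1)); first by rewrite ltrDl.
by exists t => //=; rewrite in_itv.
Qed.

Lemma C1c_bounded (al al' : R -> R) : C1c al al' ->
  @bounded_mfun R _ (measurableTypeR R) al /\ @bounded_mfun R _ (measurableTypeR R) al'.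
Proof.
move=> h; have ca := C1c_cont h; case: h => _ ca' [a [b [_ _ h]]].
by split; apply: bounded_compact_support => // t /h[].
Qed.

Section relations.
Variables (v g : plane R -> R).
Hypotheses (iv : mu2.-integrable (square R) (EFin \o v))
           (ig : mu2.-integrable (square R) (EFin \o g)).
Variables (al al' be be' : R -> R).
Hypotheses (hal : C1c al al') (hbe : C1c be be').

(** The test function is [al x_1 * be x_2]: the slice of [g] is the weak derivative of the slice of
    [v] in [x_1]. In [weak_slice1] the derivative falls on [be] instead. *)
Lemma weak_slice0 : weak_partial ord0 v g ->
  \int[mu]_x (slice (trunc v) be x * al' x) = - \int[mu]_x (slice (trunc g) be x * al x).
Proof.
have [ba ba'] := C1c_bounded hal; have [bb bb'] := C1c_bounded hbe.
have [tf d0 _] := C1c_prod hal hbe.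
move=> /(_ _ tf) /(congr1 fine) h.
rewrite !slice_fubini//; [|exact: trunc_integrable..].
rewrite -!Rintegral_square /Rintegral -fineN -h; congr fine.
by apply: eq_integral => z _; rewrite d0.
Qed.

Lemma weak_slice1 : weak_partial ord_max v g ->
  \int[mu]_x (slice (trunc v) be' x * al x) = - \int[mu]_x (slice (trunc g) be x * al x).
Proof.
have [ba ba'] := C1c_bounded hal; have [bb bb'] := C1c_bounded hbe.
have [tf _ d1] := C1c_prod hal hbe.
move=> /(_ _ tf) /(congr1 fine) h.
rewrite !slice_fubini//; [|exact: trunc_integrable..].
rewrite -!Rintegral_square /Rintegral -fineN -h; congr fine.
by apply: eq_integral => z _; rewrite d1.
Qed.

End relations.

Lemma slice_out f b x : ~ (0 < x < 1) -> slice (trunc f) b x = 0.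
Proof.
move=> h; rewrite /slice; under eq_Rintegral => y _.
  rewrite trunc_out ?mul0r; last by rewrite /square /unit_interval /= !in_itv /= => -[].
  over.
by rewrite Rintegral_cst// mul0r.
Qed.

Lemma C1c_kernel (m a : R) : 0 < m -> 0 < a -> a + 4 / m < 1 ->
  C1c (kernel m a) (fun y => m ^+ 2 * spl 2 (m * (y - a))).
Proof.
move=> m0 a0 a1; split; first exact: is_derive_kernel.
  by move=> y; apply: cvgMr; exact: continuous_scaled.
exists a, (a + 4 / m); split => // t h; split.
  by apply: kernel_out => // /andP[h1 h2]; apply: h; rewrite !ltW.
rewrite spl_out ?mulr0// => /andP[h1 h2]; apply: h.
rewrite pmulr_rgt0// in h1; rewrite -ltr_pdivlMl// mulrC in h2.
by apply/andP; split; lra.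
Qed.

Lemma ramp_01 (m a y : R) : 0 <= ramp m a y <= 1.
Proof. exact: spl4_01. Qed.

Lemma ramp_le0 (m a y : R) : 0 < m -> y <= a -> ramp m a y = 0.
Proof. by move=> m0 ya; rewrite /ramp spl_le0// pmulr_rle0//; lra. Qed.

Lemma ramp_ge1 (m a y : R) : 0 < m -> a + 4 / m <= y -> ramp m a y = 1.
Proof. by move=> m0 ya; rewrite /ramp spl4_ge// mulrC -ler_pdivrMr//; lra. Qed.

(** The widths and the order of the two ramps are free. Different widths give the plateau of the
    trace estimate, equal ones the bumps that compare two points of a segment. *)
Lemma C1c_ramps (m n a b : R) : 0 < m -> 0 < n -> 0 < a -> 0 < b -> a + 4 / m < 1 -> b + 4 / n < 1 ->
  C1c (fun y => ramp m a y - ramp n b y) (fun y => kernel m a y - kernel n b y).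
Proof.
move=> m0 n0 a0 b0 a1 b1; split.
- by move=> t; exact: is_deriveB (is_derive_ramp _ _ _) (is_derive_ramp _ _ _).
- by move=> t; apply: cvgB; exact: continuous_kernel.
have m4 : 0 < 4 / m by rewrite divr_gt0.
have n4 : 0 < 4 / n by rewrite divr_gt0.
exists (Num.min a b), (Num.max (a + 4 / m) (b + 4 / n)); split.
- by rewrite lt_min a0.
- by rewrite gt_max a1.
move=> t /negP; rewrite negb_and -!ltNge gt_max lt_min => /orP[|] /andP[ta tb]; split.
- by rewrite !ramp_le0 ?subrr// ltW.
- by rewrite !kernel_out ?subrr// => /andP[]; lra.
- by rewrite !ramp_ge1 ?subrr// ltW.
- by rewrite !kernel_out ?subrr// => /andP[]; lra.
Qed.

End weak_slices.

(** * Lebesgue points and the boundary condition *)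

Section trace.
Context {R : realType}.
Local Notation mu := (@lebesgue_measure R).
Local Notation mu2 := (leb2 R).

Lemma ae_lebesgue_pt (f : R -> R) : mu.-integrable setT (EFin \o f) ->
  {ae mu, forall x, lebesgue_pt f x}.
Proof. by move=> intf; apply: lebesgue_differentiation; exact: (open_integrable_locally openT). Qed.

Lemma ae_imp (P Q : R -> Prop) :
  {ae mu, forall x, P x} -> (forall x, P x -> Q x) -> {ae mu, forall x, Q x}.
Proof. by move=> + PQ; apply: filterS; first exact: (ae_filter_ringOfSetsType mu). Qed.

Lemma ae_and (P Q : R -> Prop) :
  {ae mu, forall x, P x} -> {ae mu, forall x, Q x} -> {ae mu, forall x, P x /\ Q x}.
Proof. by apply: filterS2; first exact: (ae_filter_ringOfSetsType mu). Qed.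

Lemma near_natSinv_lt (e c : R) : 0 < e -> 0 < c -> \forall n \near \oo, c / n.+1%:R < e.
Proof.
move=> e0 c0; have ec : 0 < e / c by rewrite divr_gt0.
have := near_infty_natSinv_lt (PosNum ec); apply: filterS => n /=.
by rewrite ltr_pdivlMr// mulrC.
Qed.

(** The relation between slices, integrated against kernels in [x_1], becomes pointwise when the
    kernels concentrate at a Lebesgue point of the sum [F] of the two slices. *)
Lemma ae_weak_slice (v g : plane R -> R) (be be' : R -> R) :
  mu2.-integrable (square R) (EFin \o v) -> mu2.-integrable (square R) (EFin \o g) ->
  C1c be be' -> weak_partial ord_max v g ->
  {ae mu, forall x, slice (trunc v) be' x = - slice (trunc g) be x}.
Proof.
move=> iv ig hbe vg.
have [bb bb'] := C1c_bounded hbe.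
have i1 := slice_integrable (trunc_integrable iv) bb'.
have i2 := slice_integrable (trunc_integrable ig) bb.
pose F x := slice (trunc v) be' x + slice (trunc g) be x.
have iF : mu.-integrable setT (EFin \o F).
  by apply: eq_integrable (integrableD measurableT i1 i2).
apply: ae_imp (ae_lebesgue_pt iF) _ => x Fx.
have [/andP[x0 x1]|x01] := pselect (0 < x < 1); last by rewrite !slice_out// oppr0.
suff : F x = 0 by rewrite /F => /eqP; rewrite addr_eq0 => /eqP.
have axn n : x - 4 / n.+1%:R <= x <= x + 4 / n.+1%:R.
  by rewrite gerBl lerDl divr_ge0.
have := kernel_cvg iF Fx axn; move/cvg_lim => <- //.
apply: lim_near_cst => //; near=> n.
have hk : C1c (kernel n.+1%:R x) (fun y => n.+1%:R ^+ 2 * spl 2 (n.+1%:R * (y - x))).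
  apply: C1c_kernel => //.
  rewrite -ltrBrDl; near: n; apply: near_natSinv_lt => //; lra.
have bk : @bounded_mfun R _ (measurableTypeR R) (kernel n.+1%:R x) by exact: bounded_kernel.
rewrite /F; under eq_Rintegral do rewrite mulrDl.
rewrite RintegralD//; last 2 first.
- exact: (integrableM_bounded measurableT i1 bk).
- exact: (integrableM_bounded measurableT i2 bk).
by rewrite (weak_slice1 iv ig hk hbe vg) addNr.
Unshelve. all: end_near. Qed.

Lemma Rintegral_bound d (T : measurableType d) (m : {measure set T -> \bar R}) (D : set T)
    (f h : T -> R) C : measurable D -> m.-integrable D (EFin \o f) ->
  measurable_fun setT h -> (forall t, `|h t| <= C) ->
  `|\int[m]_(x in D) (f x * h x)| <= C * \int[m]_(x in D) `|f x|.
Proof.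
move=> mD intf mh hC.
have bh : bounded_mfun h by split => //; exists C.
have i1 := integrableM_bounded mD intf bh.
apply: le_trans (le_normr_Rintegral _ _) _ => //.
rewrite -RintegralZl//; last exact: integrable_norm.
apply: le_Rintegral => //; first exact: integrable_norm i1.
  have := integrableZl mD C (integrable_norm intf); exact: eq_integrable.
by move=> x _; rewrite normrM mulrC ler_wpM2r.
Qed.

(** A tube argument: continuity at the points of the compact left edge gives one distance that works
    for all heights. *)
Lemma uniform_trace (u : R * R -> R) (e : R) : 0 < e ->
  {within closed_square R, continuous u} ->
  exists2 d : R, 0 < d & forall s t, 0 <= s <= d -> 0 <= t <= 1 -> `|u (s, t) - u (0, t)| <= e.
Proof.
move=> e0 cu.
have K : compact (`[0, 1] : set R) by exact: segment_compact.
pose P (s t : R) := 0 <= s <= 1 -> 0 <= t <= 1 -> `|u (s, t) - u (0, t)| <= e.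
have := (compact_near_coveringP _).1 K R (nbhs (0 : R)) P _.
have h : forall t : R, `[0, 1]%classic t -> \forall t' \near t & s \near (0 : R), P s t'.
  move=> t; rewrite /= in_itv/= => t01.
  have : u z @[z --> within (closed_square R) (nbhs (0, t))] --> u (0, t).
    move/subspace_continuousP: cu; apply.
    by rewrite /closed_square /= !in_itv/= lexx ler01.
  move=> /cvgrPdist_le/(_ _ (_ : 0 < e / 2))[]; first by rewrite divr_gt0.
  move=> [A B] /= [[a a0 hA] [b b0 hB]] hAB.
  exists (ball t b, ball (0 : R) a) => /=.
    by split; [exact: nbhsx_ballx|exact: nbhsx_ballx].
  move=> [t' s] /= [tt' s0]; rewrite /P => s01 t01'.
  have h1 : `|u (0, t) - u (s, t')| <= e / 2.
    apply: (hAB (s, t')); last by rewrite /closed_square /= !in_itv.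
    by split; [exact: hA|exact: hB].
  have h2 : `|u (0, t) - u (0, t')| <= e / 2.
    apply: (hAB (0, t')); last by rewrite /closed_square /= !in_itv/= lexx ler01.
    by split; [apply: hA; rewrite /= subrr normr0|exact: hB].
  have -> : u (s, t') - u (0, t') = (u (0, t) - u (0, t')) - (u (0, t) - u (s, t')) by lra.
  by apply: le_trans (ler_normB _ _) _; lra.
move=> /(_ (nbhs_filter _) h)[d /= d0 hd].
exists (Num.min (d / 2) 1); first by rewrite lt_min divr_gt0//= ltr01.
move=> s t; rewrite le_min => /andP[s0 /andP[sd s1]] t01.
apply: (hd s) => //=; last by rewrite s0.
by rewrite sub0r normrN ger0_norm//; lra.
Qed.

Lemma section_integrable (u : R * R -> R) (s : R) : 0 <= s <= 1 ->
  {within closed_square R, continuous u} ->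
  mu.-integrable (unit_interval R) (fun t => (u (s, t))%:E).
Proof.
move=> s01 cu.
have i : mu.-integrable `[0, 1] (EFin \o (fun t => u (s, t))).
  apply: continuous_compact_integrable; first exact: segment_compact.
  apply/subspace_continuousP => t /= t01.
  have h : u z @[z --> within (closed_square R) (nbhs (s, t))] --> u (s, t).
    by move/subspace_continuousP: cu; apply; rewrite /closed_square /= !in_itv/= s01.
  move=> A /h [[B D] /= [Bs Dt] hBD].
  rewrite /nbhs /= /within /=; near=> y => y01.
  apply: (hBD (s, y)); last by rewrite /closed_square /= !in_itv/= s01.
  split; first exact: nbhs_singleton.
  by near: y; exact: Dt.
apply: integrableS i => //; last exact: subset_itv_oo_cc.
exact: measurable_unit_interval.
Unshelve. all: end_near. Qed.

Lemma trunc_section (u : plane R -> R) (b : R -> R) (s : R) : 0 < s < 1 ->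
  slice (trunc u) b s = \int[mu]_(t in unit_interval R) (u (s, t) * b t).
Proof.
move=> s01; rewrite Rintegral_mkcond /slice; apply: eq_Rintegral => t _.
rewrite patchE; case: ifPn => [|/negP h].
  by rewrite inE => t01; rewrite trunc_in//; split => //; rewrite /unit_interval /= in_itv.
by rewrite trunc_out ?mul0r// => -[_ tI]; apply: h; exact: mem_set.
Qed.

Lemma integrable_unit_cst (c : R) : mu.-integrable (unit_interval R) (EFin \o cst c).
Proof.
have h : (mu (unit_interval R) < +oo)%E by rewrite lebesgue_unit_interval ltry.
apply: (measurable_bounded_integrable measurable_unit_interval h) => //.
by exists `|c|; split; [exact: num_real|move=> y cy t _; exact: ltW].
Qed.

Lemma Rintegral_unit_cst (c : R) : \int[mu]_(_ in unit_interval R) c = c.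
Proof.
transitivity (c * fine (mu (unit_interval R))).
  by apply: Rintegral_cst; exact: measurable_unit_interval.
by rewrite lebesgue_unit_interval mulr1.
Qed.

Lemma integrable_kernel (m a : R) : 0 < m -> mu.-integrable setT (EFin \o kernel m a).
Proof.
move=> m0; apply/integrableP; split.
  by apply/measurable_EFinP; case: (bounded_kernel a m0).
under eq_integral do rewrite /= ger0_norm ?kernel_ge0//.
by rewrite integral_kernel// ltry.
Qed.

(** The test function in [x_1] has one ramp close to the edge [x_1 = 0] and another, of opposite
    sign, starting at [x]. Its derivative compares the slices at these two places. The error is the
    integral of [du], as the test function has modulus at most 1. *)
Lemma trace_one (u du : plane R -> R) (ga ga' : R -> R) (C x m : R) :
  {within (closed_square R : set (R * R)), continuous (u : R * R -> R)} ->
  mu2.-integrable (square R) (EFin \o u) -> mu2.-integrable (square R) (EFin \o du) ->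
  weak_partial ord0 u du -> C1c ga ga' -> (forall t, `|ga t| <= C) ->
  0 < m -> 0 < x -> x + 4 / m < 1 ->
  `|\int[mu]_y (slice (trunc u) ga y * kernel m x y)| <=
  C * \int[mu]_(t in unit_interval R) `|u (0, t)| +
  \int[mu2]_z `|trunc du z * ga z.2|.
Proof.
move=> cu iu idu wu hga gaC m0 x0 xm.
have [bga bga'] := C1c_bounded hga.
have C0 : 0 <= C by apply: le_trans (gaC 0).
have mI := measurable_unit_interval (R := R).
have icst := integrable_unit_cst.
have iU := slice_integrable (trunc_integrable iu) bga.
have iG := slice_integrable (trunc_integrable idu) bga.
have s0 : 0 <= (0 : R) <= 1 by rewrite lexx ler01.
apply/ler_addgt0Pr => e e0.
(* [C] may be 0, hence [C + 1]. *)
have eC0 : 0 < e / (C + 1) by rewrite divr_gt0// ltr_wpDl.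
have [d d0 hd] := uniform_trace eC0 cu.
pose d1 := Num.min d (1 / 2).
have d10 : 0 < d1 by rewrite lt_min d0 divr_gt0.
have d1d : d1 <= d by rewrite ge_min lexx.
have d12 : d1 <= 1 / 2 by rewrite ge_min lexx orbT.
(* With this choice [kernel M a] is carried by [[d1 / 2, d1]], where [u] is uniformly close to its
   values on the edge. *)
pose M := 8 / d1; pose a := d1 / 2.
have M0 : 0 < M by rewrite divr_gt0.
have aM : a + 4 / M = d1 by rewrite /a /M invf_div; lra.
have a0 : 0 < a by rewrite divr_gt0.
have hr : C1c (fun y => ramp M a y - ramp m x y) (fun y => kernel M a y - kernel m x y).
  by apply: C1c_ramps => //; lra.
have := weak_slice0 iu idu hr hga wu.
under eq_Rintegral do rewrite mulrBr.
have bM := bounded_kernel a M0; have bm := bounded_kernel x m0.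
rewrite RintegralB//; last 2 first.
- exact: (integrableM_bounded measurableT iU bM).
- exact: (integrableM_bounded measurableT iU bm).
move=> /eqP; rewrite subr_eq addrC -subr_eq opprK addrC => /eqP <-.
apply: le_trans (ler_normD _ _) _.
rewrite [leLHS]addrC addrAC; apply: lerD; last first.
  apply: (@le_trans _ _ (1 * \int[mu]_y `|slice (trunc du) ga y|)).
    apply: Rintegral_bound => //.
      by case: (C1c_bounded hr) => -[].
    move=> t; have /andP[] := ramp_01 M a t; have /andP[] := ramp_01 m x t.
    by rewrite ler_norml => *; apply/andP; split; lra.
  rewrite mul1r -lee_fin /Rintegral !fineK; first exact: slice_abs (trunc_integrable idu) bga.
    apply: integrable_fin_num => //; apply: integrable_norm.
    exact: (integrableM_bounded measurableT (trunc_integrable idu) (bounded_mfun_snd bga)).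
  by apply: integrable_fin_num => //; apply: integrable_norm.
pose K := C * \int[mu]_(t in unit_interval R) `|u (0, t)| + e.
have hK y : 0 < y < d1 -> `|slice (trunc u) ga y| <= K.
  move=> /andP[y0 yd]; have y01 : 0 < y < 1 by lra.
  have i0 := section_integrable s0 cu.
  rewrite trunc_section//.
  apply: le_trans (Rintegral_bound (C := C) _ _ _ _) _ => //.
  - by apply: section_integrable cu; lra.
  - by case: bga.
  apply: (@le_trans _ _ (C * \int[mu]_(t in unit_interval R) (`|u (0, t)| + e / (C + 1)))).
    rewrite ler_wpM2l//; apply: le_Rintegral => //.
    - by apply: integrable_norm; apply: section_integrable cu; lra.
    - by apply: eq_integrable (integrableD mI (integrable_norm i0) (icst _)).
    move=> t; rewrite /unit_interval /= in_itv/= => t01.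
    have hyt : `|u (y, t) - u (0, t)| <= e / (C + 1) by apply: hd; lra.
    have -> : u (y, t) = u (0, t) + (u (y, t) - u (0, t)) by lra.
    by apply: le_trans (ler_normD _ _) _; rewrite lerD2l.
  rewrite (RintegralD mI (integrable_norm i0) (icst (e / (C + 1)))).
  rewrite Rintegral_unit_cst mulrDr lerD2l.
  by rewrite mulrA ler_pdivrMr ?ltr_wpDl//; nra.
have iUM := integrableM_bounded measurableT iU bM.
apply: le_trans (le_normr_Rintegral _ iUM) _ => //.
have ik : mu.-integrable setT (EFin \o (fun y => K * kernel M a y)).
  have := integrableZl measurableT K (integrable_kernel a M0); exact: eq_integrable.
apply: (@le_trans _ _ (\int[mu]_y (K * kernel M a y))).
  apply: le_Rintegral => //; first exact: integrable_norm.
  move=> y _; rewrite normrM (ger0_norm (kernel_ge0 _ _ M0)).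
  have [hy|hy] := pselect (a < y < a + 4 / M); last by rewrite kernel_out// !mulr0.
  by rewrite ler_wpM2r ?kernel_ge0// hK//; lra.
by rewrite RintegralZl ?integrable_kernel// /Rintegral integral_kernel//= mulr1.
Qed.

Lemma L1_cvg d (T : measurableType d) (m : {measure set T -> \bar R}) (D : set T)
    (f : nat -> T -> R) (p : R) : 1 < p -> measurable D -> m D = 1%E ->
  (forall n, measurable_fun D (f n)) ->
  (\int[m]_(x in D) (`|f n x| `^ p)%:E @[n --> \oo] --> 0)%E ->
  forall e : R, 0 < e -> \forall n \near \oo, (\int[m]_(x in D) `|f n x|%:E <= e%:E)%E.
Proof.
move=> p1 mD mD1 mf cvg0 e e0.
have e20 : 0 < e / 2 by rewrite divr_gt0.
have w0 : 0 < (e / 2) `^ (1 - p) by rewrite powR_gt0.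
have h0 : 0 < e / 2 / (e / 2) `^ (1 - p) by rewrite divr_gt0.
move/fine_cvgP : cvg0 => [fin /cvgrPdist_le/(_ _ h0)].
apply: filterS2 fin => n fn; rewrite sub0r normrN => le.
apply: le_trans (L1_le_Lp p1 e20 mD mD1 (mf n)) _.
rewrite -(fineK fn) -EFinM -EFinD lee_fin.
have := le_trans (ler_norm _) le; rewrite ler_pdivlMr// => {}le.
by rewrite [X in _ + X]mulrC; move: le => /=; lra.
Qed.

Lemma Rintegral_trunc_norm (f : plane R -> R) :
  \int[mu2]_z `|trunc f z| = \int[mu2]_(z in square R) `|f z|.
Proof.
rewrite [RHS]Rintegral_mkcond; apply: eq_Rintegral => z _.
by rewrite /trunc !patchE; case: ifP; rewrite ?normr0.
Qed.

Lemma Rintegral_le_fin d (T : measurableType d) (m : {measure set T -> \bar R}) (D : set T)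
    (f : T -> R) (e : R) : 0 <= e -> (\int[m]_(x in D) (f x)%:E <= e%:E)%E ->
  \int[m]_(x in D) f x <= e.
Proof. by rewrite /Rintegral; case: (integral _ _ _). Qed.

(** Two limits in this order: for a fixed kernel, the continuous approximations of the trace
    converge to [v]; then the kernel concentrates at a Lebesgue point of the slice of [v]. *)
Lemma ae_trace (p : R) (v : plane R -> R) (g : 'I_2 -> plane R -> R) (ga ga' : R -> R) :
  1 < p -> sobolev p v g -> left_trace p v g (cst 0) -> C1c ga ga' ->
  {ae mu, forall x, `|slice (trunc v) ga x| <= \int[mu2]_z `|trunc (g ord0) z * ga z.2| }.
Proof.
have arith (A B U G V D K1 t1 t2 t3 et : R) : A <= U + G -> B <= D -> G <= K1 + V ->
  U <= t1 -> V <= t2 -> D <= t3 -> t1 + t2 + t3 <= et -> A + B <= K1 + et by lra.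
move=> p1 [Lv hg] [_ [u [du [hu cu cdu ctr]]]] hga.
have Lg := (hg ord0).1.
have isq f : Lp mu2 (square R) p f -> mu2.-integrable (square R) (EFin \o f).
  by apply: Lp_integrable => //; [exact: measurable_square|exact: leb2_square].
have iv := isq _ Lv; have ig := isq _ Lg.
have iu n := isq _ (hu n).2.1; have idu n := isq _ ((hu n).2.2 ord0).1.
have [bga _] := C1c_bounded hga; have [mga [C gaC]] := bga.
have C0 : 0 <= C by apply: le_trans (gaC 0).
have msq := @measurable_square R.
have mI := @measurable_unit_interval R.
have iV := slice_integrable (trunc_integrable iv) bga.
apply: ae_imp (ae_lebesgue_pt iV) _ => x Vx.
have [/andP[x0 x1]|x01] := pselect (0 < x < 1); last first.
  by rewrite slice_out// normr0 Rintegral_ge0.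
set K := (leRHS).
have key m : 0 < m -> x + 4 / m < 1 -> `|\int[mu]_y (slice (trunc v) ga y * kernel m x y)| <= K.
  move=> m0 xm; apply/ler_addgt0Pr => eta eta0.
  (* The error [e] enters with factor [C] through the boundary values, [C] through the first
     derivative, and [m * C] through [u k - v], as the kernel is bounded by [m]. The added 1 keeps
     the denominator positive. *)
  pose e := eta / (C + C + m * C + 1).
  have den0 : 0 < C + C + m * C + 1 by rewrite ltr_wpDl// !addr_ge0// mulr_ge0// ltW.
  have e0 : 0 < e by rewrite divr_gt0.
  have bm := bounded_kernel x m0.
  have [k [hA hB hD]] : exists k,
      [/\ \int[mu]_(t in unit_interval R) `|u k (0, t)| <= e,
          \int[mu2]_(z in square R) `|du k ord0 z - g ord0 z| <= e &
          \int[mu2]_(z in square R) `|u k z - v z| <= e].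
    have c1 h := @L1_cvg _ _ mu _ (fun k t => u k (0, t) - cst 0 t) p p1 mI
       lebesgue_unit_interval h ctr e e0.
    have c2 h := @L1_cvg _ _ mu2 _ (fun k z => du k ord0 z - g ord0 z) p p1 msq
       leb2_square h (cdu ord0) e e0.
    have c3 h := @L1_cvg _ _ mu2 _ (fun k z => u k z - v z) p p1 msq
       leb2_square h cu e e0.
    have mu0 k : measurable_fun (unit_interval R) (fun t => u k (0, t)).
      have s0 : 0 <= (0 : R) <= 1 by rewrite lexx ler01.
      by have /measurable_int/measurable_EFinP := section_integrable s0 (hu k).1.
    have d1 k : measurable_fun (square R) (fun z => du k ord0 z - g ord0 z).
      by apply: measurable_funB; apply/measurable_EFinP; apply: measurable_int;
        [exact: (idu k)|exact: ig].
    have d2 k : measurable_fun (square R) (fun z => u k z - v z).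
      by apply: measurable_funB; apply/measurable_EFinP; apply: measurable_int;
        [exact: (iu k)|exact: iv].
    have d0 k : measurable_fun (unit_interval R) (fun t => u k (0, t) - cst 0 t).
      exact: measurable_funB.
    have [k [[hA hB] hD]] := @filter_ex _ _ _ _ (filterI (filterI (c1 d0) (c2 d1)) (c3 d2)).
    exists k; split; apply: Rintegral_le_fin => //; first exact: ltW.
    - by move: hA; under eq_integral do rewrite /cst subr0.
    - exact: ltW.
    - exact: ltW.
  rewrite slice_fubini//; last exact: trunc_integrable.
  rewrite -Rintegral_square.
  have bkg := bounded_mfunM (bounded_mfun_fst bm) (bounded_mfun_snd bga).
  have -> : \int[mu2]_(z in square R) (v z * (kernel m x z.1 * ga z.2)) =
    \int[mu]_y (slice (trunc (u k)) ga y * kernel m x y) -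
    \int[mu2]_(z in square R) ((u k z - v z) * (kernel m x z.1 * ga z.2)).
    rewrite slice_fubini//; last exact: trunc_integrable.
    rewrite -Rintegral_square; under [X in _ = _ - X]eq_Rintegral do rewrite mulrBl.
    rewrite RintegralB//; last 2 first.
    - exact: (integrableM_bounded msq (iu k) bkg).
    - exact: (integrableM_bounded msq iv bkg).
    by lra.
  apply: le_trans (ler_normB _ _) _.
  have iuv : mu2.-integrable (square R) (EFin \o (fun z => u k z - v z)).
    by apply: eq_integrable (integrableB msq (iu k) iv).
  have idg : mu2.-integrable (square R) (EFin \o (fun z => du k ord0 z - g ord0 z)).
    by apply: eq_integrable (integrableB msq (idu k) ig).
  have h1 := trace_one (hu k).1 (iu k) (idu k) ((hu k).2.2 ord0).2 hga gaC m0 x0 xm.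
  have h2 : `|\int[mu2]_(z in square R) ((u k z - v z) * (kernel m x z.1 * ga z.2))| <=
      m * C * \int[mu2]_(z in square R) `|u k z - v z|.
    apply: Rintegral_bound => //; first by case: bkg.
    move=> z; rewrite normrM ler_pM// ger0_norm ?kernel_ge0// kernel_le//.
  have h3 : \int[mu2]_z `|trunc (du k ord0) z * ga z.2| <=
      K + C * \int[mu2]_(z in square R) `|du k ord0 z - g ord0 z|.
    have i1 := integrableM_bounded measurableT (trunc_integrable (idu k)) (bounded_mfun_snd bga).
    have i2 := integrableM_bounded measurableT (trunc_integrable ig) (bounded_mfun_snd bga).
    have i3 := integrable_norm (trunc_integrable idg).
    have i4 : mu2.-integrable setT (EFin \o (fun z => C * `|trunc (fun z => du k ord0 z - g ord0 z) z|)).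
      by have := integrableZl measurableT C i3; exact: eq_integrable.
    rewrite -Rintegral_trunc_norm -(RintegralZl C measurableT i3).
    rewrite /K -(RintegralD measurableT (integrable_norm i2) i4).
    apply: le_Rintegral => //; first exact: integrable_norm.
      by apply: eq_integrable (integrableD measurableT (integrable_norm i2) i4).
    move=> z _; have -> : trunc (du k ord0) z * ga z.2 = trunc (g ord0) z * ga z.2 +
        trunc (fun z => du k ord0 z - g ord0 z) z * ga z.2.
      have [sz|sz] := pselect (square R z); last by rewrite !trunc_out// !mul0r addr0.
      by rewrite !trunc_in// -mulrDl addrC subrK.
    apply: le_trans (ler_normD _ _) _; rewrite lerD2l normrM mulrC ler_wpM2r//.
  have h4 : C * \int[mu]_(t in unit_interval R) `|u k (0, t)| <= C * e by rewrite ler_wpM2l.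
  have h5 : C * \int[mu2]_(z in square R) `|du k ord0 z - g ord0 z| <= C * e by rewrite ler_wpM2l.
  have h6 : m * C * \int[mu2]_(z in square R) `|u k z - v z| <= m * C * e.
    by rewrite ler_wpM2l// mulr_ge0// ltW.
  have h7 : (C + C + m * C + 1) * e = eta by rewrite /e mulrC divfK// gt_eqF.
  apply: (arith _ _ _ _ _ _ _ _ _ _ _ h1 h2 h3 h4 h5 h6).
  by rewrite -h7 !mulrDl mul1r lerDl ltW.
have axn n : x - 4 / n.+1%:R <= x <= x + 4 / n.+1%:R by rewrite gerBl lerDl divr_ge0.
have fo : Filter (nbhs \oo) by exact: eventually_filter.
have h := cvg_norm (kernel_cvg iV Vx axn); move: h => /(_ fo) h.
rewrite -(cvg_lim _ h)//; apply: limr_le; first by apply/cvg_ex; exists `|slice (trunc v) ga x|.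
near=> n; apply: key => //; rewrite -ltrBrDl.
by near: n; apply: near_natSinv_lt => //; lra.
Unshelve. all: end_near. Qed.

End trace.

(** * Variation in a strip *)

Section variation.
Context {R : realType}.
Local Notation mu := (@lebesgue_measure R).
Local Notation mu2 := (leb2 R).

Lemma limn_einf_ge (u : nat -> \bar R) (l : R) :
  (forall e : R, 0 < e -> \forall n \near \oo, ((l - e)%:E <= u n)%E) -> (l%:E <= limn_einf u)%E.
Proof.
move=> h; apply/lee_addgt0Pr => e e0; rewrite limn_einf_lim -leeBlDr//.
apply: lime_ge; first exact: is_cvg_einfs.
have [N _ hN] := h e e0; exists N => // n /= Nn.
by apply: le_ereal_inf_tmp => _ [k /= nk <-]; rewrite -EFinB; apply: hN; exact: leq_trans nk.
Qed.

Lemma limn_einf_le (u : nat -> \bar R) (l : \bar R) :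
  (forall n, (u n <= l)%E) -> (limn_einf u <= l)%E.
Proof.
move=> h; rewrite limn_einf_lim; apply: lime_le; first exact: is_cvg_einfs.
by apply: nearW => n; apply: le_trans (h n); apply: ereal_inf_lbound; exists n => /=.
Qed.

Lemma limn_einf_ge0 (u : nat -> \bar R) : (forall n, (0 <= u n)%E) -> (0 <= limn_einf u)%E.
Proof.
move=> u0; apply: (@limn_einf_ge _ 0) => e e0; apply: nearW => n.
by apply: le_trans (u0 n); rewrite lee_fin sub0r oppr_le0 ltW.
Qed.

Lemma measurable_limn_einf d (T : measurableType d) (f : nat -> T -> \bar R) :
  (forall n, measurable_fun setT (f n)) -> measurable_fun setT (fun x => limn_einf (f ^~ x)).
Proof.
move=> mf; rewrite (_ : (fun x => _) = (fun x => - limn_esup (fun n => - f n x))%E).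
  apply: measurableT_comp => //; apply: measurable_fun_limn_esup => n.
  exact: measurableT_comp.
by apply/funext => x; rewrite -[RHS]/(- limn_esup (-%E \o (f ^~ x)))%E limn_esupN oppeK.
Qed.

(** Built on the same chosen Hahn decomposition as [cintegral], so that the two are compared part by
    part. *)
Definition varm d (T : measurableType d) (nu : {charge set T -> \bar R}) :
    {measure set T -> \bar R} :=
  charge_variation (svalP (cid (svalP (cid (Hahn_decomposition nu))))).

Lemma cintegral_bound d (T : measurableType d) (nu : {charge set T -> \bar R}) (D S : set T)
    (phi : T -> R) : measurable D -> measurable S -> measurable_fun setT phi ->
  (forall z, `|phi z| <= \1_S z) -> (`|cintegral nu D phi| <= varm nu S)%E.
Proof.
move=> mD mS mphi phiS.
have h (m : {measure set T -> \bar R}) : (`|\int[m]_(x in D) (phi x)%:E| <= m S)%E.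
  apply: le_trans (le_abse_integral _ _ _) _ => //.
    by apply/measurable_EFinP; exact: measurable_funTS.
  apply: (@le_trans _ _ (\int[m]_(x in D) (\1_S x)%:E)%E).
    apply: ge0_le_integral => //.
    - by apply/measurable_EFinP; apply: measurableT_comp => //; exact: measurable_funTS.
    - by apply/measurable_EFinP; exact: measurable_indic.
    by move=> x _; rewrite lee_fin.
  by rewrite integral_indic// le_measure// ?inE//; exact: measurableI.
rewrite /cintegral /varm /=; set nuPN := svalP _.
apply: le_trans (lee_abs_sub _ _) _.
by apply: leeD; exact: h.
Qed.

Lemma C1c_spl (m a : R) : 0 < m -> 0 < a -> a + 4 / m < 1 ->
  C1c (fun y => spl 3 (m * (y - a))) (fun y => m * spl 2 (m * (y - a))).
Proof.
move=> m0 a0 a1; split; first by move=> t; exact: is_derive_scaled.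
  by move=> y; apply: cvgMr; exact: continuous_scaled.
exists a, (a + 4 / m); split => // t h.
have h' : ~ (0 < m * (t - a) < 4).
  move=> /andP[h1 h2]; apply: h.
  rewrite pmulr_rgt0// in h1; rewrite -ltr_pdivlMl// mulrC in h2.
  by apply/andP; split; lra.
by rewrite !spl_out// mulr0.
Qed.

Lemma ae_finforall (I : finType) (P : I -> R -> Prop) :
  (forall i, {ae mu, forall x, P i x}) -> {ae mu, forall x, forall i, P i x}.
Proof.
move=> h.
have : {ae mu, forall x, forall i, i \in enum I -> P i x}.
  elim: (enum I) => [|j s ih]; first exact: aeW.
  apply: ae_imp (ae_and (h j) ih) _ => x [hj hs] i; rewrite inE => /orP[/eqP->//|].
  exact: hs.
by move/ae_imp; apply => x + i; apply; rewrite mem_enum.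
Qed.

Section family.
Variables (I : finType) (i0 : I) (b b' : I -> R -> R) (J : set R).
Variables (g : plane R -> R) (nu : {charge set (plane R) -> \bar R}).
Hypotheses (hb : forall i, C1c (b i) (b' i)) (b0 : forall y, b' i0 y = 0).
Hypotheses (mJ : measurable (J : set (measurableTypeR R)))
  (bJ : forall i y, `|b i y| <= \1_J y).
Hypothesis ig : mu2.-integrable (square R) (EFin \o g).
Hypothesis gnu : forall phi : R * R -> R, test_fun phi ->
  (\int[mu2]_(x in square R) (g x * 'D_(evec R ord_max) phi x)%:E
   = - cintegral nu (square R) phi)%E.

(** The [n] bumps start at [1 / N n, ..., n / N n] and have width [4 / N n]; the last one thus ends
    at [(n + 4) / (n + 6)], inside the interval. *)
Let N n : R := (n + 6)%:R.
Let N0 n : 0 < N n. Proof. by rewrite ltr0n addn_gt0 orbT. Qed.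
Let pos n (k : 'I_n) : R := k.+1%:R / N n.
Let val n (k : 'I_n) i : R := \int[mu]_x (slice (trunc g) (b' i) x * kernel (N n) (pos k) x).
Let best n (k : 'I_n) : I := [arg max_(i > i0) val k i]%O.
Let w n (k : 'I_n) : R := val k (best k).
Let cell n (k : 'I_n) : set (measurableTypeR R) := `[pos k, pos k + (N n)^-1[.
Let A n (x : measurableTypeR R) : \bar R := (\sum_(k < n) (w k)%:E * (\1_(cell k) x)%:E)%E.

Let val_le n (k : 'I_n) i : val k i <= w k.
Proof. by rewrite /w /best; case: arg_maxP => [|j _ h]; [|exact: h]. Qed.

(** The index [i0], whose bump has zero derivative, is a competitor of value 0. *)
Let w_ge0 n (k : 'I_n) : 0 <= w k.
Proof.
apply: le_trans (val_le k i0); rewrite /val /slice.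
rewrite (_ : (fun x => _) = cst 0) ?Rintegral_cst ?mul0r//.
apply/funext => x /=; rewrite (_ : (fun y => _) = cst 0) ?Rintegral_cst ?mul0r//.
by apply/funext => y; rewrite /= b0 mulr0.
Qed.

(** The integral is the sum of the [w k / N n]. As [kernel] is [N n] times a bump, this sum is the
    pairing of [g] with the derivative in [x_2] of the single test function [phi]. *)
Let int_A n : (\int[mu]_x A n x <= varm nu (unit_interval R `*` J))%E.
Proof.
have mA (k : 'I_n) : measurable (cell k) by exact: measurable_itv.
have mcell (k : 'I_n) : mu (cell k) = ((N n)^-1)%:E.
  rewrite /cell lebesgue_measure_itv/= lte_fin ltrDl invr_gt0 N0.
  by rewrite -EFinB addrAC subrr add0r.
rewrite ge0_integral_sum//; last 2 first.
- by move=> k; apply: measurable_funeM; apply/measurable_EFinP; exact: measurable_indic.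
- by move=> k x _; rewrite mule_ge0 ?lee_fin.
have -> : (\sum_(k < n) \int[mu]_x ((w k)%:E * (\1_(cell k) x)%:E) =
   (\sum_(k < n) w k / N n)%:E)%E.
  rewrite -sumEFin; apply: eq_bigr => k _.
  rewrite ge0_integralZl_EFin//; last by apply/measurable_EFinP; exact: measurable_indic.
  rewrite EFinM -(mcell k); congr (_ * _)%E.
  by rewrite integral_indic// setIT.
pose phik (k : 'I_n) (z : R * R) := spl 3 (N n * (z.1 - pos k)) * b (best k) z.2.
have posk (k : 'I_n) : 0 < pos k /\ pos k + 4 / N n < 1.
  split; first by rewrite divr_gt0.
  rewrite /pos -mulrDl ltr_pdivrMr// mul1r /N natrD -natr1.
  by have : (k%:R + 1 <= n%:R :> R) by [rewrite natr1 ler_nat]; lra.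
have ck (k : 'I_n) := C1c_spl (N0 n) (posk k).1 (posk k).2.
have hk (k : 'I_n) := C1c_prod (ck k) (hb (best k)).
have tk (k : 'I_n) : test_fun (phik k) by have [] := hk k.
pose phi z := \sum_(k <- index_enum 'I_n) phik k z.
have tphi : test_fun phi := test_fun_sum (index_enum 'I_n) tk.
have := gnu tphi.
have ik (k : 'I_n) : mu2.-integrable (square R)
    (EFin \o (fun z => g z * (spl 3 (N n * (z.1 - pos k)) * b' (best k) z.2))).
  apply: integrableM_bounded => //; first exact: measurable_square.
  exact: (bounded_mfunM (bounded_mfun_fst (C1c_bounded (ck k)).1)
    (bounded_mfun_snd (C1c_bounded (hb (best k))).2)).
have -> : (\int[mu2]_(x in square R) (g x * 'D_(evec R ord_max) phi x)%:E = (\sum_(k < n) w k / N n)%:E)%E.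
  under eq_integral => z _.
    rewrite derive_test_sum// mulr_sumr -sumEFin.
    under eq_bigr => k _ do rewrite (let: And3 _ _ h := hk k in h z).
    over.
  rewrite integral_sum//; last exact: measurable_square.
  rewrite -sumEFin; apply: eq_bigr => k _.
  rewrite -(fineK (integrable_fin_num _ (ik k)))//; last exact: measurable_square.
  congr (_%:E).
  rewrite -[fine _]/(Rintegral _ _ _) Rintegral_square.
  have [bs _] := C1c_bounded (ck k); have [_ bb] := C1c_bounded (hb (best k)).
  rewrite -(slice_fubini (trunc_integrable ig) bs bb).
  have ims := integrableM_bounded measurableT
    (slice_integrable (trunc_integrable ig) bb) (bounded_kernel (pos k) (N0 n)).
  rewrite /w /val -RintegralZr//.
  apply: eq_Rintegral => x _; rewrite /kernel; field.
  by rewrite gt_eqF.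
move=> h.
rewrite -(gee0_abs (_ : 0 <= (\sum_(k < n) w k / N n)%:E)%E); last first.
  by rewrite lee_fin sumr_ge0// => k _; rewrite divr_ge0// ltW.
rewrite h abseN; apply: cintegral_bound.
- exact: measurable_square.
- by apply: measurableX => //; exact: measurable_itv.
- apply: measurable_sum => k.
  by case: (bounded_mfunM (bounded_mfun_fst (C1c_bounded (ck k)).1)
    (bounded_mfun_snd (C1c_bounded (hb (best k))).1)).
move=> [x y]; rewrite /phi /phik/=.
apply: le_trans (ler_norm_sum _ _ _) _.
have [x01|x01] := pselect (0 < x < 1); last first.
  rewrite big1 => [|k _]; first by rewrite indicE.
  case: (ck k) => _ _ [p [q [p0 q1 out]]].
  by rewrite (out x _).1 ?mul0r ?normr0// => /andP[? ?]; apply: x01; apply/andP; split; lra.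
apply: (@le_trans _ _ (\sum_(k < n) spl 3 (N n * x - 1 - k%:R) * \1_J y)).
  apply: ler_sum => k _; rewrite normrM.
  rewrite /pos mulrBr mulrCA divff ?gt_eqF// mulr1 -natr1 opprD addrA addrAC.
  have /andP[s0 _] := spl3_01 (N n * x - 1 - k%:R).
  by rewrite ger0_norm// ler_wpM2l.
rewrite -mulr_suml.
have -> : \1_(unit_interval R `*` J) (x, y) = \1_J y :> R.
  rewrite !indicE; congr (nat_of_bool _)%:R; apply/idP/idP; rewrite !inE.
    by case.
  by move=> Jy; split => //=; rewrite /unit_interval /= in_itv.
by rewrite ler_piMl ?indic_ge0// spl_sum_le1.
Qed.

(* The measure of the strip is tested with sums of products of a bump in [x_1] and of the [b i]
   whose pairing is maximal near that bump; these are bounded by 1 as the bumps are dominated by a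
   partition of unity. [H] is the lim inf of the maxima as the bumps concentrate. *)
Lemma family_variation : exists H : measurableTypeR R -> \bar R,
  [/\ measurable_fun setT H, forall x, (0 <= H x)%E,
      (\int[mu]_x H x <= varm nu (unit_interval R `*` J))%E &
      {ae mu, forall x, 0 < x < 1 -> forall i, ((slice (trunc g) (b' i) x)%:E <= H x)%E}].
Proof.
have mA n : measurable_fun setT (A n).
  apply: emeasurable_sum => k; apply: measurable_funeM; apply/measurable_EFinP.
  by apply: measurable_indic; exact: measurable_itv.
have A0 n x : (0 <= A n x)%E by apply: sume_ge0 => k _; rewrite mule_ge0 ?lee_fin.
exists (fun x => limn_einf (A ^~ x)); split.
- exact: measurable_limn_einf.
- by move=> x; exact: limn_einf_ge0.
- apply: le_trans (fatou mu measurableT mA (fun n x _ => A0 n x)) _.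
  exact: limn_einf_le.
have bb i : @bounded_mfun R _ (measurableTypeR R) (b' i) by case: (C1c_bounded (hb i)).
have ims i := slice_integrable (trunc_integrable ig) (bb i).
have aept : {ae mu, forall x, forall i, lebesgue_pt (slice (trunc g) (b' i)) x}.
  by apply: ae_finforall => i; exact: ae_lebesgue_pt.
apply: ae_imp aept _ => x hx /andP[x0 x1] i.
(* The left end of the cell of mesh [1 / n.+1] that contains [x]. It is used at index [n + 5], where
   the mesh is [1 / N n] and [a] is one of the positions [pos k]. *)
pose a n := (Num.truncn (n.+1%:R * x))%:R / n.+1%:R : R.
have ha n : a n <= x < a n + n.+1%:R^-1.
  have /truncn_itv/andP[t1 t2] : 0 <= n.+1%:R * x by rewrite mulr_ge0// ltW.
  rewrite /a; apply/andP; split; first by rewrite ler_pdivrMr// [leRHS]mulrC.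
  by rewrite -[X in _ + X]mul1r -mulrDl ltr_pdivlMr// [ltLHS]mulrC natr1.
have aok n : x - 4 / n.+1%:R <= a n <= x + 4 / n.+1%:R.
  have /andP[h1 h2] := ha n.
  have n0 : 0 < n.+1%:R^-1 :> R by rewrite invr_gt0.
  by move: h1 h2 n0; move: (a n) (n.+1%:R^-1) => c z *; apply/andP; split; lra.
have cv := kernel_cvg (ims i) (hx i) aok.
apply: limn_einf_ge => e e0.
move/cvgrPdist_le : cv => /(_ e e0)[M _ hM].
have c0 : 0 < 6 / (1 - x) by rewrite divr_gt0// subr_gt0.
near=> n.
(* This and [nx] make the cell index [k] of [x] satisfy [1 <= k <= n]; the cells next to the two
   ends of the interval carry no bump. *)
have xn : 1 <= n%:R * x by rewrite -ler_pdivrMr//; near: n; exact: nbhs_infty_ger.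
have nx : 6 <= n%:R * (1 - x).
  by rewrite -ler_pdivrMr ?subr_gt0//; near: n; exact: nbhs_infty_ger.
have Mn : (M <= n + 5)%N by apply: leq_trans (leq_addr _ _); near: n; exists M.
have {hM} := hM _ Mn; have /= := ha (n + 5)%N; rewrite /a -addnS.
have Nx : 1 <= (n + 6)%:R * x /\ (n + 6)%:R * x < n%:R + 1 by rewrite natrD; nra.
have /truncn_itv/andP[t1 t2] : 0 <= (n + 6)%:R * x by lra.
move: t1 t2; set k := Num.truncn _ => t1 t2 hax.
have k0 : (0 < k)%N.
  by rewrite lt0n; apply: contraTN t2 => /eqP->; rewrite -leNgt; lra.
have kn : (k.-1 < n)%N.
  rewrite prednK// -ltnS -(ltr_nat R) -natr1; lra.
pose k' := Ordinal kn.
have -> : k%:R / (n + 6)%:R = pos k' by rewrite /pos /= prednK.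
have xk : cell k' x.
  by rewrite /cell /= in_itv/= /pos/= prednK.
rewrite ler_distl => /andP[_ hv].
have hw := le_trans hv (lerD (val_le k' i) (lexx e)).
apply: (@le_trans _ _ ((w k')%:E * (\1_(cell k') x)%:E)%E).
  by rewrite indicE mem_set// mule1 lee_fin; lra.
rewrite /A (bigD1 k')//= leeDl// sume_ge0// => j _.
by rewrite mule_ge0 ?lee_fin.
Unshelve. all: end_near. Qed.

End family.
End variation.

(** * Oscillation on almost every segment *)

Section oscillation.
Context {R : realType}.
Local Notation mu := (@lebesgue_measure R).
Local Notation mu2 := (leb2 R).

Definition grid n (x : R) : R := (Num.truncn (n.+1%:R * x))%:R / n.+1%:R.

Lemma grid_itv n x : 0 <= x -> grid n x <= x < grid n x + n.+1%:R^-1.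
Proof.
move=> x0; have /truncn_itv/andP[t1 t2] : 0 <= n.+1%:R * x by rewrite mulr_ge0.
rewrite /grid; apply/andP; split; first by rewrite ler_pdivrMr// [leRHS]mulrC.
by rewrite -[X in _ + X]mul1r -mulrDl ltr_pdivlMr// [ltLHS]mulrC natr1.
Qed.

Lemma grid_near n x : 0 <= x -> x - 4 / n.+1%:R <= grid n x <= x + 4 / n.+1%:R.
Proof.
move=> x0; have /andP[h1 h2] := grid_itv n x0.
have n0 : 0 < n.+1%:R^-1 :> R by rewrite invr_gt0.
by move: h1 h2 n0; move: (grid n x) (n.+1%:R^-1) => c z *; apply/andP; split; lra.
Qed.

Variables (a b : R) (a0 : 0 <= a) (b1 : b <= 1).
Variables (g : plane R -> R) (nu : {charge set (plane R) -> \bar R}).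
Hypothesis ig : mu2.-integrable (square R) (EFin \o g).
Hypothesis gnu : forall phi : R * R -> R, test_fun phi ->
  (\int[mu2]_(x in square R) (g x * 'D_(evec R ord_max) phi x)%:E
   = - cintegral nu (square R) phi)%E.

Let valid M (i : 'I_M.+1) := (a < i%:R / M.+1%:R) && (i%:R / M.+1%:R + 4 / M.+1%:R < b).

(** The derivative of a difference of two ramps is a difference of two kernels, so its pairing with
    [g] compares averages near two points, while the bump itself has modulus at most 1. Invalid
    pairs get the zero function, so that the family is indexed by all pairs. *)
Let bump M (i : 'I_M.+1 * 'I_M.+1) (y : R) : R :=
  if valid i.1 && valid i.2
  then ramp M.+1%:R (i.1%:R / M.+1%:R) y - ramp M.+1%:R (i.2%:R / M.+1%:R) y else 0.

Let dbump M (i : 'I_M.+1 * 'I_M.+1) (y : R) : R :=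
  if valid i.1 && valid i.2
  then kernel M.+1%:R (i.1%:R / M.+1%:R) y - kernel M.+1%:R (i.2%:R / M.+1%:R) y else 0.

Let bump_C1c M (i : 'I_M.+1 * 'I_M.+1) : C1c (bump i) (dbump i).
Proof.
rewrite /bump /dbump; case: (boolP (valid i.1 && valid i.2)) => [/andP[/andP[h1 h2] /andP[h3 h4]]|_].
  apply: C1c_ramps => //.
  - exact: le_lt_trans a0 h1.
  - exact: le_lt_trans a0 h3.
  - exact: lt_le_trans h2 b1.
  - exact: lt_le_trans h4 b1.
split.
- by move=> t; exact: is_derive_cst.
- exact: cst_continuous.
- by exists (1 / 2), (1 / 2); split => //; lra.
Qed.

Let bump_supp M (i : 'I_M.+1 * 'I_M.+1) y : `|bump i y| <= \1_(`]a, b[%classic : set R) y.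
Proof.
rewrite /bump; case: (boolP (valid i.1 && valid i.2)) => [/andP[/andP[h1 h2] /andP[h3 h4]]|_]; last by rewrite normr0.
have [yab|yab] := pselect (a < y < b).
  rewrite indicE mem_set/= ?in_itv//.
  have /andP[? ?] := ramp_01 M.+1%:R (i.1%:R / M.+1%:R) y.
  have /andP[? ?] := ramp_01 M.+1%:R (i.2%:R / M.+1%:R) y.
  by rewrite ler_norml; apply/andP; split; lra.
have [ya|ya] := leP y a.
  by rewrite !ramp_le0 ?subrr ?normr0//; apply: (le_trans ya); exact: ltW.
have yb : b <= y by rewrite leNgt; apply/negP => yb; apply: yab; rewrite ya.
by rewrite !ramp_ge1 ?subrr ?normr0//; apply: le_trans yb; exact: ltW.
Qed.

(** For each mesh there are finitely many pairs of grid points, as the choice of a maximum requires.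
    A pair of Lebesgue points is approached by grid pairs as the mesh tends to 0, and Fatou's lemma
    keeps the bound of the integral. *)
Lemma slice_oscillation : exists H : measurableTypeR R -> \bar R,
  [/\ measurable_fun setT H, forall x, (0 <= H x)%E,
      (\int[mu]_x H x <= varm nu (unit_interval R `*` `]a, b[%classic))%E &
      {ae mu, forall x, 0 < x < 1 -> forall y y', a < y < b -> a < y' < b ->
         lebesgue_pt (fun t => trunc g (x, t)) y -> lebesgue_pt (fun t => trunc g (x, t)) y' ->
         (`|trunc g (x, y) - trunc g (x, y')|%:E <= H x)%E}].
Proof.
have mab : measurable (`]a, b[%classic : set (measurableTypeR R)) by exact: measurable_itv.
have b00 M y : dbump (ord0 : 'I_M.+1, ord0) y = 0.
  by rewrite /dbump /= subrr; case: ifP.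
have /choice[H hH] M := @family_variation R _ (ord0 : 'I_M.+1, ord0) (@bump M) (@dbump M)
  `]a, b[%classic g nu (@bump_C1c M) (b00 M) mab (@bump_supp M) ig gnu.
have mH M : measurable_fun setT (H M) by case: (hH M).
have H0 M x : (0 <= H M x)%E by case: (hH M).
exists (fun x => limn_einf (H ^~ x)); split.
- exact: measurable_limn_einf.
- by move=> x; exact: limn_einf_ge0.
- apply: le_trans (fatou mu measurableT mH (fun n x _ => H0 n x)) _.
  by apply: limn_einf_le => M; case: (hH M).
have aeH : {ae mu, forall x, forall M, 0 < x < 1 -> forall i,
    ((slice (trunc g) (@dbump M i) x)%:E <= H M x)%E}.
  by apply/ae_foralln => M; case: (hH M).
apply: ae_imp (ae_and aeH (ae_integrable1 (trunc_integrable ig))) _ => x [hx ix] x01.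
suff key y y' : a < y < b -> a < y' < b ->
    lebesgue_pt (fun t => trunc g (x, t)) y -> lebesgue_pt (fun t => trunc g (x, t)) y' ->
    ((trunc g (x, y) - trunc g (x, y'))%:E <= limn_einf (H ^~ x))%E.
  move=> y y' hy hy' py py'.
  have [h|h] := leP 0 (trunc g (x, y) - trunc g (x, y')).
    by rewrite ger0_norm//; exact: key.
  by rewrite ltr0_norm// opprB; exact: key.
move=> /andP[ay yb] /andP[ay' yb'] py py'.
have y0 : 0 <= y by exact: le_trans (ltW ay).
have y0' : 0 <= y' by exact: le_trans (ltW ay').
have cv := kernel_cvg ix py (fun n => grid_near n y0).
have cv' := kernel_cvg ix py' (fun n => grid_near n y0').
apply: limn_einf_ge => e e0.
have e20 : 0 < e / 2 by rewrite divr_gt0.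
move/cvgrPdist_le : cv => /(_ _ e20) cv; move/cvgrPdist_le : cv' => /(_ _ e20) cv'.
have dpos : 0 < Num.min (Num.min (y - a) (b - y)) (Num.min (y' - a) (b - y')).
  by rewrite !lt_min !subr_gt0 ay yb ay' yb'.
near=> n.
have n4 : 4 / n.+1%:R < Num.min (Num.min (y - a) (b - y)) (Num.min (y' - a) (b - y')).
  by near: n; exact: near_natSinv_lt.
(* Once [4 / n.+1] is below the distances of the two points to [a] and [b], the kernels placed on
   the grid have their supports inside the segment. *)
have vld z : a < z -> z < b -> 4 / n.+1%:R < z - a -> 4 / n.+1%:R < b - z ->
    exists2 i : 'I_n.+1, valid i & grid n z = i%:R / n.+1%:R.
  move=> az zb za bz; have z0 : 0 <= z by exact: le_trans (ltW az).
  have nz0 : 0 <= n.+1%:R * z by rewrite mulr_ge0.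
  have tn : (Num.truncn (n.+1%:R * z) < n.+1)%N.
    have /truncn_itv/andP[t1 _] := nz0.
    rewrite -(ltr_nat R); apply: le_lt_trans t1 _.
    by rewrite gtr_pMr//; exact: lt_le_trans zb b1.
  exists (Ordinal tn) => //; rewrite /valid /= -/(grid n z).
  have /andP[g1 g2] := grid_itv n z0.
  have n0 : 0 < n.+1%:R^-1 :> R by rewrite invr_gt0.
  by move: g1 g2 za bz n0; move: (grid n z) (n.+1%:R^-1) => c w *; apply/andP; split; lra.
move: n4; rewrite !lt_min => /andP[/andP[n1 n2] /andP[n3 n4]].
have [i vi gi] := vld y ay yb n1 n2.
have [j vj gj] := vld y' ay' yb' n3 n4.
have := hx n x01 (i, j); apply: le_trans.
rewrite lee_fin /slice /dbump /= vi vj /= -gi -gj.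
have bi := @bounded_kernel R n.+1%:R (grid n y) (ltr0Sn _ _).
have bj := @bounded_kernel R n.+1%:R (grid n y') (ltr0Sn _ _).
under eq_Rintegral do rewrite mulrBr.
rewrite RintegralB//; last 2 first.
- exact: (integrableM_bounded measurableT ix bi).
- exact: (integrableM_bounded measurableT ix bj).
have : `|trunc g (x, y) - \int[mu]_t (trunc g (x, t) * kernel n.+1%:R (grid n y) t)| <= e / 2.
  by near: n.
have : `|trunc g (x, y') - \int[mu]_t (trunc g (x, t) * kernel n.+1%:R (grid n y') t)| <= e / 2.
  by near: n.
rewrite !ler_norml => /andP[l1 l2] /andP[l3 l4].
by move: l1 l2 l3 l4; move: (trunc g (x, y)) (trunc g (x, y')) (Rintegral _ _ _) (Rintegral _ _ _) => *; lra.
Unshelve. all: end_near. Qed.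

End oscillation.

(** * The lower bound *)

Section slice_lower.
Context {R : realType}.
Local Notation mu := (@lebesgue_measure R).
Implicit Types (p th t : R).

Definition well p th t : R := Num.min (`|t + th| `^ p) (`|t - (1 - th)| `^ p).

Lemma well_ge0 p th t : 0 <= well p th t.
Proof. by rewrite /well le_min !powR_ge0. Qed.

Lemma measurable_well p th : measurable_fun setT (well p th : measurableTypeR R -> R).
Proof.
apply: measurable_minr.
  apply: (measurableT_comp (measurable_powR p)); apply: measurableT_comp => //.
  exact: measurable_funD.
apply: (measurableT_comp (measurable_powR p)); apply: measurableT_comp => //.
exact: measurable_funB.
Qed.

(** The wells are [- th] and [1 - th], and their midpoint is [1 / 2 - th]. *)
Lemma well_left p th t : 0 < p -> t <= 1 / 2 - th -> well p th t = `|t + th| `^ p.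
Proof.
move=> p0 h; rewrite /well min_l//; apply: ge0_ler_powR; rewrite ?nnegrE ?(ltW p0)//.
rewrite (ler0_norm (_ : t - (1 - th) <= 0)); last lra.
by rewrite ler_norml; apply/andP; split; lra.
Qed.

Lemma well_right p th t : 0 < p -> 1 / 2 - th <= t -> well p th t = `|t - (1 - th)| `^ p.
Proof.
move=> p0 h; rewrite /well min_r//; apply: ge0_ler_powR; rewrite ?nnegrE ?(ltW p0)//.
rewrite (ger0_norm (_ : 0 <= t + th)); last lra.
by rewrite ler_norml; apply/andP; split; lra.
Qed.

(** The factor [th ^ (1 - p)] makes the cost of a deviation of order [th] again of order [th]. The
    factor [8 ^ p] suffices both near a well, for deviations above [th / 4], and at distance at
    least [1 / 4] from both wells. *)
Definition penalty p th t : R := 8 `^ p * th `^ (1 - p) * well p th t.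

Lemma penalty_ge0 p th t : 0 <= penalty p th t.
Proof. by rewrite /penalty !mulr_ge0 ?powR_ge0 ?well_ge0. Qed.

Lemma le_quarter p th t : 1 < p -> 0 < th -> `|t| <= th / 4 + 8 `^ p * th `^ (1 - p) * `|t| `^ p.
Proof.
move=> p1 th0; have [h|h] := leP `|t| (th / 4).
  by rewrite ler_wpDr// !mulr_ge0 ?powR_ge0.
have th4 : 0 < th / 4 by rewrite divr_gt0.
have t0 : 0 < `|t| by exact: lt_trans h.
rewrite ler_wpDl ?(ltW th4)//.
have -> : `|t| `^ p = `|t| `^ (p - 1) * `|t|.
  rewrite -[X in _ = _ * X](powRr1 (ltW t0)) -powRD ?subrK//.
  by rewrite (gt_eqF t0) implybT.
rewrite mulrA ler_peMl// ?(ltW t0)//.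
have p10 : 0 <= p - 1 by lra.
rewrite (_ : 1 - p = - (p - 1)) ?powRN; last lra.
rewrite mulrAC ler_pdivlMr ?powR_gt0// mul1r.
apply: (@le_trans _ _ (8 `^ (p - 1) * `|t| `^ (p - 1))).
  by rewrite -powRM//; apply: ge0_ler_powR; rewrite ?nnegrE//; lra.
by rewrite ler_wpM2r ?powR_ge0// ler_powR//; lra.
Qed.

Lemma slice_lower p th (f be : R -> R) (a b : R) (h : \bar R) :
  1 < p -> 0 < th -> th <= 1 / 2 ->
  mu.-integrable setT (EFin \o f) ->
  @bounded_mfun R _ (measurableTypeR R) be -> (forall y, 0 <= be y) ->
  (forall y, ~ (a < y < b) -> be y = 0) ->
  mu.-integrable setT (EFin \o be) -> (\int[mu]_y be y = 1) -> (0 <= h)%E ->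
  (forall y y', a < y < b -> a < y' < b -> lebesgue_pt f y -> lebesgue_pt f y' ->
    (`|f y - f y'|%:E <= h)%E) ->
  ((3 / 4 * th)%:E <= `|\int[mu]_y (f y * be y)|%:E +
     \int[mu]_y (penalty p th (f y) * be y)%:E + (4 * th)%:E * h)%E.
Proof.
move=> p1 th0 th12 intf bbe be0 beout ibe be1 h0 osc.
have p0 : 0 < p by lra.
have mf : measurable_fun setT f by apply/measurable_EFinP; exact: measurable_int intf.
have mpen : measurable_fun setT (fun y => penalty p th (f y) * be y).
  apply: measurable_funM; last by case: bbe.
  apply: measurable_funM => //.
  exact: (measurableT_comp (measurable_well p th)).
have pen0 y : 0 <= penalty p th (f y) * be y by rewrite mulr_ge0// penalty_ge0.
have ip0 : (0 <= \int[mu]_y (penalty p th (f y) * be y)%:E)%E.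
  by apply: integral_ge0 => y _; rewrite lee_fin.
(* With oscillation at least [1 / 4], the last term alone is at least [th]. *)
have [h14|h14] := leP (4^-1)%:E h.
  apply: (@le_trans _ _ ((4 * th)%:E * h)%E).
    apply: (@le_trans _ _ ((4 * th)%:E * (4^-1)%:E)%E).
      by rewrite -EFinM lee_fin; lra.
    by rewrite lee_wpmul2l// lee_fin; lra.
  by rewrite leeDr// adde_ge0.
(* [s] is -1, 1 or 0 according as [f] stays on the side of [- th], on the side of [1 - th], or away
   from both wells. The pointwise inequality is linear in [f], so it can be averaged against
   [be]. *)
suff [s s1 hs] : exists2 s : R, `|s| <= 1 & forall y, a < y < b -> lebesgue_pt f y ->
    3 / 4 * th - s * f y <= penalty p th (f y).
  have ifb := integrableM_bounded measurableT intf bbe.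
  have key : ((3 / 4 * th - s * \int[mu]_y (f y * be y))%:E <=
      \int[mu]_y (penalty p th (f y) * be y)%:E)%E.
    have i1 := integrableZl measurableT (3 / 4 * th) ibe.
    have i2 := integrableZl measurableT s ifb.
    have i3 : mu.-integrable setT (EFin \o (fun y => 3 / 4 * th * be y - s * (f y * be y))).
      exact: eq_integrable (integrableB measurableT i1 i2).
    have -> : 3 / 4 * th - s * \int[mu]_y (f y * be y) =
        \int[mu]_y (3 / 4 * th * be y - s * (f y * be y)).
      rewrite RintegralB//.
      by rewrite !RintegralZl// be1 mulr1.
    rewrite /Rintegral fineK; last exact: integrable_fin_num i3.
    (* The comparison of integrals is between nonnegative functions that are ordered almost
       everywhere; hence the positive part. *)
    apply: (@le_trans _ _ (\int[mu]_y (Num.max (3 / 4 * th * be y - s * (f y * be y)) 0)%:E)%E).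
      have m3 : measurable_fun setT (fun y => 3 / 4 * th * be y - s * (f y * be y)).
        by apply/measurable_EFinP; exact: measurable_int i3.
      apply: le_integral => //.
        apply: le_integrable i3 => //.
          by apply/measurable_EFinP; exact: measurable_maxr.
        move=> y _ /=; rewrite lee_fin.
        by have [w|w] := leP 0 (3 / 4 * th * be y - s * (f y * be y)); rewrite ?normr0.
      by move=> y _; rewrite lee_fin le_max lexx.
    apply: ae_ge0_le_integral => //.
    - by move=> y _; rewrite lee_fin le_max lexx orbT.
    - apply/measurable_EFinP; apply: measurable_maxr => //.
      by apply/measurable_EFinP; exact: measurable_int i3.
    - by move=> y _; rewrite lee_fin.
    - exact/measurable_EFinP.
    apply: ae_imp (ae_lebesgue_pt intf) _ => y py _.
    rewrite lee_fin ge_max pen0 andbT.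
    have [yab|yab] := pselect (a < y < b); last by rewrite beout// !mulr0 subrr.
    by rewrite mulrA -mulrBl ler_wpM2r// hs.
  have : 3 / 4 * th <= `|\int[mu]_y (f y * be y)| + (3 / 4 * th - s * \int[mu]_y (f y * be y)).
    suff : s * \int[mu]_y (f y * be y) <= `|\int[mu]_y (f y * be y)| by lra.
    by apply: le_trans (ler_norm _) _; rewrite normrM ler_piMl.
  rewrite -lee_fin EFinD => /le_trans; apply.
  by rewrite -addeA leeD2l// (le_trans key)// leeDl// mule_ge0// lee_fin; lra.
have osc' y y' : a < y < b -> a < y' < b -> lebesgue_pt f y -> lebesgue_pt f y' ->
    `|f y - f y'| <= 4^-1.
  by move=> *; rewrite -lee_fin; apply: le_trans (ltW h14); exact: osc.
have [[y0 [y0ab py0 hy0]]|hleft] :=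
    pselect (exists y0, [/\ a < y0 < b, lebesgue_pt f y0 & f y0 < 1 / 4 - th]).
  exists (-1); first by rewrite normrN1.
  move=> y yab py; have := osc' _ _ yab y0ab py py0; rewrite ler_norml => /andP[_ o2].
  rewrite /penalty well_left//; last by lra.
  have := le_quarter (f y + th) p1 th0; have := ler_norm (f y + th); lra.
have [[y0 [y0ab py0 hy0]]|hright] :=
    pselect (exists y0, [/\ a < y0 < b, lebesgue_pt f y0 & 3 / 4 - th < f y0]).
  exists 1; first by rewrite normr1.
  move=> y yab py; have := osc' _ _ yab y0ab py py0; rewrite ler_norml => /andP[+ _] => o2.
  rewrite /penalty well_right//; last by lra.
  (* Near the right well the bound starts from [1 - th], which is at least [th] because
     [th <= 1 / 2]. *)
  have := le_quarter (f y - (1 - th)) p1 th0; have := ler_norm (- (f y - (1 - th))).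
  rewrite normrN; lra.
exists 0; first by rewrite normr0 ler01.
move=> y yab py; rewrite mul0r subr0.
have f1 : 1 / 4 - th <= f y by rewrite leNgt; apply/negP => ?; apply: hleft; exists y.
have f2 : f y <= 3 / 4 - th by rewrite leNgt; apply/negP => ?; apply: hright; exists y.
have w : (4^-1) `^ p <= well p th (f y).
  rewrite /well le_min; apply/andP; split; apply: ge0_ler_powR; rewrite ?nnegrE ?(ltW p0)//.
    by rewrite ler_normr; apply/orP; left; lra.
  by rewrite ler_normr; apply/orP; right; lra.
rewrite /penalty; apply: (@le_trans _ _ (8 `^ p * th `^ (1 - p) * 4^-1 `^ p)); last first.
  by rewrite ler_wpM2l// mulr_ge0 ?powR_ge0.
rewrite [leRHS]mulrAC -powRM// (_ : 8 / 4 = 2); last lra.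
have th1 : th `^ p <= 1.
  by apply: (@le_trans _ _ th); [apply: ge1r_powR|]; lra.
have tw : 1 <= 2 `^ p :> R by rewrite -[leLHS](powRr0 2); apply: ler_powR; lra.
have {1}-> : th = th `^ p * th `^ (1 - p).
  by rewrite -powRD ?(gt_eqF th0) ?implybT// addrCA subrr addr0 powRr1// ltW.
rewrite mulrA ler_wpM2r ?powR_ge0//; nra.
Qed.

End slice_lower.

Section lower.
Context {R : realType}.
Local Notation mu := (@lebesgue_measure R).
Local Notation mu2 := (leb2 R).

(** Two pieces suffice: those cut out of [A] by a Hahn decomposition of one entry. On each of them,
    the entry is at most the Frobenius norm of the matrix. *)
Lemma varm_le_total_variation d (T : measurableType d) (m n : nat)
    (nu : 'I_m -> 'I_n -> {charge set T -> \bar R}) (i : 'I_m) (j : 'I_n) (A : set T) :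
  measurable A -> (varm (nu i j) A <= Defs.total_variation nu A)%E.
Proof.
move=> mA; suff h P N (nuPN : hahn_decomposition (nu i j) P N) :
  (charge_variation nuPN A <= Defs.total_variation nu A)%E by exact: h.
have [[mP posP] [mN negN] PUN PIN] := nuPN.
pose E k := if k is 0 then A `&` P else if k is 1%N then A `&` N else set0.
have mE k : measurable (E k).
  by case: k => [|[|k]] /=; [exact: measurableI|exact: measurableI|exact: measurable0].
have UE : \bigcup_k E k = A.
  apply/seteqP; split=> [z [k _]|z Az].
    by case: k => [|[|k]] //= [].
  have : (P `|` N) z by rewrite PUN.
  by case=> ?; [exists 0%N|exists 1%N].
have tE : trivIset setT E.
  apply/trivIsetP => k l _ _; case: k => [|[|k]]; case: l => [|[|l]] //= _;
    rewrite ?set0I ?setI0// setIACA setIid ?PIN ?setI0//.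
  by rewrite [N `&` P]setIC PIN setI0.
pose F k := Num.sqrt (\sum_i \sum_j fine (nu i j (E k)) ^+ 2).
apply: (@le_trans _ _ (\sum_(0 <= k <oo) (F k)%:E)%E); last first.
  by apply: ereal_sup_ubound; exists E.
apply: (@le_trans _ _ (\sum_(0 <= k < 2) (F k)%:E)%E); last first.
  by apply: nneseries_lim_ge => k _ _; rewrite lee_fin sqrtr_ge0.
have hF k : `|fine (nu i j (E k))| <= F k.
  rewrite -sqrtr_sqr; apply: ler_wsqrtr.
  rewrite (bigD1 i)//= (bigD1 j)//= -addrA lerDl addr_ge0//.
    by apply: sumr_ge0 => ? _; exact: sqr_ge0.
  by apply: sumr_ge0 => ? _; apply: sumr_ge0 => ? _; exact: sqr_ge0.
have fin k : nu i j (E k) \is a fin_num by exact: fin_num_measure.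
rewrite big_nat_recr//= big_nat1; apply: leeD.
  rewrite jordan_posE cjordan_posE /crestr0 mem_set// /crestr -[X in (X <= _)%E](fineK (fin 0%N)).
  by rewrite lee_fin; apply: le_trans (ler_norm _) (hF _).
rewrite jordan_negE cjordan_negE /crestr0 mem_set// /crestr -[X in (- X <= _)%E](fineK (fin 1%N)).
by rewrite -EFinN lee_fin; apply: le_trans (ler_norm _) _; rewrite normrN hF.
Qed.

Lemma measurable_penalty (p th : R) : measurable_fun setT (penalty p th : measurableTypeR R -> R).
Proof. by apply: measurable_funM => //; exact: measurable_well. Qed.

Lemma integral_unit_cst (c : \bar R) : (\int[mu]_(_ in unit_interval R) c = c)%E.
Proof.
transitivity (c * mu (unit_interval R))%E.
  by apply: integral_cst; exact: measurable_unit_interval.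
by rewrite lebesgue_unit_interval mule1.
Qed.

Section strip.
Variables (p th : R) (v : plane R -> R) (g : 'I_2 -> plane R -> R).
Variable nu : {charge set (plane R) -> \bar R}.
Hypotheses (p1 : 1 < p) (th0 : 0 < th) (th12 : th <= 1 / 2).
Hypotheses (Sv : sobolev p v g) (tr : left_trace p v g (cst 0)).
Hypothesis ig : mu2.-integrable (square R) (EFin \o g ord_max).
Hypothesis gnu : forall phi : R * R -> R, test_fun phi ->
  (\int[mu2]_(x in square R) (g ord_max x * 'D_(evec R ord_max) phi x)%:E
   = - cintegral nu (square R) phi)%E.

(** On almost every segment, the average of d_2 v against the kernel is minus that of [v] against
    the derivative of the kernel, which [ae_trace] bounds by the first term. This bound does not
    depend on [x_1], so integrating over [x_1] leaves it unchanged. *)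
Lemma strip_lower (a b m c : R) : 0 <= a -> b <= 1 -> 0 < m -> a < c -> c + 4 / m < b ->
  ((3 / 4 * th)%:E <=
    \int[mu2]_(z in square R) `|g ord0 z * (m ^+ 2 * spl 2 (m * (z.2 - c)))|%:E +
    \int[mu2]_(z in square R) (penalty p th (g ord_max z) * kernel m c z.2)%:E +
    (4 * th)%:E * varm nu (unit_interval R `*` `]a, b[%classic))%E.
Proof.
move=> a0 b1 m0 ac cb.
have th4 : 0 <= 4 * th by rewrite mulr_ge0// ltW.
have th34 : 0 <= 3 / 4 * th by rewrite mulr_ge0// ltW.
have m4 : 0 < 4 / m by rewrite divr_gt0.
have ab : a < b by lra.
have [c0 c1] : 0 < c /\ c + 4 / m < 1 by split; lra.
have cbe := C1c_kernel m0 c0 c1.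
(* The derivative of the kernel has to be a C^1 factor itself, with the continuous derivative
   [m ^+ 3 * spl 1]; this is what fixes the degree of the spline. *)
have cga : C1c (fun y => m ^+ 2 * spl 2 (m * (y - c))) (fun y => m ^+ 3 * spl 1 (m * (y - c))).
  split.
  - move=> t; apply: is_derive_eq (is_deriveZ (m ^+ 2) (is_derive_scaled 0 m c t)) _.
    by rewrite /GRing.scale/= mulrA -exprSr.
  - by move=> y; apply: cvgMr; exact: continuous_scaled.
  exists c, (c + 4 / m); split => // t h.
  have h' : ~ (0 < m * (t - c) < 4).
    move=> /andP[h1 h2]; apply: h.
    rewrite pmulr_rgt0// in h1; rewrite -ltr_pdivlMl// mulrC in h2.
    by apply/andP; split; lra.
  by rewrite !spl_out// !mulr0.
have isq f : Lp mu2 (square R) p f -> mu2.-integrable (square R) (EFin \o f).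
  by apply: Lp_integrable => //; [exact: measurable_square|exact: leb2_square].
have [Lv hg] := Sv.
have msq := @measurable_square R.
have iv := isq _ Lv; have ig0 := isq _ (hg ord0).1.
have [bga _] := C1c_bounded cga.
have [H [mH H0 intH osc]] := slice_oscillation a0 b1 ig gnu.
set N := (X in (X + _ + _)%E).
have NE : N = (\int[mu2]_z `|trunc (g ord0) z * (m ^+ 2 * spl 2 (m * (z.2 - c)))|)%:E.
  have i0 := integrableM_bounded measurableT (trunc_integrable ig0) (bounded_mfun_snd bga).
  rewrite /Rintegral fineK; last by apply: integrable_fin_num => //; exact: integrable_norm.
  rewrite /N [LHS]integral_mkcond; apply: eq_integral => z _.
  by rewrite /trunc !patchE; case: ifP => // _; rewrite mul0r normr0.
have N0 : (0 <= N)%E by rewrite NE lee_fin Rintegral_ge0.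
pose P : plane R -> \bar R :=
  (fun z => (penalty p th (g ord_max z) * kernel m c z.2)%:E) \_ (square R).
have mQ : measurable_fun (square R) (fun z => penalty p th (g ord_max z) * kernel m c z.2).
  apply: measurable_funM; last first.
    by apply: measurable_funTS; case: (bounded_mfun_snd (bounded_kernel c m0)).
  apply: (measurableT_comp (measurable_penalty p th)).
  by apply/measurable_EFinP; exact: measurable_int ig.
have mP : measurable_fun setT P.
  by apply: (measurable_restrictT _ msq).1; exact/measurable_EFinP.
have P0 z : (0 <= P z)%E.
  by rewrite /P patchE; case: ifP => // _; rewrite lee_fin mulr_ge0 ?penalty_ge0 ?kernel_ge0.
have mFP : measurable_fun setT (fubini_F mu P).
  exact: measurable_fun_fubini_tonelli_F.
have FP0 x : (0 <= fubini_F mu P x)%E by exact: integral_ge0.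
have mI := @measurable_unit_interval R.
rewrite [X in (_ + X + _)%E]integral_mkcond -/P fubini_tonelli1//.
apply: (@le_trans _ _ (\int[mu]_(x in unit_interval R) (N + fubini_F mu P x + (4 * th)%:E * H x))%E);
    last first.
  rewrite ge0_integralD//; last 4 first.
  - by move=> x _; rewrite adde_ge0.
  - by apply: emeasurable_funD; [exact: measurable_cst|exact: measurable_funTS].
  - by move=> x _; rewrite mule_ge0 ?lee_fin.
  - by apply: measurable_funeM; exact: measurable_funTS.
  rewrite ge0_integralD//; last exact: measurable_funTS.
  rewrite ge0_integralZl_EFin//; last exact: measurable_funTS.
  apply: leeD; first apply: leeD.
  - by rewrite integral_unit_cst.
  - by apply: ge0_subset_integral.
  rewrite lee_wpmul2l// ?lee_fin//.
  by apply: le_trans intH; apply: ge0_subset_integral.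
apply: (@le_trans _ _ (\int[mu]_(x in unit_interval R) (3 / 4 * th)%:E)%E).
  by rewrite integral_unit_cst.
apply: ae_ge0_le_integral => //.
- by move=> x _; apply: adde_ge0; [exact: adde_ge0|apply: mule_ge0; rewrite ?lee_fin].
- apply: emeasurable_funD; last by apply: measurable_funeM; exact: measurable_funTS.
  by apply: emeasurable_funD; [exact: measurable_cst|exact: measurable_funTS].
have A1 := ae_weak_slice iv ig cbe (hg ord_max).2.
have A2 := ae_trace p1 Sv tr cga.
have A3 := ae_integrable1 (trunc_integrable ig).
apply: ae_imp (ae_and (ae_and A1 A2) (ae_and A3 osc)) _ => x [[h1 h2] [h3 h4]] Ix.
have x01 : 0 < x < 1 by move: Ix; rewrite /unit_interval /= in_itv.
apply: le_trans (slice_lower p1 th0 th12 h3 (bounded_kernel c m0) _ _ (integrable_kernel c m0) _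
  (H0 x) (h4 x01)) _.
- by move=> y; exact: kernel_ge0.
- by move=> y hy; apply: (kernel_out m0) => /andP[y1 y2]; apply: hy; rewrite (lt_trans ac y1) (lt_trans y2 cb).
- by rewrite /Rintegral integral_kernel.
rewrite leeD2r// leeD//.
  rewrite NE lee_fin; apply: le_trans h2.
  by rewrite h1 normrN.
rewrite /fubini_F; apply: ge0_le_integral => //.
- by move=> y _; rewrite lee_fin mulr_ge0 ?penalty_ge0 ?kernel_ge0.
- apply/measurable_EFinP; apply: measurable_funM; last by case: (bounded_kernel c m0).
  apply: (measurableT_comp (measurable_penalty p th)).
  by apply/measurable_EFinP; exact: measurable_int h3.
- exact: measurable_fun_pair2.
move=> y _; rewrite /P patchE; case: ifPn => [/set_mem sz|/negP sz]; first by rewrite trunc_in.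
rewrite kernel_out ?mulr0// => /andP[y0 y1]; apply: sz; apply/mem_set; split => //=.
by rewrite /unit_interval /= in_itv/= (lt_trans c0 y0) (lt_trans y1 c1).
Qed.

End strip.
End lower.

(** * Choice of the number of strips *)

Section lower_arithmetic.
Context {R : realType}.
Local Notation mu := (@lebesgue_measure R).
Local Notation mu2 := (leb2 R).

(** At most one term is nonzero. *)
Lemma sum_strips_le n (F : 'I_n -> R) (y c : R) : 0 <= c -> (forall i, F i <= c) ->
  (forall i : 'I_n, ~ (i%:R / n%:R < y < i.+1%:R / n%:R) -> F i = 0) -> \sum_(i < n) F i <= c.
Proof.
case: n F => [|n] F c0 Fc F0; first by rewrite big_ord0.
have [[i0 /andP[l1 l2]]|h] := pselect (exists i0 : 'I_n.+1, i0%:R / n.+1%:R < y < i0.+1%:R / n.+1%:R).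
  rewrite (bigD1 i0)//= big1 ?addr0// => i ii0; apply: F0 => /andP[l3 l4].
  have := lt_trans l1 l4; have := lt_trans l3 l2.
  rewrite !ltr_pM2r ?invr_gt0// !ltr_nat !ltnS => h1 h2.
  by move/negP: ii0; apply; apply/eqP/val_inj/eqP; rewrite eqn_leq h1.
by rewrite big1// => i _; apply: F0 => hi; apply: h; exists i.
Qed.

Lemma powRS (x q : R) : 0 < x -> x `^ (q + 1) = x `^ q * x.
Proof. by move=> x0; rewrite powRD ?(gt_eqF x0) ?implybT// powRr1 ?(ltW x0). Qed.

Lemma powRB1 (x q : R) : 0 < x -> x `^ (q - 1) * x = x `^ q.
Proof. by move=> x0; rewrite -powRS// subrK. Qed.

Lemma powR_opp1 (x q : R) : x `^ (1 - q) = (x `^ (q - 1))^-1.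
Proof. by rewrite -powRN opprB. Qed.

Lemma le_powR_exp1 (x q : R) : 1 <= x -> 1 <= q -> x <= x `^ q.
Proof. by move=> x1 q1; rewrite -[leLHS]powRr1 ?(le_trans ler01)// ler_powR. Qed.

Lemma le1_powR (x q : R) : 1 <= x -> 0 <= q -> 1 <= x `^ q.
Proof. by move=> x1 q0; rewrite -[leLHS](powRr0 x) ler_powR. Qed.

Lemma arith_scale (s n th u e1 E w e2 V : R) : n != 0 ->
  s / n * (64 * n ^+ 2 * (th / (256 * n) + u * e1) + 8 * n * (E * w * e2) + 4 * th * V) =
  (s * th) / 4 + s * u * (64 * n) * e1 + 8 * E * (s * w) * e2 + 4 * (s * th / n) * V.
Proof. by move=> n0; field. Qed.

Lemma arith_tail (t c1 c2 c3 c4 eps e1 e2 V : R) : 0 <= e1 -> 0 <= e2 -> 0 <= V ->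
  c1 <= c4 -> c2 <= c4 -> c3 <= c4 * eps ->
  3 / 4 * t <= t / 4 + c1 * e1 + c2 * e2 + c3 * V -> t / 2 <= c4 * (e1 + e2 + eps * V).
Proof.
move=> e10 e20 V0 h1 h2 h3 H.
have := ler_wpM2r e10 h1; have := ler_wpM2r e20 h2; have := ler_wpM2r V0 h3.
by rewrite !mulrDr mulrA; lra.
Qed.

(** Multiplication by [th ^ (p - 1) / n] turns the left-hand side into [3 / 4 * th ^ p]. The
    constant 256 is such that the term free of [e1], [e2] and [V] becomes [th ^ p / 4] and is
    absorbed. The coefficients of [e1] and [e2] are then at most [(512 * X) ^ p], and that of [V] is
    at most [eps] times this. *)
Lemma arith_lower (p th eps e1 e2 V : R) : 1 < p -> 0 < th -> 0 < eps ->
  0 <= e1 -> 0 <= e2 -> 0 <= V ->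
  (forall n, (0 < n)%N -> n%:R * (3 / 4 * th) <=
     64 * n%:R ^+ 2 * (th / (256 * n%:R) + (th / (256 * n%:R)) `^ (1 - p) * e1) +
     8 * n%:R * (8 `^ p * th `^ (1 - p) * e2) + 4 * th * V) ->
  (2 * 512 `^ p)^-1 * (th `^ p * Num.min 1 ((eps / th `^ p) `^ (p / (p + 1)))) <=
  e1 + e2 + eps * V.
Proof.
move=> p1 th0 eps0 e10 e20 V0 hn.
(* The numeral is replaced by a variable of which only the factorisations [256 * 2] and [64 * 8],
   the positivity and the bound 4 are kept. *)
have [K [K2 K8 K4 K0] ->] : exists2 K : R, [/\ K = 256 * 2, K = 64 * 8, 4 <= K & 0 < K] & 512 = K.
  by exists 512; [split; lra|reflexivity].
have p0 : 0 < p by apply: lt_trans p1.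
have p10 : 0 < p + 1 by rewrite addr_gt0.
have pm1 : 0 <= p - 1 by rewrite subr_ge0 ltW.
have t0 : 0 < th `^ p by exact: powR_gt0.
have tth := powRB1 p th0.
move: (tth) t0; set s := th `^ (p - 1); set t := th `^ p => sth t0.
have s0 : 0 < s by exact: powR_gt0.
pose Y := (t / eps) `^ (p + 1)^-1.
have te0 : 0 < t / eps by rewrite divr_gt0.
have Y0 : 0 < Y by rewrite powR_gt0.
have Yp : Y `^ p * Y = t / eps.
  by rewrite -powRS// -powRrM mulVf ?gt_eqF// powRr1// ltW.
have YpN : (Y `^ p)^-1 = (eps / t) `^ (p / (p + 1)).
  rewrite -powRN -powRrM (_ : eps / t = (t / eps)^-1); last by rewrite invf_div.
  rewrite -(powR_inv1 (ltW te0)) -powRrM; congr (_ `^ _).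
  by rewrite mulN1r mulrN mulrC.
(* [X] is the maximum of 1 and [Y], so that the regime [eps > th ^ p], where the minimum is 1, is
   treated together with the other one. *)
have [X [X1 YX mX]] : exists X, [/\ 1 <= X, t / eps <= X `^ p * X &
    Num.min 1 ((eps / t) `^ (p / (p + 1))) <= (X `^ p)^-1].
  have [Y1|Y1] := leP 1 Y.
    exists Y; split => //; first by rewrite Yp.
    by rewrite YpN ge_min lexx orbT.
  exists 1; split => //; last by rewrite powR1 invr1 ge_min lexx.
  rewrite powR1 mul1r -Yp mulr_ile1 ?powR_ge0 ?(ltW Y0) ?(ltW Y1)//.
  by have := @ge0_ler_powR R p (ltW p0) Y 1; rewrite powR1; apply; rewrite ?nnegrE ?(ltW Y0) ?(ltW Y1).
have X0 : 0 < X by apply: lt_le_trans X1.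
have Xp0 : 0 < X `^ p by exact: powR_gt0.
(* Then [X < n <= 2 * X], since [1 <= X]. *)
pose n := (Num.truncn X).+1.
have /andP[nX1 nX2] : (Num.truncn X)%:R <= X < n%:R by apply: truncn_itv; exact: ltW.
have n2X : n%:R <= 2 * X.
  rewrite /n -natr1 mulr_natl mulr2n; exact: lerD.
have n0 : 0 < n%:R :> R by rewrite ltr0n.
have H := ler_wpM2l (ltW (divr_gt0 s0 n0)) (hn n isT).
have sw : s * th `^ (1 - p) = 1 by rewrite powR_opp1 mulfV// gt_eqF.
rewrite arith_scale ?(gt_eqF n0)// sth sw mulr1 in H.
rewrite (_ : s / n%:R * (n%:R * (3 / 4 * th)) = 3 / 4 * t) in H; last first.
  by rewrite -sth; field; rewrite gt_eqF.
have n256 : 0 < 256 * n%:R :> R by apply: mulr_gt0; [rewrite ltr0n|exact: n0].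
have su : s * (th / (256 * n%:R)) `^ (1 - p) * (64 * n%:R) <= K `^ p * X `^ p.
  rewrite powR_opp1 powRM ?(ltW th0) ?invr_ge0 ?(ltW n256)// [X in s * X]invfM -/s mulVKf ?(gt_eqF s0)//.
  rewrite -(powR_inv1 (ltW n256)) -powRrM mulN1r powRN invrK.
  apply: (@le_trans _ _ ((256 * n%:R) `^ p)).
    rewrite -(powRB1 p n256) ler_wpM2l ?powR_ge0// ler_wpM2r ?(ltW n0)//.
    by rewrite ler_nat.
  rewrite -powRM ?(ltW X0) ?(ltW K0)//; apply: ge0_ler_powR; rewrite ?nnegrE ?(ltW p0) ?(ltW n256)//.
    by rewrite mulr_ge0 ?(ltW K0) ?(ltW X0).
  by rewrite K2 -mulrA; apply: ler_wpM2l; [exact: ler0n|exact: n2X].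
have c2 : 8 * 8 `^ p <= K `^ p * X `^ p.
  apply: (@le_trans _ _ (K `^ p)); last by rewrite ler_peMr ?powR_ge0// le1_powR ?(ltW p0).
  rewrite K8 powRM// ler_wpM2r ?powR_ge0//.
  by apply: (@le_trans _ _ 64); [rewrite ler_nat|apply: le_powR_exp1; rewrite ?ler1n// ltW].
have c3 : 4 * (t / n%:R) <= K `^ p * X `^ p * eps.
  have tn : t / n%:R <= X `^ p * eps.
    rewrite ler_pdivrMr//; rewrite ler_pdivrMr// in YX.
    apply: le_trans YX _; rewrite mulrAC ler_wpM2l ?(ltW nX2)//.
    by rewrite mulr_ge0 ?powR_ge0// ltW.
  rewrite -mulrA; apply: ler_pM => //; first by rewrite divr_ge0 ?(ltW t0)// ltW.
  by apply: (@le_trans _ _ K); [exact: K4|apply: le_powR_exp1; rewrite ?(ltW p1)// (le_trans _ K4) ?ler1n].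
have key := arith_tail e10 e20 V0 su c2 c3 H.
apply: (@le_trans _ _ ((2 * K `^ p)^-1 * (t * (X `^ p)^-1))).
  by rewrite ler_wpM2l ?invr_ge0 ?mulr_ge0 ?powR_ge0// ler_wpM2l// ltW.
have c0 : 0 < K `^ p * X `^ p by rewrite mulr_gt0// powR_gt0.
rewrite -(ler_pM2l c0); apply: le_trans key.
rewrite invfM le_eqVlt; apply/orP; left; apply/eqP; field.
by rewrite !gt_eqF// powR_gt0.
Qed.

End lower_arithmetic.

Section energy_lower.
Context {R : realType}.
Local Notation mu := (@lebesgue_measure R).
Local Notation mu2 := (leb2 R).

(** The functions live on disjoint strips, so the sum costs nothing. The measure is a parameter
    because the lemma is also applied to the variation of the Hessian. *)
Lemma sum_strips_integral (m : {measure set (plane R) -> \bar R}) n (F : 'I_n -> plane R -> R)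
    (G : plane R -> R) (C : R) : 0 <= C ->
  (forall i, measurable_fun (square R) (F i)) -> measurable_fun (square R) G ->
  (forall i z, 0 <= F i z <= C * G z) -> (forall z, 0 <= G z) ->
  (forall (i : 'I_n) z, ~ (i%:R / n%:R < z.2 < i.+1%:R / n%:R) -> F i z = 0) ->
  (\sum_(i < n) \int[m]_(z in square R) (F i z)%:E <= C%:E * \int[m]_(z in square R) (G z)%:E)%E.
Proof.
move=> C0 mF mG FG G0 F0; have msq := @measurable_square R.
have F0' i z : 0 <= F i z by case/andP: (FG i z).
rewrite -ge0_integral_sum//; last 2 first.
- by move=> i; exact/measurable_EFinP.
- by move=> i z _; rewrite lee_fin.
rewrite -ge0_integralZl_EFin//; last 2 first.
- by move=> z _; rewrite lee_fin.
- exact/measurable_EFinP.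
apply: ge0_le_integral => //.
- by move=> z _; apply: sume_ge0 => i _; rewrite lee_fin.
- under eq_fun do rewrite sumEFin.
  by apply/measurable_EFinP; apply: measurable_sum.
- under eq_fun do rewrite -EFinM.
  by apply/measurable_EFinP; apply: measurable_funM.
move=> z _; rewrite sumEFin -EFinM lee_fin.
apply: (sum_strips_le (y := z.2)); first exact: mulr_ge0.
- by move=> i; case/andP: (FG i z).
- by move=> i; exact: F0.
Qed.

Section sum.
Variables (p th : R) (v : plane R -> R) (g : 'I_2 -> plane R -> R).
Variable nu : {charge set (plane R) -> \bar R}.
Hypotheses (p1 : 1 < p) (th0 : 0 < th) (th12 : th <= 1 / 2).
Hypotheses (Sv : sobolev p v g) (tr : left_trace p v g (cst 0)).
Hypothesis ig : mu2.-integrable (square R) (EFin \o g ord_max).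
Hypothesis gnu : forall phi : R * R -> R, test_fun phi ->
  (\int[mu2]_(x in square R) (g ord_max x * 'D_(evec R ord_max) phi x)%:E
   = - cintegral nu (square R) phi)%E.

Lemma strips_lower n : (0 < n)%N ->
  ((n%:R * (3 / 4 * th))%:E <=
    (64 * n%:R ^+ 2)%:E * \int[mu2]_(z in square R) `|g ord0 z|%:E +
    (8 * n%:R)%:E * \int[mu2]_(z in square R) (penalty p th (g ord_max z))%:E +
    (4 * th)%:E * varm nu (square R))%E.
Proof.
move=> n0; have n0' : 0 < n%:R :> R by rewrite ltr0n.
have th4 : 0 <= 4 * th by rewrite mulr_ge0// ltW.
have msq := @measurable_square R.
(* The support of the spline then has length [1 / (2 * n)]; starting at distance [q = 1 / (4 * n)]
   from the bottom, it is centred in the strip. The coefficients [64 * n ^+ 2] and [8 * n] are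
   [m ^+ 2] and [m], which bound the derivative of the kernel and the kernel. *)
have [m m0 m8] : exists2 m : R, 0 < m & m = 8 * n%:R.
  by exists (8 * n%:R) => //; rewrite mulr_gt0.
have [q q0 q4] : exists2 q : R, 0 < q & q = (4 * n%:R)^-1.
  by exists (4 * n%:R)^-1 => //; rewrite invr_gt0 mulr_gt0.
pose c (i : 'I_n) : R := i%:R / n%:R + q.
have c4 : 4 / m = 2 * q by rewrite m8 q4; field; rewrite gt_eqF.
have iS (i : 'I_n) : i.+1%:R / n%:R = i%:R / n%:R + 4 * q :> R.
  by rewrite q4 -natr1; field; rewrite gt_eqF.
have i1 (i : 'I_n) : i.+1%:R / n%:R <= 1 :> R by rewrite ler_pdivrMr// mul1r ler_nat.
have i0 (i : 'I_n) : 0 <= i%:R / n%:R :> R by rewrite divr_ge0.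
have ci (i : 'I_n) : i%:R / n%:R < c i by rewrite /c ltrDl.
have ci' (i : 'I_n) : c i + 4 / m < i.+1%:R / n%:R.
  by rewrite c4 iS /c; move: (i%:R / n%:R) q0 => x q0; lra.
pose J (i : 'I_n) : set R := `]i%:R / n%:R, i.+1%:R / n%:R[%classic.
have hs (i : 'I_n) := strip_lower p1 th0 th12 Sv tr ig gnu (i0 i) (i1 i) m0 (ci i) (ci' i).
have : (\sum_(i < n) (3 / 4 * th)%:E <= \sum_(i < n) (
    \int[mu2]_(z in square R) `|g ord0 z * (m ^+ 2 * spl 2 (m * (z.2 - c i)))|%:E +
    \int[mu2]_(z in square R) (penalty p th (g ord_max z) * kernel m (c i) z.2)%:E +
    (4 * th)%:E * varm nu (unit_interval R `*` J i)))%E.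
  by apply: lee_sum => i _; exact: hs.
rewrite (_ : (n%:R * (3 / 4 * th))%:E = \sum_(i < n) (3 / 4 * th)%:E)%E; last first.
  by rewrite sumEFin sumr_const card_ord mulr_natl.
move=> /le_trans; apply.
rewrite 2!big_split.
have out (i : 'I_n) (y : R) : ~ (i%:R / n%:R < y < i.+1%:R / n%:R) -> ~ (c i < y < c i + 4 / m).
  move=> h /andP[h1 h2]; apply: h; rewrite (lt_trans (ci i) h1)/=.
  exact: lt_trans h2 (ci' i).
have mg0 : measurable_fun (square R) (g ord0) by case: Sv => _ /(_ ord0)[[]].
have mg1 : measurable_fun (square R) (g ord_max) by case: Sv => _ /(_ ord_max)[[]].
have mpen : measurable_fun (square R) (fun z => penalty p th (g ord_max z)).
  exact: (measurableT_comp (measurable_penalty p th)).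
apply: leeD; first apply: leeD.
- apply: sum_strips_integral => //.
  + move=> i; apply: measurableT_comp => //.
    apply: measurable_funM => //; apply: measurable_funTS.
    have [_ /bounded_mfun_snd[]//] := C1c_bounded (C1c_kernel m0 (le_lt_trans (i0 i) (ci i)) (lt_le_trans (ci' i) (i1 i))).
  + exact: measurableT_comp.
  + move=> i z; rewrite normr_ge0 normrM mulrC ler_wpM2r// normrM ger0_norm ?sqr_ge0//.
    rewrite m8 exprMn (_ : 8 ^+ 2 = 64); last by rewrite -natrX.
    by rewrite ler_piMr ?mulr_ge0 ?sqr_ge0// normr_spl2.
  + move=> i z /out h; rewrite (_ : spl _ _ = 0) ?mulr0 ?normr0//.
    apply: spl_out => // /andP[h1 h2]; apply: h.
    rewrite pmulr_rgt0// subr_gt0 in h1; rewrite -ltr_pdivlMl// in h2.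
    by rewrite h1/= addrC -ltrBlDr mulrC.
- apply: sum_strips_integral => //.
  + move=> i; apply: measurable_funM => //; apply: measurable_funTS.
    by have [] := bounded_mfun_snd (bounded_kernel (c i) m0).
  + move=> i z; rewrite mulr_ge0 ?penalty_ge0 ?kernel_ge0//= mulrC.
    by rewrite -m8 ler_wpM2r ?penalty_ge0 ?kernel_le.
  + by move=> z; exact: penalty_ge0.
  + by move=> i z /out h; rewrite kernel_out ?mulr0.
rewrite -ge0_sume_distrr//.
apply: lee_wpmul2l => //.
have mI (i : 'I_n) : measurable (unit_interval R `*` J i : set (plane R)).
  by apply: measurableX; [exact: measurable_unit_interval|by rewrite /J; exact: measurable_itv].
have sI (i : 'I_n) : unit_interval R `*` J i `<=` square R.
  move=> z [z1]; rewrite /J/= in_itv/= => /andP[z2 z3]; split => //.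
  by rewrite /unit_interval/= in_itv/= (le_lt_trans (i0 i) z2) (lt_le_trans z3 (i1 i)).
(* The variations of the strips are summed by the same lemma, as integrals of indicators against
   [varm nu]. *)
rewrite (eq_bigr (fun i : 'I_n => \int[varm nu]_(z in square R)
  (\1_(unit_interval R `*` J i) z)%:E)%E); last first.
  by move=> i _; rewrite integral_indic//; congr (varm nu _); apply/esym/setIidl.
apply: (@le_trans _ _ (1%:E * \int[varm nu]_(z in square R) (1%:R)%:E)%E); last first.
  by rewrite integral_cst// !mul1e.
apply: sum_strips_integral => //.
- by move=> i; apply: measurable_indic.
- by move=> i z; rewrite mulr1 indicE; case: (_ \in _); rewrite ?ler01 lexx.
- move=> i z h; rewrite indicE memNset// => -[_]; rewrite /J/= in_itv/=; exact: h.
Qed.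

End sum.

Lemma energy_lower (p th eps : R) (v : classB p) : 1 < p -> 0 < th -> th <= 1 / 2 -> 0 < eps ->
  (((2 * 512 `^ p)^-1 * (th `^ p * Num.min 1 ((eps / th `^ p) `^ (p / (p + 1)))))%:E
   <= energy eps th v)%E.
Proof.
move=> p1 th0 th12 eps0; have msq := @measurable_square R.
have Sv := classB_sobolev v; have [ig gnu] := classB_BV v ord_max.
have [_ Sg] := Sv.
have mg0 : measurable_fun (square R) (partials v ord0) by have [[]] := Sg ord0.
have mg1 : measurable_fun (square R) (partials v ord_max) by have [[]] := Sg ord_max.
have mw : measurable_fun (square R) (fun z => well p th (partials v ord_max z)).
  exact: (measurableT_comp (measurable_well p th)).
have m0 : measurable_fun (square R) (fun z => `|partials v ord0 z| `^ p).
  by apply: (measurableT_comp (measurable_powR p)); exact: measurableT_comp.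
have -> : energy eps th v = (\int[mu2]_(z in square R) (`|partials v ord0 z| `^ p)%:E +
    \int[mu2]_(z in square R) (well p th (partials v ord_max z))%:E +
    eps%:E * Defs.total_variation (hessian v) (square R))%E.
  rewrite /energy; congr (_ + _)%E; rewrite -ge0_integralD//.
  - exact/measurable_EFinP.
  - by move=> z _; rewrite lee_fin well_ge0.
  - exact/measurable_EFinP.
have V0 := varm_le_total_variation (hessian v) ord_max ord_max msq.
set V := Defs.total_variation _ _ in V0 *.
have {}V0' : (0 <= V)%E by apply: le_trans V0.
have E10 : (0 <= \int[mu2]_(z in square R) (`|partials v ord0 z| `^ p)%:E)%E.
  by apply: integral_ge0 => z _; rewrite lee_fin powR_ge0.
have E20 : (0 <= \int[mu2]_(z in square R) (well p th (partials v ord_max z))%:E)%E.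
  by apply: integral_ge0 => z _; rewrite lee_fin well_ge0.
have L1 n : (0 < n)%N -> (\int[mu2]_(z in square R) `|partials v ord0 z|%:E <=
    (th / (256 * n%:R))%:E + ((th / (256 * n%:R)) `^ (1 - p))%:E *
    \int[mu2]_(z in square R) (`|partials v ord0 z| `^ p)%:E)%E.
  move=> n0; apply: L1_le_Lp; [exact: p1| |exact: msq|exact: leb2_square|exact: mg0].
  by apply: divr_gt0; [exact: th0|apply: mulr_gt0; rewrite ltr0n].
have P : (\int[mu2]_(z in square R) (penalty p th (partials v ord_max z))%:E =
    (8 `^ p * th `^ (1 - p))%:E * \int[mu2]_(z in square R) (well p th (partials v ord_max z))%:E)%E.
  rewrite -ge0_integralZl_EFin//.
  - by move=> z _; rewrite lee_fin well_ge0.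
  - exact/measurable_EFinP.
  - by rewrite mulr_ge0 ?powR_ge0.
have S n (n0 : (0 < n)%N) := strips_lower p1 th0 th12 Sv (classB_trace v) ig (gnu ord_max) n0.
rewrite P in S; move: S L1 V0 V0' E10 E20.
move: (\int[mu2]_(z in square R) (`|partials v ord0 z| `^ p)%:E)%E => E1.
move: (\int[mu2]_(z in square R) (well p th (partials v ord_max z))%:E)%E => E2.
move: (varm _ _) => W; move: (\int[mu2]_(z in square R) `|partials v ord0 z|%:E)%E => F.
move: V => V S L1 V0 V0' E10 E20 {P}.
have epsV : (0 <= eps%:E * V)%E by rewrite mule_ge0// lee_fin ltW.
have ge0Noo (x : \bar R) : (0 <= x -> x != -oo)%E by case: x.
(* If one of the three terms is infinite, so is the energy; otherwise the claim is about real
   numbers. *)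
have [E1oo|E1oo] := eqVneq E1 +oo%E.
  by rewrite E1oo addye ?addye ?leey ?ge0Noo.
have [E2oo|E2oo] := eqVneq E2 +oo%E.
  by rewrite E2oo addey ?addye ?leey ?ge0Noo.
have [Voo|Voo] := eqVneq V +oo%E.
  by rewrite Voo gt0_muley ?lte_fin// addey ?leey ?ge0Noo// adde_ge0.
have fin (x : \bar R) : (0 <= x)%E -> x != +oo%E -> exists2 r : R, 0 <= r & x = r%:E.
  by case: x => [r|//|//]; rewrite lee_fin => r0 _; exists r.
have [e1 e10 ?] := fin _ E10 E1oo; have [e2 e20 ?] := fin _ E20 E2oo.
have [w w0 ?] := fin _ V0' Voo; subst E1 E2 V.
rewrite -EFinM -!EFinD lee_fin; apply: arith_lower => // n n0.
rewrite -lee_fin; apply: le_trans (S n n0) _; rewrite !EFinD.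
apply: leeD; first apply: leeD.
- rewrite [leRHS]EFinM; apply: lee_wpmul2l; first by rewrite lee_fin mulr_ge0// sqr_ge0.
  by rewrite EFinD EFinM; exact: L1.
- by rewrite -!EFinM.
- by rewrite [leRHS]EFinM; apply: lee_wpmul2l; rewrite // lee_fin mulr_ge0// ltW.
Qed.
End energy_lower.

(** * Functions of class C^2 *)

Section density.
Context d (T : measurableType d) {R : realType}.

Lemma bounded_integrable_finite (n : {finite_measure set T -> \bar R}) (D : set T) (phi : T -> R)
    (M : R) : measurable D -> measurable_fun D phi -> (forall z, D z -> `|phi z| <= M) ->
  n.-integrable D (EFin \o phi).
Proof.
move=> mD mphi pM; apply: measurable_bounded_integrable => //.
  by rewrite ltey_eq fin_num_measure.
by exists M; split; [exact: num_real|move=> x Mx z Dz; apply: le_trans (pM z Dz) (ltW Mx)].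
Qed.

(** The Radon-Nikodym derivative is taken with respect to a packed sigma-finite measure; this packs
    a measure that comes with a proof only. *)
Lemma sigma_finite_pack (m : {measure set T -> \bar R}) : sigma_finite setT m ->
  {m' : {sigma_finite_measure set T -> \bar R} | (m' : {measure set T -> \bar R}) = m}.
Proof.
case: m => m c sf.
by exists (SigmaFiniteMeasure.Pack (SigmaFiniteMeasure.Class
  (Measure.measure_function_Content_isMeasure_mixin c)
  (isSFinite.Axioms_ T R m (sfinite_measure_sigma_finite sf)) (isSigmaFinite.Axioms_ T R m sf))).
Qed.

Variable m0 : {measure set T -> \bar R}.
Hypothesis sf : sigma_finite setT m0.

(** Both Jordan parts have densities with respect to [m0]. The difference of the two has the same
    integrals as [f] over measurable sets, hence equals [f] almost everywhere. *)
Lemma cintegral_induced (f : T -> \bar R) (intf : m0.-integrable setT f) (D : set T) (phi : T -> R)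
    (M : R) : measurable D -> measurable_fun D phi -> (forall z, D z -> `|phi z| <= M) ->
  (cintegral (induced_charge intf) D phi = \int[m0]_(z in D) ((phi z)%:E * f z))%E.
Proof.
move=> mD mphi pM; case: (sigma_finite_pack sf) intf => m; case: _ / => {}intf.
suff h P N (nuPN : hahn_decomposition (induced_charge intf) P N) :
    (\int[jordan_pos nuPN]_(z in D) (phi z)%:E - \int[jordan_neg nuPN]_(z in D) (phi z)%:E =
     \int[m]_(z in D) ((phi z)%:E * f z))%E by exact: h.
have dom : induced_charge intf `<< m.
  apply/null_content_dominatesP => A mA mA0.
  by apply: null_set_integral => //; apply: measurable_funTS; exact: measurable_int intf.
have dp := jordan_pos_dominates nuPN dom; have dn := jordan_neg_dominates nuPN dom.
have ip := bounded_integrable_finite (jordan_pos nuPN) mD mphi pM.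
have im := bounded_integrable_finite (jordan_neg nuPN) mD mphi pM.
rewrite -(Radon_Nikodym_change_of_variables dp mD ip) -(Radon_Nikodym_change_of_variables dn mD im).
set rp := Radon_Nikodym _ _; set rn := Radon_Nikodym _ _.
have irp : m.-integrable setT rp by exact: Radon_Nikodym_integrable.
have irn : m.-integrable setT rn by exact: Radon_Nikodym_integrable.
have pM' : [bounded phi z | z in D].
  by exists M; split; [exact: num_real|move=> x Mx z Dz; apply: le_trans (pM z Dz) (ltW Mx)].
have iM (g : T -> \bar R) : m.-integrable setT g -> m.-integrable D (fun z => (phi z)%:E * g z)%E.
  move=> ig; under eq_fun do rewrite muleC.
  by apply: (integrableMl mD (integrableS measurableT mD _ ig)).
rewrite -integralB//; [|exact: iM..].
apply: ae_eq_integral => //.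
- by apply: measurable_int (integrableB mD (iM _ irp) (iM _ irn)).
- exact: measurable_int (iM _ intf).
have ae : ae_eq m setT (rp \- rn)%E f.
  apply: integral_ae_eq => //.
  - exact: integrableB.
  - exact: measurable_int intf.
  move=> E _ mE; rewrite integralB//; [|exact: integrableS irp|exact: integrableS irn].
  rewrite -!Radon_Nikodym_integral//.
  rewrite [RHS](_ : _ = induced_charge intf E)// (jordan_decomp nuPN mE).
  by rewrite /cadd/= cscaleN1.
apply: filterS ae => z /= h Dz; rewrite -(h I) muleBr//.
by rewrite fin_num_adde_defr//; exact: Radon_Nikodym_fin_num.
Qed.
End density.

(** * Measurability and integration by parts on the square *)

Section plane_measure.
Context {R : realType}.
Local Notation mu := (@lebesgue_measure R).
Local Notation mu2 := (leb2 R).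

Lemma sigma_finite_leb2 : sigma_finite setT mu2.
Proof.
have /sigma_finiteP[F [TF ndF Foo]] := sigma_finiteT mu.
exists (fun n => F n `*` F n).
  rewrite -setXTT TF predeqE => -[x y]; split.
    move=> [/= [n _ Fnx] [k _ Gky]]; exists (maxn n k) => //; split.
    - by move: x Fnx; exact/subsetPset/ndF/leq_maxl.
    - by move: y Gky; exact/subsetPset/ndF/leq_maxr.
  by move=> [n _ []/= ? ?]; split; exists n.
move=> k; have [? ?] := Foo k.
split; first exact: measurableX.
by rewrite product_measure1E// lte_mul_pinfty// ge0_fin_numE.
Qed.

(** Rounding [x] down to a grid gives functions measurable for the product structure, being
    measurable in [y] on each of countably many strips; they converge by continuity in [x]. Separate
    continuity is what the partial derivatives of a test function give directly. *)
Lemma measurable_separately_continuous (f : plane R -> R) :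
  (forall x : R, continuous (fun y : R => f (x, y) : R)) ->
  (forall y : R, continuous (fun x : R => f (x, y) : R)) -> measurable_fun setT f.
Proof.
move=> cy cx; pose c n (x : R) : R := (Num.floor (n.+1%:R * x))%:~R / n.+1%:R.
have fl n (x : R) : (Num.floor (n.+1%:R * x))%:~R <= n.+1%:R * x < (Num.floor (n.+1%:R * x))%:~R + 1.
  by have := floor_itv (n.+1%:R * x); rewrite intrD.
have cle n (x : R) : c n x <= x < c n x + n.+1%:R^-1.
  have n0 : 0 < n.+1%:R :> R by rewrite ltr0n.
  rewrite /c -[X in _ + X]mul1r -mulrDl ler_pdivrMr// ltr_pdivlMr// [x * _]mulrC; exact: fl.
apply: (measurable_fun_cvg (h := fun n (z : plane R) => f (c n z.1, z.2))).
  move=> n _ B mB; rewrite setTI.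
  rewrite (_ : _ @^-1` B = \bigcup_(k : int) ([set x : R | Num.floor (n.+1%:R * x) = k] `*`
     ((fun y => f (k%:~R / n.+1%:R, y)) @^-1` B))); last first.
    apply/seteqP; split => [z Bz|z [k _ [/= zk Bz]]]; first by exists (Num.floor (n.+1%:R * z.1)).
    by rewrite /= /c zk.
  apply: countable_bigcupT_measurable => [|k]; first exact: countableP.
  apply: measurableX.
    rewrite (_ : [set x | _] = `[k%:~R / n.+1%:R, (k%:~R + 1) / n.+1%:R[%classic) //.
    apply/seteqP; split => x /=; rewrite in_itv/= ler_pdivrMr// ltr_pdivlMr// [x * _]mulrC.
      by move=> <-; exact: fl.
    by move=> h; apply: floor_def; rewrite intrD.
  rewrite -[X in measurable X]setTI; apply: (continuous_measurable_fun (cy _)) => //.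
move=> z _; have zc : c n z.1 @[n --> \oo] --> z.1.
  apply/cvgrPdist_lt => e e0; near=> n.
  have n0 : 0 < n.+1%:R :> R by rewrite ltr0n.
  have h3 : 1 / n.+1%:R < e by near: n; exact: near_natSinv_lt.
  rewrite div1r in h3.
  have /andP[h4 h5] := cle n z.1.
  rewrite ger0_norm ?subr_ge0//; apply: lt_trans h3.
  by rewrite ltrBlDl.
by case: z zc => z1 z2 /= zc; exact: (cvg_comp _ _ zc (cx z2 z1)).
Unshelve. all: by end_near.
Qed.

End plane_measure.

Section by_parts.
Context {R : realType}.
Local Notation mu := (@lebesgue_measure R).
Local Notation mu2 := (leb2 R).
Implicit Types (phi f g h : R * R -> R).

Lemma is_derive_slice0 phi (x y d : R) :
  is_derive (x, y) (evec R ord0) phi d -> is_derive x 1 (fun t => phi (t, y)) d.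
Proof.
move=> [h1 h2].
have E : (fun h : R => h^-1 *: ((phi \o shift (x, y)) (h *: evec R ord0) - phi (x, y))) =
  (fun h : R => h^-1 *: (((fun t => phi (t, y)) \o shift x) (h *: 1) - phi (x, y))).
  apply/funext => h; rewrite /evec eqxx /=; congr (_ *: (phi _ - phi _)).
  by rewrite (_ : h *: (1, 0) + (x, y) = (h *: 1 + x, h *: 0 + y))// scaler0 add0r.
by apply: DeriveDef; [rewrite /derivable -E|rewrite /derive -E].
Qed.

Lemma is_derive_slice1 phi (x y d : R) :
  is_derive (x, y) (evec R ord_max) phi d -> is_derive y 1 (fun t => phi (x, t)) d.
Proof.
move=> [h1 h2].
have E : (fun h : R => h^-1 *: ((phi \o shift (x, y)) (h *: evec R ord_max) - phi (x, y))) =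
  (fun h : R => h^-1 *: (((fun t => phi (x, t)) \o shift y) (h *: 1) - phi (x, y))).
  apply/funext => h; rewrite /evec /=; congr (_ *: (phi _ - phi _)).
  by rewrite (_ : h *: (0, 1) + (x, y) = (h *: 0 + x, h *: 1 + y))// scaler0 add0r.
by apply: DeriveDef; [rewrite /derivable -E|rewrite /derive -E].
Qed.

Lemma continuous_slice1 f x : continuous f -> continuous (fun y : R => f (x, y)).
Proof.
move=> cf y; apply: (@continuous_comp _ _ _ (fun y : R => (x, y)) f); last exact: cf.
by apply: (@cvg_pair _ _ _ (nbhs y) (nbhs x) (nbhs y)); [exact: cvg_cst|exact: cvg_id].
Qed.

Lemma continuous_slice0 f y : continuous f -> continuous (fun x : R => f (x, y)).
Proof.
move=> cf x; apply: (@continuous_comp _ _ _ (fun x : R => (x, y)) f); last exact: cf.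
by apply: (@cvg_pair _ _ _ (nbhs x) (nbhs x) (nbhs y)); [exact: cvg_id|exact: cvg_cst].
Qed.

Lemma continuous_plane_measurable f : continuous f -> measurable_fun setT (f : plane R -> R).
Proof.
move=> cf; apply: measurable_separately_continuous => t.
  exact: continuous_slice1.
exact: continuous_slice0.
Qed.

Lemma continuous_bounded_square f : continuous f ->
  exists2 M : R, 0 <= M & forall z, closed_square R z -> `|f z| <= M.
Proof.
move=> cf; have K : compact (closed_square R : set (R * R)).
  by apply: compact_setX; exact: segment_compact.
have [M [_ hM]] := compact_bounded (continuous_compact (continuous_subspaceT cf) K).
exists (Num.max 0 (M + 1)); first by rewrite le_max lexx.
by move=> z Kz; rewrite le_max (hM (M + 1)) ?orbT ?ltrDl//; exists z.
Qed.

Lemma square_closed_square : square R `<=` closed_square R.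
Proof.
move=> z [] /=; rewrite /unit_interval/= !in_itv/= => /andP[h1 h2] /andP[h3 h4].
by split; rewrite /= in_itv/= !ltW.
Qed.

Lemma integrable_square f (M : R) : measurable_fun setT (f : plane R -> R) ->
  (forall z, square R z -> `|f z| <= M) -> mu2.-integrable (square R) (EFin \o f).
Proof.
move=> mf fM; apply: measurable_bounded_integrable => //.
- exact: measurable_square.
- by have := @leb2_square R => /= ->; rewrite ltry.
- exact: measurable_funTS.
by exists M; split; [exact: num_real|move=> x Mx z Dz; apply: le_trans (fM z Dz) (ltW Mx)].
Qed.

Lemma continuous_integrable_square f : continuous f -> mu2.-integrable (square R) (EFin \o f).
Proof.
move=> cf; have [M _ fM] := continuous_bounded_square cf.
apply: (@integrable_square _ M); first exact: continuous_plane_measurable.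
by move=> z /square_closed_square; exact: fM.
Qed.

Section test.
Variable phi : R * R -> R.
Hypothesis tphi : test_fun phi.

Lemma test_fun_slice0 (x y : R) :
  is_derive x 1 (fun t => phi (t, y)) ('D_(evec R ord0) phi (x, y)).
Proof. by apply: is_derive_slice0; apply: DeriveDef => //; case: tphi => /(_ ord0)[]. Qed.

Lemma test_fun_slice1 (x y : R) :
  is_derive y 1 (fun t => phi (x, t)) ('D_(evec R ord_max) phi (x, y)).
Proof. by apply: is_derive_slice1; apply: DeriveDef => //; case: tphi => /(_ ord_max)[]. Qed.

(** The complement of the support is open, so [phi] vanishes near every point outside of the square,
    boundary points included. *)
Lemma test_fun_out z : ~ square R z -> phi z = 0 /\ forall i, 'D_(evec R i) phi z = 0.
Proof.
case: tphi => _ [K [cK Ks] K0] zs; have nKz : ~ K z by move=> /Ks.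
split; first exact: K0.
move=> i; rewrite -[RHS](derive_cst (0 : R) z (evec R i)); apply: near_eq_derive.
have oK : open (~` K) by apply: closed_openC; apply: compact_closed.
by have := open_nbhs_nbhs (conj oK nKz); apply: filterS => t; exact: K0.
Qed.

Lemma test_fun_measurable : measurable_fun setT (phi : plane R -> R).
Proof.
apply: measurable_separately_continuous => t.
  by apply: is_derive_continuous => s; exact: test_fun_slice1.
by apply: is_derive_continuous => s; exact: test_fun_slice0.
Qed.

(** The mean value theorem on vertical segments, from the bottom edge, where [phi] vanishes. *)
Lemma test_fun_bounded : exists2 M : R, 0 <= M & forall z, `|phi z| <= M.
Proof.
have cD : continuous (fun z => 'D_(evec R ord_max) phi z) by case: tphi => /(_ ord_max)[].
have [M M0 DM] := continuous_bounded_square cD.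
exists M => // -[x y]; have [sq|nsq] := pselect (square R (x, y)); last first.
  by rewrite (test_fun_out nsq).1 normr0.
have /square_closed_square[/= x01 y01] := sq.
move: (y01); rewrite in_itv/= => /andP[y0 y1].
have nx0 : ~ square R (x, 0) by case=> _; rewrite /unit_interval/= in_itv/= ltxx.
have [c c01] := MVT_segment y0 (fun t _ => test_fun_slice1 x t)
   (continuous_subspaceT (is_derive_continuous (test_fun_slice1 x))).
rewrite (test_fun_out nx0).1 !subr0 => ->; rewrite normrM (ger0_norm y0).
apply: (@le_trans _ _ (M * 1)); last by rewrite mulr1.
apply: ler_pM => //; apply: DM; split => //=.
move: c01; rewrite !in_itv/= => /andP[-> cy]; exact: le_trans cy y1.
Qed.

Lemma square_integral0 h (M : R) : measurable_fun setT (h : plane R -> R) ->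
  (forall z, square R z -> `|h z| <= M) -> (forall z, ~ square R z -> h z = 0) ->
  (forall x, \int[mu]_y (h (x, y))%:E = 0)%E \/ (forall y, \int[mu]_x (h (x, y))%:E = 0)%E ->
  (\int[mu2]_(z in square R) (h z)%:E = 0)%E.
Proof.
move=> mh hM h0 H.
have E : h = h \_ (square R).
  apply/funext => z; rewrite patchE; case: ifPn => // /negP zs; apply: h0 => zs'.
  by apply: zs; exact/mem_set.
have ih : mu2.-integrable setT (EFin \o h).
  by rewrite E; exact: trunc_integrable (integrable_square mh hM).
rewrite integral_mkcond restrict_EFin -E.
case: H => H; [rewrite -(integral12_prod_meas1 ih)|rewrite -(integral21_prod_meas1 ih)].
  by rewrite integral0_eq// => x _; rewrite /fubini_F; exact: H.
by rewrite integral0_eq// => x _; rewrite /fubini_G; exact: H.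
Qed.

Lemma by_parts1 (F f psi dpsi : R -> R) : (forall t : R, is_derive t 1 F (f t)) -> continuous f ->
  (forall t : R, is_derive t 1 psi (dpsi t)) -> continuous dpsi ->
  (forall t, ~ (0 < t < 1) -> psi t = 0 /\ dpsi t = 0) ->
  (\int[mu]_t (F t * dpsi t + f t * psi t)%:E = 0)%E.
Proof.
move=> dF cf dp cdp p0; have cF := is_derive_continuous dF; have cp := is_derive_continuous dp.
have [p00 _] : psi 0 = 0 /\ dpsi 0 = 0 by apply: p0; rewrite ltxx.
have [p11 _] : psi 1 = 0 /\ dpsi 1 = 0 by apply: p0; rewrite ltxx andbF.
have dG (t : R) : is_derive t 1 (fun t => F t * psi t) (F t * dpsi t + f t * psi t).
  have h := is_deriveM (dF t) (dp t); apply: is_derive_eq h _.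
  by rewrite /GRing.scale/= [psi t * _]mulrC.
have cG : continuous (fun t => F t * dpsi t + f t * psi t).
  by move=> t; apply: cvgD; apply: cvgM; [exact: cF|exact: cdp|exact: cf|exact: cp].
rewrite (integral_is_derive (@ltr01 R) dG cG) ?p00 ?p11 ?mulr0 ?subrr//.
move=> t h; have [|-> ->] := p0 t; last by rewrite !mulr0 addr0.
by move=> /andP[/ltW t0 /ltW t1]; apply: h; rewrite t0.
Qed.

(** The sum [f * D phi + g * phi] is the derivative of [f * phi], so its integral over each line in
    the direction [i] is 0. *)
Lemma by_parts (i : 'I_2) f g : continuous f -> continuous g ->
  (forall z, is_derive z (evec R i) f (g z)) ->
  (\int[mu2]_(z in square R) (f z * 'D_(evec R i) phi z)%:E =
   - \int[mu2]_(z in square R) (g z * phi z)%:E)%E.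
Proof.
move=> cf cg dfg; have cD : continuous (fun z => 'D_(evec R i) phi z) by case: tphi => /(_ i)[].
have [Mf Mf0 fM] := continuous_bounded_square cf.
have [Mg Mg0 gM] := continuous_bounded_square cg.
have [MD MD0 DM] := continuous_bounded_square cD.
have [Mp Mp0 pM] := test_fun_bounded.
have m1 : measurable_fun setT (fun z : plane R => f z * 'D_(evec R i) phi z).
  by apply: measurable_funM; exact: continuous_plane_measurable.
have m2 : measurable_fun setT (fun z : plane R => g z * phi z).
  by apply: measurable_funM; [exact: continuous_plane_measurable|exact: test_fun_measurable].
have b1 z : square R z -> `|f z * 'D_(evec R i) phi z| <= Mf * MD.
  by move=> /square_closed_square zs; rewrite normrM ler_pM ?fM ?DM.
have b2 z : square R z -> `|g z * phi z| <= Mg * Mp.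
  by move=> /square_closed_square zs; rewrite normrM ler_pM ?gM ?pM.
have i1 := integrable_square m1 b1; have i2 := integrable_square m2 b2.
have msq := @measurable_square R.
apply/eqP; rewrite -[X in _ == X]add0e -sube_eq ?oppeK; last 2 first.
- exact: integrable_fin_num i1.
- by rewrite fin_num_adde_defr.
rewrite -integralD//; apply/eqP.
apply: (square_integral0 (h := fun z => f z * 'D_(evec R i) phi z + g z * phi z)
  (M := Mf * MD + Mg * Mp)).
- exact: measurable_funD.
- by move=> z zs; apply: le_trans (ler_normD _ _) _; apply: lerD; [exact: b1|exact: b2].
- by move=> z /test_fun_out[-> ->]; rewrite !mulr0 addr0.
case: (ord2P i) => ei; subst i; [right => y|left => x].
  apply: (by_parts1 (F := fun t => f (t, y)) (f := fun t => g (t, y))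
     (psi := fun t => phi (t, y)) (dpsi := fun t => 'D_(evec R ord0) phi (t, y))).
  - by move=> t; exact: is_derive_slice0.
  - exact: continuous_slice0.
  - by move=> t; exact: test_fun_slice0.
  - exact: (@continuous_slice0 (fun z => 'D_(evec R ord0) phi z)).
  - move=> t nt; suff /test_fun_out[-> ->] : ~ square R (t, y) by [].
    by case; rewrite /unit_interval/= in_itv.
apply: (by_parts1 (F := fun t => f (x, t)) (f := fun t => g (x, t))
   (psi := fun t => phi (x, t)) (dpsi := fun t => 'D_(evec R ord_max) phi (x, t))).
- by move=> t; exact: is_derive_slice1.
- exact: continuous_slice1.
- by move=> t; exact: test_fun_slice1.
- exact: (@continuous_slice1 (fun z => 'D_(evec R ord_max) phi z)).
move=> t nt; suff /test_fun_out[-> ->] : ~ square R (x, t) by [].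
by case=> _; rewrite /unit_interval/= in_itv.
Qed.
End test.
End by_parts.

Section total_variation_density.
Context {R : realType}.

Lemma sqrt_sum_le (I : finType) (x : I -> R) :
  \sum_i x i ^+ 2 <= (\sum_i `|x i|) ^+ 2.
Proof.
elim: (index_enum I) => [|i r ih]; first by rewrite !big_nil expr0n.
rewrite !big_cons sqrrD -normrX ger0_norm ?sqr_ge0// -addrA lerD2l.
by apply: le_trans ih _; rewrite lerDr mulrn_wge0// mulr_ge0// sumr_ge0.
Qed.

Lemma sqrt_sum2_le m n (x : 'I_m -> 'I_n -> R) :
  Num.sqrt (\sum_i \sum_j x i j ^+ 2) <= \sum_i \sum_j `|x i j|.
Proof.
rewrite -[leRHS]ger0_norm; last by apply: sumr_ge0 => i _; exact: sumr_ge0.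
rewrite -sqrtr_sqr ler_sqrt ?sqr_ge0//.
apply: le_trans (_ : \sum_i (\sum_j `|x i j|) ^+ 2 <= _).
  by apply: ler_sum => i _; exact: sqrt_sum_le.
apply: le_trans (sqrt_sum_le _) _; rewrite le_eqVlt; apply/orP; left; apply/eqP.
by congr (_ ^+ 2); apply: eq_bigr => i _; rewrite ger0_norm// sumr_ge0.
Qed.

(** On each set of a partition, the Frobenius norm is at most the sum of the moduli of the entries,
    and each of these is at most the integral of the modulus of its density. *)
Lemma total_variation_density d (T : measurableType d) (mm : {measure set T -> \bar R}) (m n : nat)
    (f : 'I_m -> 'I_n -> T -> R) (intf : forall i j, mm.-integrable setT (EFin \o f i j)) (A : set T) :
  measurable A ->
  (Defs.total_variation (fun i j => induced_charge (intf i j)) A <=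
   \int[mm]_(z in A) (\sum_i \sum_j `|f i j z|)%:E)%E.
Proof.
move=> mA; apply: ge_ereal_sup => _ [E [mE tE EA ->]].
have mf i j : measurable_fun setT (fun z => `|f i j z|).
  by apply: measurableT_comp => //; apply/measurable_EFinP; exact: measurable_int (intf i j).
have mG : measurable_fun setT (fun z => \sum_i \sum_j `|f i j z|).
  by apply: measurable_sum => i; apply: measurable_sum.
have G0 z : (0 <= (\sum_i \sum_j `|f i j z|)%:E)%E.
  by rewrite lee_fin; apply: sumr_ge0 => i _; exact: sumr_ge0.
rewrite -EA ge0_integral_bigcup//; last first.
  by apply/measurable_EFinP; exact: measurable_funTS.
apply: lee_nneseries => [k _ _|k _].
  by rewrite lee_fin sqrtr_ge0.
apply: le_trans (_ : (\sum_i \sum_j `|fine (induced_charge (intf i j) (E k))|)%:E <= _)%E.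
  by rewrite lee_fin; exact: sqrt_sum2_le.
under [leRHS]eq_integral do rewrite -sumEFin.
rewrite -sumEFin ge0_integral_sum//; last 2 first.
- move=> i; apply/measurable_EFinP; apply: measurable_funTS; exact: measurable_sum.
- by move=> i z _; rewrite lee_fin sumr_ge0.
apply: lee_sum => i _.
under [leRHS]eq_integral do rewrite -sumEFin.
rewrite -sumEFin ge0_integral_sum//; last first.
- by move=> j; apply/measurable_EFinP; exact: measurable_funTS.
apply: lee_sum => j _.
have iE : mm.-integrable (E k) (EFin \o f i j) by exact: integrableS (intf i j).
rewrite -abse_EFin fineK; last exact: integrable_fin_num iE.
exact: le_abse_integral (measurable_int _ iE).
Qed.

End total_variation_density.

(** * Competitors given by functions of class C^2 *)

Section jets.
Context {R : realType}.
Local Notation mu := (@lebesgue_measure R).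
Local Notation mu2 := (leb2 R).

(* [J a b] stands for the derivative of [J 0 0], [a] times in [x_1] and [b] times in [x_2]. *)
Definition jet (J : nat -> nat -> R * R -> R) : Prop :=
  (forall a b, (a + b <= 2)%N -> continuous (J a b)) /\
  forall a b (i : 'I_2) z, (a + b < 2)%N ->
    is_derive z (evec R i) (J a b) (J (a + (i == ord0))%N (b + (i == ord_max))%N z).

Definition elastic (p th : R) (J : nat -> nat -> R * R -> R) (z : R * R) : R :=
  `|J 1%N 0%N z| `^ p + well p th (J 0%N 1%N z).

Definition surface (J : nat -> nat -> R * R -> R) (z : R * R) : R :=
  `|J 2%N 0%N z| + 2 * `|J 1%N 1%N z| + `|J 0%N 2%N z|.

Lemma continuous_Lp (p : R) (f : R * R -> R) : 0 < p -> continuous f -> Lp mu2 (square R) p f.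
Proof.
move=> p0 cf; have mf := continuous_plane_measurable cf.
split; first exact: measurable_funTS.
have [M M0 fM] := continuous_bounded_square cf.
have : mu2.-integrable (square R) (EFin \o (fun z => `|f z| `^ p)).
  apply: (@integrable_square _ _ (M `^ p)).
    by apply: (measurableT_comp (measurable_powR p)); exact: measurableT_comp.
  move=> z /square_closed_square zs; have fzM := fM z zs.
  by rewrite ger0_norm ?powR_ge0// ge0_ler_powR ?nnegrE ?(ltW p0).
by apply: integrable_lty; exact: measurable_square.
Qed.

(** The function is continuous up to the boundary, so a constant sequence computes its trace. The
    second derivatives, cut off outside the square to be integrable on the plane, are the densities
    of the Hessian; the mixed one occurs in two entries, hence the factor 2 in [surface]. *)
Lemma classB_of_jet (p : R) (J : nat -> nat -> R * R -> R) : 1 < p -> jet J ->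
  (forall y, J 0%N 0%N (0, y) = 0) ->
  exists v : classB p, forall th eps : R, 0 <= eps ->
    (energy eps th v <= \int[mu2]_(z in square R) (elastic p th J z)%:E +
       eps%:E * \int[mu2]_(z in square R) (surface J z)%:E)%E.
Proof.
move=> p1 [cJ dJ] J0; have p0 : 0 < p by apply: lt_trans p1.
have msq := @measurable_square R.
pose g (i : 'I_2) : plane R -> R := J (0 + (i == ord0))%N (0 + (i == ord_max))%N.
pose H (i j : 'I_2) : plane R -> R :=
  J (0 + (j == ord0) + (i == ord0))%N (0 + (j == ord_max) + (i == ord_max))%N.
have cg i : continuous (g i : R * R -> R) by apply: cJ; case: (ord2P i) => ->.
have cH i j : continuous (H i j : R * R -> R).
  by apply: cJ; case: (ord2P i) => ->; case: (ord2P j) => ->.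
have intH i j : mu2.-integrable setT (EFin \o trunc (H i j)).
  by apply: trunc_integrable; exact: continuous_integrable_square.
have c0 : continuous (J 0%N 0%N) by exact: cJ.
have Sv : sobolev p (J 0%N 0%N) g.
  split; first exact: continuous_Lp.
  move=> i; split; first exact: continuous_Lp.
  by move=> phi tphi; apply: by_parts => // z; exact: dJ.
have BV j : BV_derivative (g j) (fun i => induced_charge (intH i j)).
  split; first exact: continuous_integrable_square.
  move=> i phi tphi; have [M _ pM] := test_fun_bounded tphi.
  rewrite (@cintegral_induced _ _ _ _ sigma_finite_leb2 _ _ _ phi M)//; last first.
    by apply: measurable_funTS; exact: test_fun_measurable.
  have dH z : is_derive z (evec R i) (g j) (H i j z).
    by apply: dJ; case: (ord2P j) => ->.
  rewrite (by_parts tphi (cg j) (cH i j) dH).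
  congr (- _)%E; apply: eq_integral => z /set_mem zs.
  by rewrite /= trunc_in// -EFinM mulrC.
have tr : left_trace p (J 0%N 0%N) g (cst 0).
  have z0 : (0 : R) `^ p = 0 by rewrite powR0// gt_eqF.
  split.
    split; first exact: measurable_cst.
    by under eq_integral do rewrite /= normr0 z0; rewrite integral0 ltry.
  exists (fun _ => J 0%N 0%N), (fun _ => g); split.
  - by move=> n; split => //; exact: continuous_subspaceT.
  - by under eq_fun do under eq_integral do rewrite subrr normr0 z0; under eq_fun do rewrite integral0; exact: cvg_cst.
  - by move=> i; under eq_fun do under eq_integral do rewrite subrr normr0 z0; under eq_fun do rewrite integral0; exact: cvg_cst.
  - by under eq_fun do under eq_integral do rewrite /= J0 subrr normr0 z0; under eq_fun do rewrite integral0; exact: cvg_cst.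
exists (ClassB Sv BV tr) => th eps eps0; rewrite /energy /=; apply: leeD; first by [].
apply: lee_wpmul2l; first by rewrite lee_fin.
apply: le_trans (total_variation_density intH msq) _.
rewrite le_eqVlt; apply/orP; left; apply/eqP; apply: eq_integral => z /set_mem zs; congr EFin.
rewrite !big_ord_recl !big_ord0 !trunc_in// /surface !addr0 mulr_natl mulr2n.
by rewrite !addrA.
Qed.

End jets.

(** * The branching construction *)

Section waves.
Context {R : realType}.
Implicit Types (m a b u x y : R) (s : nat -> R) (S : R -> nat -> R).

(* The [j]-th derivative of a convex function, which vanishes for [u <= 0] and has slope 1
   for [4 / m <= u]. *)
Definition pulse m j u : R := m ^+ j / m * spl (5 - j) (m * u).

Lemma is_derive_pulse m j u : (j <= 2)%N -> is_derive u 1 (pulse m j) (pulse m j.+1 u).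
Proof.
move=> j2.
have h n : is_derive u 1 (fun y : R => spl n.+2 (m * y)) (m * spl n.+1 (m * u)).
  have := is_derive_scaled n m 0 u; rewrite subr0.
  by rewrite (_ : (fun y => spl n.+2 (m * (y - 0))) = (fun y => spl n.+2 (m * y)))//;
    apply/funext => y; rewrite subr0.
have -> : pulse m j = (m ^+ j / m) \*: (fun y => spl (4 - j).+1 (m * y)).
  by apply/funext => y; rewrite /pulse -subSn// (leq_trans j2).
have := is_deriveZ (m ^+ j / m) (h (3 - j)%N).
rewrite -subSn ?(leq_trans j2)// => hh; apply: is_derive_eq hh _.
rewrite /pulse /GRing.scale/= mulrA exprSr subSS.
by congr (_ * _); rewrite -!mulrA [m^-1 * m]mulrC.
Qed.

Lemma continuous_pulse m j : continuous (pulse m j).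
Proof.
move=> u; apply: cvgMr.
have h : m * z @[z --> u] --> m * u by apply: cvgMr; exact: cvg_id.
exact: (cvg_comp _ _ h (@continuous_spl _ _ _)).
Qed.

Lemma pulse1 m a y : m != 0 -> pulse m 1 (y - a) = ramp m a y.
Proof. by move=> m0; rewrite /pulse expr1 divff// mul1r. Qed.

Lemma pulse2 m a y : m != 0 -> pulse m 2 (y - a) = kernel m a y.
Proof. by move=> m0; rewrite /pulse expr2 mulfK. Qed.

(* [s i] is the [i]-th derivative in [x_1] of the parameter, on which the interface position
   [a + b * s 0] depends. *)
Definition wave m s a b (i j : nat) y : R :=
  let u := y - (a + b * s 0%N) in
  match i with
  | 0 => pulse m j u
  | 1 => - (b * s 1%N) * pulse m j.+1 u
  | _ => - (b * s 2%N) * pulse m j.+1 u + (b * s 1%N) ^+ 2 * pulse m j.+2 u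
  end.

Definition tilt s (i j : nat) y : R :=
  match j with 0 => s i * y | 1 => s i | _ => 0 end.

Definition time S : Prop := (forall n, (n <= 2)%N -> continuous (S ^~ n)) /\
  forall n x, (n < 2)%N -> is_derive x 1 (S ^~ n) (S x n.+1).

Definition stime m a x n : R := m ^+ n * spl (4 - n) (m * (x - a)).

Lemma time_stime m a : time (stime m a).
Proof.
split=> [n n2|n x n2]; first by move=> x; apply: cvgMr; exact: continuous_scaled.
have := is_deriveZ (m ^+ n) (is_derive_scaled (2 - n)%N m a x).
case: n n2 => [|[|//]] _ h; apply: is_derive_eq h _.
  by rewrite /stime /GRing.scale/= expr0 expr1 mul1r.
by rewrite /stime /GRing.scale/= mulrA expr2 expr1.
Qed.

Lemma time_cst s : s 1%N = 0 -> s 2%N = 0 -> time (fun _ => s).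
Proof.
move=> s1 s2; split => [n _|n x n2]; first by move=> x; exact: cvg_cst.
apply: is_derive_eq (is_derive_cst (s n) x 1) _.
by case: n n2 => [|[|//]] _.
Qed.

Lemma jetI (J : nat -> nat -> R * R -> R) :
  (forall a b : nat, (a + b <= 2)%N -> continuous (J a b)) ->
  (forall (a b : nat) x y, (a + b < 2)%N -> is_derive x 1 (fun t => J a b (t, y)) (J a.+1 b (x, y))) ->
  (forall (a b : nat) x y, (a + b < 2)%N -> is_derive y 1 (fun t => J a b (x, t)) (J a b.+1 (x, y))) ->
  jet J.
Proof.
move=> c d0 d1; split => // a b i [x y] ab; case: (ord2P i) => ->.
  by rewrite /= addn1 addn0; apply: derivable_evec0; exact: d0.
by rewrite /= addn1 addn0; apply: derivable_evec1; exact: d1.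
Qed.

Lemma continuous_fst1 (f : R -> R) : continuous f -> continuous (fun z : R * R => f z.1).
Proof. by move=> cf z; apply: continuous_comp; [exact: cvg_fst|exact: cf]. Qed.

Lemma jet_wave m a b S : time S -> jet (fun i j z => wave m (S z.1) a b i j z.2).
Proof.
move=> [cS dS].
have cS1 n : (n <= 2)%N -> continuous (fun z : R * R => S z.1 n).
  by move=> n2; exact: (continuous_fst1 (cS n n2)).
have cu : continuous (fun z : R * R => z.2 - (a + b * S z.1 0%N)).
  move=> z; apply: cvgB; first exact: cvg_snd.
  by apply: cvgD; [exact: cvg_cst|apply: cvgMr; exact: cS1].
have cp j : continuous (fun z : R * R => pulse m j (z.2 - (a + b * S z.1 0%N))).
  by move=> z; exact: (cvg_comp _ _ (cu z) (@continuous_pulse m j _)).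
have dp j x y : (j <= 2)%N ->
    is_derive x 1 (fun t => pulse m j (y - (a + b * S t 0%N)))
      (- (b * S x 1%N) * pulse m j.+1 (y - (a + b * S x 0%N))).
  move=> j2.
  have h1 : is_derive x 1 (fun t => y - (a + b * S t 0%N)) (- (b * S x 1%N)).
    have h := is_deriveB (is_derive_cst y x 1)
      (is_deriveD (is_derive_cst a x 1) (is_deriveZ b (dS 0%N x isT))).
    by apply: is_derive_eq h _; rewrite sub0r add0r.
  have h2 := is_derive_pulse m (y - (a + b * S x 0%N)) j2.
  have h := is_derive1_comp (g := fun t => y - (a + b * S t 0%N)) h2 h1.
  by apply: is_derive_eq h _; rewrite ?[_ *: _]mulrC// mulrC.
apply: jetI.
- case=> [|[|[|//]]] j ij z.
  + exact: cp.
  + by apply: cvgM; [apply: cvgN; apply: cvgMr; exact: cS1|exact: cp].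
  + apply: cvgD; apply: cvgM; try exact: cp.
      by apply: cvgN; apply: cvgMr; exact: cS1.
    by apply: cvgM; apply: cvgMr; exact: cS1.
- case=> [|[|//]] j x y ij.
  + by apply: dp; rewrite ltnW.
  + have h1 : is_derive x 1 (fun t => - (b * S t 1%N)) (- (b * S x 2%N)).
      by have h := is_deriveN (is_deriveZ b (dS 1%N x isT)); exact: is_derive_eq h _.
    have j2 : (j.+1 <= 2)%N by move: ij; rewrite add1n ltnS => /leq_trans; apply.
    have h := is_deriveM h1 (dp j.+1 x y j2); apply: is_derive_eq h _.
    rewrite /wave /GRing.scale/=; ring.
- have dy j c y : (j <= 2)%N -> is_derive y 1 (fun t => pulse m j (t - c)) (pulse m j.+1 (y - c)).
    move=> j2; have h1 : is_derive y 1 (fun t => t - c) 1.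
      have h := is_deriveB (is_derive_id y 1) (is_derive_cst c y 1).
      by apply: is_derive_eq h _; rewrite subr0.
    have h2 := is_derive_pulse m (y - c) j2.
    by have h := is_derive1_comp (g := fun t => t - c) h2 h1; apply: is_derive_eq h _; rewrite ?scale1r ?mul1r ?mulr1.
  case=> [|[|//]] j x y ij.
  + exact: (dy j (a + b * S x 0%N) y (ltnW (ij : (j < 2)%N))).
  + have j2 : (j.+1 <= 2)%N by move: ij; rewrite add1n ltnS => /leq_trans; apply.
    by have h := is_deriveZ (- (b * S x 1%N)) (dy j.+1 (a + b * S x 0%N) y j2); exact: is_derive_eq h _.
Qed.

Lemma jet_tilt S : time S -> jet (fun i j z => tilt (S z.1) i j z.2).
Proof.
move=> [cS dS].
have cS1 n : (n <= 2)%N -> continuous (fun z : R * R => S z.1 n).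
  by move=> n2; exact: (continuous_fst1 (cS n n2)).
apply: jetI.
- move=> i [|[|j]] ij z; last exact: cvg_cst.
    by apply: cvgM; [apply: cS1; rewrite addn0 in ij|exact: cvg_snd].
  by apply: cS1; apply: leq_trans ij; exact: leq_addr.
- move=> i [|[|j]] x y ij; last exact: (is_derive_cst (0 : R) x 1).
  + rewrite addn0 in ij.
    have h := is_deriveM (dS i x ij) (is_derive_cst y x 1); apply: is_derive_eq h _.
    by rewrite /tilt /GRing.scale/= mulr0 add0r mulrC.
  + by apply: dS; apply: leq_ltn_trans ij; exact: leq_addr.
- move=> i [|[|j]] x y ij; [|exact: (is_derive_cst (S x i) y 1)|exact: (is_derive_cst (0 : R) y 1)].
  + have h := is_deriveZ (S x i) (is_derive_id y 1); apply: is_derive_eq h _.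
    exact: mulr1.
Qed.

Lemma jetD J1 J2 : jet J1 -> jet J2 -> jet (fun i j (z : R * R) => J1 i j z + J2 i j z).
Proof.
move=> [c1 d1] [c2 d2]; split => [a b ab z|a b i z ab].
  by apply: cvgD; [exact: c1|exact: c2].
exact: (is_deriveD (d1 a b i z ab) (d2 a b i z ab)).
Qed.

Lemma jetZ (c : R) J : jet J -> jet (fun i j (z : R * R) => c * J i j z).
Proof.
move=> [c1 d1]; split => [a b ab z|a b i z ab].
  by apply: cvgMr; exact: c1.
exact: (is_deriveZ c (d1 a b i z ab)).
Qed.

Lemma jetB J1 J2 : jet J1 -> jet J2 -> jet (fun i j (z : R * R) => J1 i j z - J2 i j z).
Proof.
move=> h1 h2; rewrite (_ : (fun i j z => _) = (fun i j z => J1 i j z + (-1) * J2 i j z)).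
  exact: jetD h1 (jetZ _ h2).
by apply/funext => i; apply/funext => j; apply/funext => z; rewrite mulN1r.
Qed.

Lemma jet_sum n (J : nat -> nat -> nat -> R * R -> R) : (forall k, jet (J k)) ->
  jet (fun i j z => \sum_(k < n) J k i j z).
Proof.
move=> h; elim: n => [|n ih].
  rewrite (_ : (fun i j z => _) = (fun i j z => 0 * J 0%N i j z)); first exact: jetZ.
  by apply/funext => i; apply/funext => j; apply/funext => z; rewrite big_ord0 mul0r.
rewrite (_ : (fun i j z => _) = (fun i j z => \sum_(k < n) J k i j z + J n i j z)).
  exact: jetD.
by apply/funext => i; apply/funext => j; apply/funext => z; rewrite big_ord_recr.
Qed.

End waves.

(** * Energy of a layer of teeth *)

Section layers.
Context {R : realType}.
Local Notation mu := (@lebesgue_measure R).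
Local Notation mu2 := (leb2 R).

Lemma spl_nondecreasing n (t t' : R) : (forall c : R, 0 <= spl n.+1 c) -> t <= t' -> spl n.+2 t <= spl n.+2 t'.
Proof.
move=> s0 tt'; have [c _ E] := MVT_segment tt' (fun x _ => is_derive_spl n x)
  (continuous_subspaceT (@continuous_spl R n.+2)).
by rewrite -subr_ge0 E mulr_ge0// subr_ge0.
Qed.

Lemma ramp_nonincreasing (m a b y : R) : 0 < m -> a <= b -> ramp m b y <= ramp m a y.
Proof.
move=> m0 ab; apply: spl_nondecreasing => [c|]; first by have /andP[] := spl3_01 c.
by rewrite ler_pM2l// lerB.
Qed.

(** The quantity [x * (1 - x)] measures the distance from 0 and 1. When the pair [a], [b] is added
    to a partial sum [S], the right-hand side exceeds the new value by at least [2 * ((b - S) * (1 -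
    a)) + 2 * (S * (1 - b))], whose factors are nonnegative along a decreasing chain. *)
Lemma alternating_sum n (u v : nat -> R) :
  (forall k, [/\ 0 <= v k, v k <= u k, u k <= 1 & u k.+1 <= v k]) ->
  0 <= \sum_(k < n) (u k - v k) <= u 0%N /\
  (\sum_(k < n) (u k - v k)) * (1 - \sum_(k < n) (u k - v k)) <=
  \sum_(k < n) (u k * (1 - u k) + v k * (1 - v k)).
Proof.
elim: n u v => [|n ih] u v h.
  rewrite !big_ord0 mul0r !lexx; have [h1 h2 _ _] := h 0%N.
  by rewrite (le_trans h1).
have [/andP[S0 S1] qS] := ih (fun k => u k.+1) (fun k => v k.+1) (fun k => h k.+1).
rewrite !big_ord_recl /= /bump /=; move: S0 S1 qS.
set S := \sum_(k < n) _; set Q := \sum_(k < n) _ => S0 S1 qS.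
have [v0 vu u1 uv] := h 0%N.
have Sv : S <= v 0%N := le_trans S1 uv.
move: (u 0%N) (v 0%N) v0 vu u1 Sv => a b b0 ab a1 Sb.
split; first by apply/andP; split; lra.
have e1 : 0 <= S * (1 - b) by rewrite mulr_ge0//; lra.
have e2 : 0 <= (b - S) * (1 - a) by rewrite mulr_ge0//; lra.
have E : a * (1 - a) + b * (1 - b) + S * (1 - S) - (a - b + S) * (1 - (a - b + S)) =
  2 * ((b - S) * (1 - a)) + 2 * (S * (1 - b)) by ring.
by rewrite -subr_ge0; apply: le_trans (_ : 0 <= 2 * ((b - S) * (1 - a)) + 2 * (S * (1 - b))) _;
  [rewrite addr_ge0// mulr_ge0|rewrite -E lerD2r lerD2l].
Qed.

Lemma powR_le_max (p x e t : R) : 1 < p -> 0 <= x <= 1 -> 0 <= e -> `|t| <= 2 * Num.max x e ->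
  `|t| `^ p <= 2 `^ p * (x + e `^ p).
Proof.
move=> p1 /andP[x0 x1] e0 tm; have p0 : 0 <= p by rewrite (le_trans ler01)// ltW.
have m0 : 0 <= Num.max x e by rewrite le_max x0.
apply: le_trans (_ : (2 * Num.max x e) `^ p <= _).
  by apply: ge0_ler_powR => //; rewrite nnegrE ?mulr_ge0.
rewrite powRM// ler_wpM2l ?powR_ge0//.
have [xe|ex] := leP x e; first by rewrite lerDr.
apply: le_trans (_ : x <= _); last by rewrite lerDl powR_ge0.
have [->|xn0] := eqVneq x 0; first by rewrite powR0// gt_eqF// (lt_trans ltr01).
by rewrite -[leRHS]powRr1//; apply: ger_powR; rewrite ?lt0r ?xn0 ?x0 ?x1// ltW.
Qed.

(** The nearer well is taken, according as [x <= 1 / 2] or not: [2 * (x * (1 - x))] is at least the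
    distance of [x] to the nearer of 0 and 1, and numbers in [[0, 1]] decrease when raised to the
    power [p]. The shift [e] stands for the defect of slope of a growing layer. *)
Lemma well_shift (p th e0 e x : R) : 1 < p -> 0 <= x <= 1 -> 0 <= e <= e0 ->
  well p th (x - th + e) <= 2 `^ p * (2 * (x * (1 - x)) + e0 `^ p).
Proof.
move=> p1 /andP[x0 x1] /andP[e00 ee0]; rewrite /well.
have e00' : 0 <= e0 := le_trans e00 ee0.
rewrite (_ : x - th + e + th = x + e); last by ring.
rewrite (_ : x - th + e - (1 - th) = e - (1 - x)); last by ring.
have [xh|xh] := leP x (1 / 2).
  apply: le_trans (_ : `|x + e| `^ p <= _); first by rewrite ge_min lexx.
  apply: le_trans (_ : 2 `^ p * (x + e0 `^ p) <= _).
    apply: powR_le_max => //; first by rewrite x0.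
    rewrite ger0_norm ?addr_ge0// mulr_natl mulr2n; apply: lerD; rewrite le_max ?lexx//.
    by rewrite ee0 orbT.
  rewrite ler_wpM2l ?powR_ge0// lerD2r.
  have := mulr_ge0 x0 (_ : 0 <= 1 - 2 * x); rewrite -subr_ge0.
  by move=> /(_ ltac:(lra)); rewrite mulrBr mulr1 !mulrBr mulr1; lra.
apply: le_trans (_ : `|e - (1 - x)| `^ p <= _); first by rewrite ge_min lexx orbT.
apply: le_trans (_ : 2 `^ p * ((1 - x) + e0 `^ p) <= _).
  apply: powR_le_max => //; first by apply/andP; split; lra.
  have : 0 <= 1 - x by lra.
  move: (1 - x) => w w0; rewrite ler_norml.
  by have [we|we] := leP w e0; apply/andP; split; lra.
rewrite ler_wpM2l ?powR_ge0// lerD2r.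
have : 0 <= (1 - x) * (2 * x - 1) by rewrite mulr_ge0//; lra.
by rewrite mulrBr mulr1; lra.
Qed.

(** It is used for the indicators of the smoothed interfaces, with [de = 4 / m], and for the
    kernels, with [de = 1]. *)
Lemma slice_sum_le (w : R -> R -> R) (K1 K2 de : R) n (c d : nat -> R) (g : R -> R) :
  0 <= K1 -> 0 <= K2 -> 0 <= de ->
  (forall a, measurable_fun setT (w a : measurableTypeR R -> R)) -> (forall a y, 0 <= w a y) ->
  (forall a, (\int[mu]_(y in unit_interval R) (w a y)%:E <= de%:E)%E) ->
  measurable_fun setT (g : measurableTypeR R -> R) -> (forall y, 0 <= g y) ->
  (forall y, 0 < y < 1 -> g y <= K1 + K2 * \sum_(k < n) (w (c k) y + w (d k) y)) ->
  (\int[mu]_(y in unit_interval R) (g y)%:E <= (K1 + K2 * (n%:R * (2 * de)))%:E)%E.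
Proof.
move=> K10 K20 de0 mw w0 iw mg g0 gle.
have mI := @measurable_unit_interval R.
have ms k : measurable_fun setT (fun y : measurableTypeR R => w (c k) y + w (d k) y).
  exact: measurable_funD.
have mS : measurable_fun setT (fun y : measurableTypeR R => \sum_(k < n) (w (c k) y + w (d k) y)).
  by apply: measurable_sum => k; exact: ms.
have S0 y : 0 <= \sum_(k < n) (w (c k) y + w (d k) y).
  by apply: sumr_ge0 => k _; exact: addr_ge0.
apply: (@le_trans _ _ (\int[mu]_(y in unit_interval R)
   (K1 + K2 * \sum_(k < n) (w (c k) y + w (d k) y))%:E)%E).
  apply: ge0_le_integral => //.
  - by move=> y _; rewrite lee_fin.
  - by apply/measurable_EFinP; exact: measurable_funTS.
  - apply/measurable_EFinP; apply: measurable_funTS; apply: measurable_funD => //.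
    exact: measurable_funM.
under eq_integral do rewrite EFinD EFinM.
rewrite ge0_integralD//; last 2 first.
- by move=> y _; rewrite mule_ge0// lee_fin.
- by under eq_fun do rewrite -EFinM; apply/measurable_EFinP; apply: measurable_funTS; apply: measurable_funM.
rewrite integral_unit_cst EFinD; apply: leeD => //.
rewrite ge0_integralZl_EFin//; last 2 first.
- by move=> y _; rewrite lee_fin.
- by apply/measurable_EFinP; exact: measurable_funTS.
rewrite EFinM; apply: lee_wpmul2l => //.
under eq_integral do rewrite -sumEFin.
rewrite ge0_integral_sum//; last 2 first.
- by move=> k; apply/measurable_EFinP; exact: measurable_funTS.
- by move=> k y _; rewrite lee_fin addr_ge0.
apply: (@le_trans _ _ (\sum_(k < n) (2 * de)%:E)%E); last first.
  by rewrite sumEFin sumr_const card_ord -(mulr_natl (2 * de) n).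
apply: lee_sum => k _; under eq_integral do rewrite EFinD.
rewrite ge0_integralD//.
- by rewrite mulr_natl mulr2n EFinD; apply: leeD.
- by move=> y _; rewrite lee_fin.
- by apply/measurable_EFinP; exact: measurable_funTS.
- by move=> y _; rewrite lee_fin.
- by apply/measurable_EFinP; exact: measurable_funTS.
Qed.

Lemma strip_integral (f : plane R -> R) (K a b : R) : measurable_fun setT f ->
  (forall z, 0 <= f z) -> a <= b -> 0 <= K ->
  (forall x, a <= x < b -> (\int[mu]_(y in unit_interval R) (f (x, y))%:E <= K%:E)%E) ->
  (\int[mu2]_(z in `[a, b[ `*` unit_interval R) (f z)%:E <= (K * (b - a))%:E)%E.
Proof.
move=> mf f0 ab K0 fK; have mI := @measurable_unit_interval R.
set D := `[a, b[ `*` unit_interval R.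
have mD : measurable (D : set (plane R)) by apply: measurableX.
have mfD : measurable_fun setT ((EFin \o f) \_ D).
  apply/measurable_restrict => //; apply/measurable_EFinP; exact: measurable_funTS.
rewrite integral_mkcond (_ : (fun z => _) \_ D = (EFin \o f) \_ D)// fubini_tonelli1//; last first.
  by move=> z; rewrite patchE; case: ifP => // _; rewrite lee_fin.
apply: (@le_trans _ _ (\int[mu]_(x in `[a, b[) K%:E)%E); last first.
  rewrite integral_cst//= lebesgue_measure_itv/= lte_fin.
  have [_|ba] := ltP a b; first by rewrite -EFinB -EFinM.
  by rewrite mule0 lee_fin mulr_ge0// subr_ge0.
rewrite [leRHS]integral_mkcond; apply: ge0_le_integral => //.
- by move=> x _; apply: integral_ge0 => y _; rewrite patchE; case: ifP => // _; rewrite lee_fin.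
- apply: measurable_fun_fubini_tonelli_F => // z.
  by rewrite patchE; case: ifP => // _; rewrite lee_fin.
- exact/measurable_restrict.
move=> x _; rewrite /fubini_F patchE; case: ifPn => [/set_mem xab|xab].
  apply: le_trans (fK x xab); rewrite [leRHS]integral_mkcond.
  rewrite le_eqVlt; apply/orP; left; apply/eqP; apply: eq_integral => y _.
  rewrite !patchE; congr (if _ then _ else _).
  by apply/idP/idP => /set_mem h; apply/mem_set => //; case: h.
rewrite integral0_eq// => y _; rewrite patchE; case: ifPn => // /set_mem[h _].
by move/negP: xab; case; exact/mem_set.
Qed.

End layers.

Section layer_bounds.
Context {R : realType}.
Local Notation mu := (@lebesgue_measure R).
Local Notation mu2 := (leb2 R).

(* [M] teeth of slopes [1 - th] and [- th], up to the term [- th * tilt], whose right interfaces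
   move with the parameter [s]. For [kap = 0], [A = 1] and [B = alt], the teeth merge two by two
   as [s 0] goes from 0 to 1. For [kap = 1], [A = 0] and [B = 1], they grow from nothing, and the
   average slope is compensated by the term in [kap]. *)
Definition layer (m th kap : R) (M : nat) (A B s : nat -> R) (i j : nat) (y : R) : R :=
  - (th * kap) * tilt s i j y + \sum_(k < M) (wave m s (k%:R / M%:R) 0 i j y -
    wave m s (k%:R / M%:R + th / M%:R * A k) (th / M%:R * B k) i j y).

Definition one (i : nat) : R := if i is 0 then 1 else 0.

(** The part of the slope [- th] that does not move with the parameter is kept apart from [layer]:
    gluing adds the change of a layer only. *)
Definition sloped (m th kap : R) M (A B s : nat -> R) i j y : R :=
  - (th * (1 - kap)) * tilt one i j y + layer m th kap M A B s i j y.

Lemma jet_layer m th kap M A B S : time S ->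
  jet (fun i j z => layer m th kap M A B (S z.1) i j z.2).
Proof.
move=> tS; apply: jetD; first by apply: jetZ; exact: jet_tilt.
apply: (@jet_sum _ M (fun k i j z => wave m (S z.1) (k%:R / M%:R) 0 i j z.2 -
  wave m (S z.1) (k%:R / M%:R + th / M%:R * A k) (th / M%:R * B k) i j z.2)) => k.
by apply: jetB; exact: jet_wave.
Qed.

Lemma measurable_elastic p th J : jet J -> measurable_fun setT (elastic p th J : plane R -> R).
Proof.
move=> [cJ _]; apply: measurable_funD.
  apply: (measurableT_comp (measurable_powR p)); apply: measurableT_comp => //.
  by apply: continuous_plane_measurable; exact: cJ.
apply: (measurableT_comp (measurable_well p th)).
by apply: continuous_plane_measurable; exact: cJ.
Qed.

Lemma measurable_surface J : jet J -> measurable_fun setT (surface J : plane R -> R).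
Proof.
move=> [cJ _].
have h a b : (a + b <= 2)%N -> measurable_fun setT (fun z : plane R => `|J a b z| : R).
  move=> ab; apply: measurableT_comp => //.
  by apply: continuous_plane_measurable; exact: cJ.
apply: measurable_funD; last exact: h.
apply: measurable_funD; first exact: h.
by apply: measurable_funM => //; exact: h.
Qed.

Lemma elastic_ge0 p th J z : 0 <= @elastic R p th J z.
Proof. by rewrite addr_ge0 ?powR_ge0 ?well_ge0. Qed.

Lemma surface_ge0 J z : 0 <= @surface R J z.
Proof. by rewrite !addr_ge0 ?mulr_ge0. Qed.

Section slice.
Variables (p m th kap la : R) (M : nat) (A B s : nat -> R).
Hypotheses (p1 : 1 < p) (m0 : 0 < m) (th0 : 0 < th) (th12 : th <= 1 / 2) (la0 : 0 < la).
Hypotheses (k01 : 0 <= kap <= 1) (M0 : (0 < M)%N) (s01 : 0 <= s 0%N <= 1).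
Hypotheses (s1la : `|s 1%N| <= 4 / la) (s2la : `|s 2%N| <= (4 / la) ^+ 2).
Hypotheses (AB : forall k, 0 <= A k + B k * s 0%N <= 2) (B1 : forall k, `|B k| <= 1).

Let a k : R := k%:R / M%:R.
Let b k : R := k%:R / M%:R + th / M%:R * A k + th / M%:R * B k * s 0%N.
Let D y : R := - (th * kap) * y + \sum_(k < M) th / M%:R * B k * ramp m (b k) y.

Hypothesis HD : forall y, 0 < y < 1 -> `|D y| <= 2 * th / M%:R.

Let M0' : 0 < M%:R :> R. Proof. by rewrite ltr0n. Qed.
Let mn0 : m != 0. Proof. by rewrite gt_eqF. Qed.

(** The last term is the defect of slope. It vanishes for merging teeth and lies between 0 and
    [th * kap] in general. *)
Lemma sloped01 y : sloped m th kap M A B s 0 1 y =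
  \sum_(k < M) (ramp m (a k) y - ramp m (b k) y) - th + th * kap * (1 - s 0%N).
Proof.
rewrite /sloped /layer /= (eq_bigr (fun k : 'I_M => ramp m (a k) y - ramp m (b k) y)).
  by ring.
by move=> k _; rewrite mul0r addr0 !pulse1.
Qed.

Lemma sloped10 y : sloped m th kap M A B s 1 0 y = s 1%N * D y.
Proof.
rewrite /sloped /layer /= mul0r mulr0 add0r /D mulrDr mulr_sumr; congr (_ + _); first by ring.
apply: eq_bigr => k _; rewrite mul0r oppr0 !mul0r sub0r !pulse1// -/(b k); ring.
Qed.

Lemma sloped20 y : sloped m th kap M A B s 2 0 y =
  s 2%N * D y - s 1%N ^+ 2 * \sum_(k < M) (th / M%:R * B k) ^+ 2 * kernel m (b k) y.
Proof.
rewrite /sloped /layer /= mul0r mulr0 add0r /D mulrDr !mulr_sumr -addrA; congr (_ + _); first by ring.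
rewrite -sumrB; apply: eq_bigr => k _.
rewrite !mul0r expr0n/= oppr0 !mul0r addr0 sub0r !pulse1// !pulse2// -/(b k); ring.
Qed.

Lemma sloped11 y : sloped m th kap M A B s 1 1 y =
  s 1%N * (- (th * kap) + \sum_(k < M) th / M%:R * B k * kernel m (b k) y).
Proof.
rewrite /sloped /layer /= mulr0 add0r mulrDr mulr_sumr; congr (_ + _); first by ring.
apply: eq_bigr => k _; rewrite mul0r oppr0 !mul0r sub0r !pulse2// -/(b k); ring.
Qed.

Lemma sloped02 y : sloped m th kap M A B s 0 2 y =
  \sum_(k < M) (kernel m (a k) y - kernel m (b k) y).
Proof.
rewrite /sloped /layer /= !mulr0 !add0r; apply: eq_bigr => k _.
by rewrite mul0r addr0 !pulse2.
Qed.

(** The interfaces are ordered, [a k <= b k <= a k.+1], since [th <= 1 / 2] and the displacement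
    [A k + B k * s 0] is at most 2. The ramps then form a decreasing chain, and [x * (1 - x)] of a
    ramp is carried by its transition interval. *)
Lemma slice_alternating y : 0 <= \sum_(k < M) (ramp m (a k) y - ramp m (b k) y) <= 1 /\
  (\sum_(k < M) (ramp m (a k) y - ramp m (b k) y)) *
    (1 - \sum_(k < M) (ramp m (a k) y - ramp m (b k) y)) <=
  \sum_(k < M) (\1_(`]a k, a k + 4 / m[%classic) y + \1_(`]b k, b k + 4 / m[%classic) y).
Proof.
have q1 c : ramp m c y * (1 - ramp m c y) <= \1_(`]c, c + 4 / m[%classic) y.
  have /andP[r0 r1] := ramp_01 m c y.
  have [/andP[h1 h2]|h] := boolP (c < y < c + 4 / m).
    rewrite indicE mem_set/= ?in_itv/= ?h1//.
    by apply: le_trans (_ : 1 * 1 <= _); [apply: ler_pM; rewrite ?subr_ge0//; lra|rewrite mulr1].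
  apply: le_trans (_ : 0 <= _); last by rewrite indicE.
  have [cy|cy] := leP y c; first by rewrite ramp_le0// mul0r.
  rewrite cy/= -leNgt in h; rewrite ramp_ge1 ?subrr ?mulr0//.
have st k : 0 <= th / M%:R * (A k + B k * s 0%N) <= M%:R^-1.
  have /andP[h1 h2] := AB k; rewrite mulr_ge0 ?divr_ge0// ?(ltW th0)//=.
  rewrite mulrAC -[leRHS]mul1r ler_pM2r ?invr_gt0//.
  by apply: le_trans (_ : 1 / 2 * 2 <= _); [apply: ler_pM => //; exact: ltW|lra].
have bE k : b k = a k + th / M%:R * (A k + B k * s 0%N) by rewrite /b /a; ring.
have aS k : a k.+1 = a k + M%:R^-1 by rewrite /a -natr1 mulrDl mul1r.
have H k : [/\ 0 <= ramp m (b k) y, ramp m (b k) y <= ramp m (a k) y, ramp m (a k) y <= 1 &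
    ramp m (a k.+1) y <= ramp m (b k) y].
  have /andP[st1 st2] := st k.
  split; first by have /andP[] := ramp_01 m (b k) y.
  - by apply: ramp_nonincreasing => //; rewrite bE lerDl.
  - by have /andP[] := ramp_01 m (a k) y.
  - by apply: ramp_nonincreasing => //; rewrite bE aS lerD2l.
have [/andP[S0 S1] qS] := alternating_sum M H; split.
  by rewrite S0 (le_trans S1)//; have /andP[] := ramp_01 m (a 0%N) y.
by apply: le_trans qS _; apply: ler_sum => k _; apply: lerD; exact: q1.
Qed.

Lemma slice_elastic_le x y : 0 < y < 1 ->
  elastic p th (fun i j z => sloped m th kap M A B s i j z.2) (x, y) <=
  (8 * th / (la * M%:R)) `^ p + 2 `^ p * (th * kap) `^ p + 2 `^ p * 2 *
  \sum_(k < M) (\1_(`]a k, a k + 4 / m[%classic) y + \1_(`]b k, b k + 4 / m[%classic) y).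
Proof.
move=> y01; rewrite /elastic /= sloped10 sloped01 -[leRHS]addrA; apply: lerD.
  apply: ge0_ler_powR; rewrite ?nnegrE//; first by rewrite (le_trans ler01)// ltW.
    by rewrite !mulr_ge0 ?invr_ge0 ?mulr_ge0// ?(ltW th0) ?(ltW la0).
  rewrite normrM (_ : 8 * th / (la * M%:R) = 4 / la * (2 * th / M%:R)).
    by apply: ler_pM => //; exact: HD.
  by field; rewrite !gt_eqF.
have [S01 qS] := slice_alternating y.
have /andP[k0 k1] := k01; have /andP[s0 s1] := s01.
have tk : 0 <= th * kap by rewrite mulr_ge0// ltW.
apply: le_trans (@well_shift _ p th (th * kap) _ _ p1 S01 _) _.
  rewrite mulr_ge0 ?subr_ge0//=; apply: ler_piMr => //; lra.
by rewrite [leLHS]mulrDr [leLHS]addrC lerD2l mulrA ler_wpM2l// mulr_ge0// powR_ge0.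
Qed.

(** An interface moves in [x_1] with speed at most [4 / (la * M)], and its Hessian costs the square
    of 1 plus that speed. The terms outside the sum come from the acceleration [s 2] and from the
    compensating slope. *)
Lemma slice_surface_le x y : 0 < y < 1 ->
  surface (fun i j z => sloped m th kap M A B s i j z.2) (x, y) <=
  (32 / (la ^+ 2 * M%:R) + 8 / la) + (1 + 4 / (la * M%:R)) ^+ 2 *
  \sum_(k < M) (kernel m (a k) y + kernel m (b k) y).
Proof.
move=> y01; rewrite /surface /= sloped20 sloped11 sloped02.
have ka k : 0 <= kernel m (a k) y by exact: kernel_ge0.
have kb k : 0 <= kernel m (b k) y by exact: kernel_ge0.
set Q := \sum_(k < M) (kernel m (a k) y + kernel m (b k) y).
have Q2 : `|\sum_(k < M) (kernel m (a k) y - kernel m (b k) y)| <= Q.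
  apply: le_trans (ler_norm_sum _ _ _) _; apply: ler_sum => k _.
  by apply: le_trans (ler_normB _ _) _; rewrite !ger0_norm.
have h0 : 0 <= M%:R^-1 :> R by rewrite invr_ge0.
have [th1 th2] : th <= 1 /\ 2 * th <= 1 by move: th12 th0 => h1 h2; split; lra.
have tB k : `|th / M%:R * B k| <= M%:R^-1.
  rewrite normrM -[leRHS]mulr1; apply: ler_pM => //.
  by rewrite ger0_norm ?mulr_ge0 ?(ltW th0)// ler_piMl.
have Q1 : `|\sum_(k < M) th / M%:R * B k * kernel m (b k) y| <= M%:R^-1 * Q.
  apply: le_trans (ler_norm_sum _ _ _) _; rewrite mulr_sumr; apply: ler_sum => k _.
  by rewrite normrM; apply: ler_pM => //; rewrite ger0_norm// lerDr.
have Q0 : `|\sum_(k < M) (th / M%:R * B k) ^+ 2 * kernel m (b k) y| <= M%:R^-1 ^+ 2 * Q.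
  apply: le_trans (ler_norm_sum _ _ _) _; rewrite mulr_sumr; apply: ler_sum => k _.
  rewrite normrM normrX; apply: ler_pM => //; last by rewrite ger0_norm// lerDr.
  by rewrite ler_sqr ?nnegrE.
have D1 : `|D y| <= M%:R^-1.
  by apply: le_trans (HD y01) _; rewrite ler_piMl.
have Qp : 0 <= Q by apply: sumr_ge0 => k _; exact: addr_ge0.
have tk : `|- (th * kap)| <= 1.
  rewrite normrN normrM -[leRHS]mulr1; apply: ler_pM => //.
    by rewrite ger0_norm ?(ltW th0).
  by have /andP[k0 k1] := k01; rewrite ger0_norm.
move: (s1la) (s2la); set l := 4 / la => s1l s2l.
have l0 : 0 <= l by rewrite divr_ge0// ltW.
have -> : 32 / (la ^+ 2 * M%:R) + 8 / la = 2 * (l ^+ 2 * M%:R^-1) + 2 * l.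
  by rewrite /l; field; rewrite !gt_eqF.
have -> : 4 / (la * M%:R) = l * M%:R^-1 by rewrite /l; field; rewrite !gt_eqF.
move: (\sum_(k < M) (kernel m (a k) y - kernel m (b k) y)) Q2 => X2 Q2.
move: (\sum_(k < M) th / M%:R * B k * kernel m (b k) y) Q1 => X1 Q1.
move: (\sum_(k < M) (th / M%:R * B k) ^+ 2 * kernel m (b k) y) Q0 => X0 Q0.
move: (D y) D1 => d D1.
move: (M%:R^-1) h0 D1 Q0 Q1 => h h0 D1 Q0 Q1.
have t1 : `|s 2%N * d| <= l ^+ 2 * h by rewrite normrM; apply: ler_pM.
have t2 : `|s 1%N ^+ 2 * X0| <= l ^+ 2 * (h ^+ 2 * Q).
  by rewrite normrM normrX; apply: ler_pM => //; rewrite ?exprn_ge0// ler_sqr ?nnegrE.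
have t3 : `|s 1%N * (- (th * kap) + X1)| <= l * (1 + h * Q).
  by rewrite normrM; apply: ler_pM => //; apply: le_trans (ler_normD _ _) _; apply: lerD.
have t4 : `|s 2%N * d - s 1%N ^+ 2 * X0| <= l ^+ 2 * h + l ^+ 2 * (h ^+ 2 * Q).
  by apply: le_trans (ler_normB _ _) _; apply: lerD.
apply: le_trans (_ : (l ^+ 2 * h + l ^+ 2 * (h ^+ 2 * Q)) + 2 * (l * (1 + h * Q)) + Q <= _).
  by apply: lerD => //; apply: lerD => //; rewrite ler_wpM2l.
have e0 : 0 <= l ^+ 2 * h by rewrite mulr_ge0// sqr_ge0.
(* The square accounts exactly for the three terms in [Q]; what remains is half of
   [32 / (la ^+ 2 * M)]. *)
rewrite -subr_ge0 (_ : _ - _ = l ^+ 2 * h)//; ring.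
Qed.

End slice.
End layer_bounds.

Section strips.
Context {R : realType}.
Local Notation mu := (@lebesgue_measure R).
Local Notation mu2 := (leb2 R).

(* The derivative of [layer] with respect to the parameter. *)
Definition gap (m th kap : R) (M : nat) (A B s : nat -> R) (y : R) : R :=
  - (th * kap) * y + \sum_(k < M) th / M%:R * B k *
    ramp m (k%:R / M%:R + th / M%:R * A k + th / M%:R * B k * s 0%N) y.

Definition admissible (m th kap : R) (M : nat) (A B : nat -> R) : Prop :=
  (forall k, `|B k| <= 1) /\ forall s : nat -> R, 0 <= s 0%N <= 1 ->
   (forall k, 0 <= A k + B k * s 0%N <= 2) /\
   (forall y, 0 < y < 1 -> `|gap m th kap M A B s y| <= 2 * th / M%:R).

(* Half-open, so that the strips of consecutive layers add up. *)
Definition strip (a b : R) : set (plane R) := `[a, b[ `*` unit_interval R.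

Lemma stime_bounds (la a x : R) : 0 < la ->
  [/\ 0 <= stime (4 / la) a x 0 <= 1, `|stime (4 / la) a x 1| <= 4 / la &
      `|stime (4 / la) a x 2| <= (4 / la) ^+ 2].
Proof.
move=> la0; have l0 : 0 <= 4 / la by rewrite divr_ge0// ltW.
rewrite /stime expr0 expr1 mul1r -[(4 - 1)%N]/3%N -[(4 - 2)%N]/2%N; split; first exact: spl4_01.
- have /andP[h1 h2] := spl3_01 (4 / la * (x - a)).
  by rewrite normrM !ger0_norm// ler_piMr.
- by rewrite normrM ger0_norm ?sqr_ge0// ler_piMr ?sqr_ge0// normr_spl2.
Qed.

Lemma stime_before (la a x : R) n : 0 < la -> (n <= 2)%N -> x <= a -> stime (4 / la) a x n = 0.
Proof.
move=> la0 n2 xa; rewrite /stime; case: n n2 => [|[|[|//]]] _ /=; rewrite spl_le0 ?mulr0//;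
  by rewrite mulr_ge0_le0 ?divr_ge0 ?(ltW la0)// subr_le0.
Qed.

Lemma stime_after (la a x : R) n : 0 < la -> (n <= 2)%N -> a + la <= x ->
  stime (4 / la) a x n = one n :> R.
Proof.
move=> la0 n2 xa; have h : 4 <= 4 / la * (x - a).
  by rewrite mulrAC ler_pdivlMr// ler_pM2l// lerBrDl.
by rewrite /stime; case: n n2 => [|[|[|//]]] _ /=; rewrite ?spl4_ge ?spl_ge ?mulr0 ?expr0 ?mulr1.
Qed.

Section strip.
Variables (p m th kap la a0 : R) (M : nat) (A B : nat -> R) (V : nat -> nat -> R * R -> R).
Hypotheses (p1 : 1 < p) (m0 : 0 < m) (th0 : 0 < th) (th12 : th <= 1 / 2) (la0 : 0 < la).
Hypotheses (k01 : 0 <= kap <= 1) (M0 : (0 < M)%N) (adm : admissible m th kap M A B).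
Hypothesis jV : jet V.
Hypothesis VE : forall x y i j, a0 <= x < a0 + la -> (i + j <= 2)%N ->
  V i j (x, y) = sloped m th kap M A B (stime (4 / la) a0 x) i j y.

Lemma measurable_slice (f : plane R -> R) (x : R) : measurable_fun setT f ->
  measurable_fun setT ((fun y => f (x, y)) : measurableTypeR R -> R).
Proof. by move=> mf; apply: (measurableT_comp mf); exact: pair1_measurable. Qed.

Lemma strip_elastic : (\int[mu2]_(z in strip a0 (a0 + la)%R) (elastic p th V z)%:E <=
  (((8 * th / (la * M%:R)) `^ p + 2 `^ p * (th * kap) `^ p +
    2 `^ p * 2 * (M%:R * (2 * (4 / m)))) * la)%:E)%E.
Proof.
have [B1 ad] := adm; have p20 : 0 <= 2 `^ p * 2 :> R by rewrite mulr_ge0 ?powR_ge0.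
have m4 : 0 <= 4 / m by rewrite divr_ge0// ltW.
have K0 : 0 <= (8 * th / (la * M%:R)) `^ p + 2 `^ p * (th * kap) `^ p.
  by rewrite addr_ge0// ?mulr_ge0 ?powR_ge0.
rewrite [X in (_ * X)%:E](_ : la = a0 + la - a0); last by ring.
apply: strip_integral => //.
- exact: measurable_elastic.
- by move=> z; exact: elastic_ge0.
- by rewrite lerDl ltW.
- by rewrite addr_ge0// mulr_ge0// mulr_ge0// mulr_ge0.
move=> x xa; have [s01 s1 s2] := stime_bounds a0 x la0; have [AB HD] := ad _ s01.
apply: (slice_sum_le (w := fun c y => \1_(`]c, c + 4 / m[%classic) y)
  (c := fun k => k%:R / M%:R) (d := fun k => k%:R / M%:R + th / M%:R * A k +
    th / M%:R * B k * stime (4 / la) a0 x 0%N)) => //.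
- by move=> c; apply: measurable_indic; exact: measurable_itv.
- move=> c; pose I : set (measurableTypeR R) := `]c, c + 4 / m[%classic.
  have mI : measurable I by exact: measurable_itv.
  have mU := @measurable_unit_interval R.
  rewrite -/I integral_indic//; apply: (@le_trans _ _ (mu I)).
    by apply: le_measure; rewrite ?inE//; exact: measurableI.
  rewrite lebesgue_measure_itv/= lte_fin ltrDl; case: ifP => _; last by rewrite lee_fin.
  by rewrite -EFinD addrAC subrr add0r.
- by apply: measurable_slice; exact: measurable_elastic.
- by move=> y; exact: elastic_ge0.
move=> y y01.
have -> : elastic p th V (x, y) =
    elastic p th (fun i j z => sloped m th kap M A B (stime (4 / la) a0 x) i j z.2) (x, y).
  by rewrite /elastic !VE.
exact: slice_elastic_le.
Qed.

(** [m] does not occur in the bound, as the kernels have mass 1. With [X = la * M], the slices give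
    [64 / X + 24 + 2 * X], and [24 <= 12 * (X + 1 / X)]; hence 76 = 64 + 12. *)
Lemma strip_surface : (\int[mu2]_(z in strip a0 (a0 + la)%R) (surface V z)%:E <=
  (76 * (la * M%:R + (la * M%:R)^-1))%:E)%E.
Proof.
have [B1 ad] := adm; have M0' : 0 < M%:R :> R by rewrite ltr0n.
have lM : 0 < la * M%:R by rewrite mulr_gt0.
have K10 : 0 <= 32 / (la ^+ 2 * M%:R) + 8 / la.
  by rewrite addr_ge0// divr_ge0 ?mulr_ge0 ?sqr_ge0 ?(ltW la0).
apply: (@le_trans _ _ (((32 / (la ^+ 2 * M%:R) + 8 / la) +
    (1 + 4 / (la * M%:R)) ^+ 2 * (M%:R * (2 * 1))) * (a0 + la - a0))%:E); last first.
  rewrite lee_fin; have -> : a0 + la - a0 = la by ring.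
  have -> : ((32 / (la ^+ 2 * M%:R) + 8 / la) + (1 + 4 / (la * M%:R)) ^+ 2 * (M%:R * (2 * 1))) * la =
      64 * (la * M%:R)^-1 + 24 + 2 * (la * M%:R).
    by field; rewrite !gt_eqF.
  move: (la * M%:R) lM => X X0.
  have := mulr_ge0 (sqr_ge0 (X - 1)) (_ : 0 <= X^-1); rewrite invr_ge0 (ltW X0) => /(_ isT).
  have -> : (X - 1) ^+ 2 * X^-1 = X - 2 + X^-1 by field; rewrite gt_eqF.
  have : 0 <= X^-1 by rewrite invr_ge0 ltW.
  move: (X^-1) => Y; lra.
apply: strip_integral => //.
- exact: measurable_surface.
- by move=> z; exact: surface_ge0.
- by rewrite lerDl ltW.
- by rewrite addr_ge0// mulr_ge0 ?sqr_ge0// mulr_ge0.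
move=> x xa; have [s01 s1 s2] := stime_bounds a0 x la0; have [AB HD] := ad _ s01.
apply: (slice_sum_le (w := kernel m)
  (c := fun k => k%:R / M%:R) (d := fun k => k%:R / M%:R + th / M%:R * A k +
    th / M%:R * B k * stime (4 / la) a0 x 0%N)) => //.
- exact: sqr_ge0.
- by move=> c; have [] := bounded_kernel c m0.
- by move=> c y; exact: kernel_ge0.
- move=> c; rewrite -(integral_kernel c m0); apply: ge0_subset_integral => //.
  + exact: measurable_unit_interval.
  + by apply/measurable_EFinP; have [] := bounded_kernel c m0.
  + by move=> y _; rewrite lee_fin kernel_ge0.
- by apply: measurable_slice; exact: measurable_surface.
- by move=> y; exact: surface_ge0.
move=> y y01.
have -> : surface V (x, y) =
    surface (fun i j z => sloped m th kap M A B (stime (4 / la) a0 x) i j z.2) (x, y).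
  by rewrite /surface !VE.
exact: slice_surface_le.
Qed.

End strip.
End strips.

(** * Merging layers and the terminal layer *)

Section branching.
Context {R : realType}.
Local Notation mu2 := (leb2 R).
Implicit Types (m th : R) (s : nat -> R).

Definition alt (k : nat) : R := (-1) ^+ k.

Lemma alt_even k : alt k.*2 = 1.
Proof. by rewrite /alt -mul2n exprM sqrrN !expr1n. Qed.

Lemma alt_odd k : alt k.*2.+1 = -1.
Proof. by rewrite /alt exprS -/(alt k.*2) alt_even mulr1. Qed.

Lemma sum_pairs n (F : nat -> R) :
  \sum_(k < n.*2) F k = \sum_(k < n) (F k.*2 + F k.*2.+1).
Proof.
elim: n => [|n ih]; first by rewrite !big_ord0.
by rewrite doubleS !big_ord_recr /= ih addrA.
Qed.

(** Right interfaces of even and odd index move in opposite directions, so [gap] is [th / (2 n)]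
    times an alternating sum of ramps, which lies in [[0, 1]]. The bound [th <= 1 / 2] keeps these
    interfaces ordered during the motion. *)
Lemma admissible_layer m th n : 0 < m -> 0 < th -> th <= 1 / 2 -> (0 < n)%N ->
  admissible m th 0 n.*2 (fun=> 1) alt.
Proof.
move=> m0 th0 th12 n0; have M0 : 0 < n.*2%:R :> R by rewrite ltr0n double_gt0.
split=> [k|s /andP[s0 s1]]; first by rewrite /alt normrX normrN1 expr1n.
have aS k : -1 <= alt k <= 1 by rewrite -ler_norml /alt normrX normrN1 expr1n.
have ak k : - s 0%N <= alt k * s 0%N <= s 0%N.
  have /andP[h1 h2] := aS k; apply/andP; split.
    by rewrite -mulN1r ler_wpM2r.
  by rewrite -[leRHS]mul1r ler_wpM2r.
split=> [k|y y01].
  by have /andP[h1 h2] := ak k; apply/andP; split; lra.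
pose b k : R := k%:R / n.*2%:R + th / n.*2%:R * 1 + th / n.*2%:R * alt k * s 0%N.
rewrite /gap mulr0 oppr0 mul0r add0r (sum_pairs n (fun k => th / n.*2%:R * alt k * ramp m (b k) y)).
have bS k : b k <= b k.+1.
  have -> : b k = (k%:R + (th + th * (alt k * s 0%N))) / n.*2%:R by rewrite /b; field; rewrite gt_eqF.
  have -> : b k.+1 = (k%:R + 1 + (th + th * (alt k.+1 * s 0%N))) / n.*2%:R.
    by rewrite /b -natr1; field; rewrite gt_eqF.
  rewrite ler_pM2r ?invr_gt0//.
  have /andP[h1 h2] := ak k; have /andP[h3 h4] := ak k.+1.
  have t1 : th * (alt k * s 0%N) <= 1 / 2.
    apply: le_trans (_ : th * 1 <= _); last by rewrite mulr1.
    by rewrite ler_wpM2l ?(ltW th0)// (le_trans h2).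
  have t2 : - (1 / 2) <= th * (alt k.+1 * s 0%N).
    apply: le_trans (_ : th * (-1) <= _); first by rewrite mulrN1 lerN2.
    by rewrite ler_wpM2l ?(ltW th0)// (le_trans _ h3)// lerN2.
  move: (th * (alt k * s 0%N)) (th * (alt k.+1 * s 0%N)) t1 t2 => X Y; lra.
have E k : th / n.*2%:R * alt k.*2 * ramp m (b k.*2) y +
    th / n.*2%:R * alt k.*2.+1 * ramp m (b k.*2.+1) y =
    th / n.*2%:R * (ramp m (b k.*2) y - ramp m (b k.*2.+1) y).
  by rewrite alt_even alt_odd; ring.
rewrite (_ : \sum_(k < n) _ = \sum_(k < n) th / n.*2%:R * (ramp m (b k.*2) y - ramp m (b k.*2.+1) y));
  last by apply: eq_bigr => k _; exact: E.
rewrite -mulr_sumr.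
have [/andP[S0 S1] _] := @alternating_sum R n (fun k => ramp m (b k.*2) y)
  (fun k => ramp m (b k.*2.+1) y) (fun k => And4 (andP (ramp_01 m (b k.*2.+1) y)).1
   (ramp_nonincreasing y m0 (bS k.*2)) (andP (ramp_01 m (b k.*2) y)).2
   (ramp_nonincreasing y m0 (bS k.*2.+1))).
have tn : 0 <= th / n.*2%:R by rewrite divr_ge0// ltW.
rewrite ger0_norm; last exact: mulr_ge0.
apply: le_trans (_ : th / n.*2%:R * 1 <= _).
  by rewrite ler_wpM2l// (le_trans S1)//; have /andP[] := ramp_01 m (b 0%N) y.
by rewrite mulr1 ler_pM2r ?invr_gt0// ler_peMl ?ler1n// ?(ltW th0).
Qed.

Lemma sum_indicator_le (F : nat -> R) (X : R) n : 0 <= X -> (forall k, 0 <= F k <= 1) ->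
  (forall k, X <= k%:R -> F k = 0) -> \sum_(k < n) F k <= X + 1.
Proof.
move=> X0 F1 F0; elim: n => [|n ih]; first by rewrite big_ord0 addr_ge0.
have [Xn|nX] := leP X n%:R; first by rewrite big_ord_recr/= F0// addr0.
apply: le_trans (_ : \sum_(k < n.+1) 1 <= _).
  by apply: ler_sum => k _; case/andP: (F1 k).
by rewrite sumr_const card_ord -natr1 lerD2r ltW.
Qed.

Lemma sum_indicator_ge (F : nat -> R) (X : R) n : (forall k, 0 <= F k) ->
  (forall k, k%:R + 2 <= X -> F k = 1) -> Num.min n%:R (X - 2) <= \sum_(k < n) F k.
Proof.
move=> F0 F1; elim: n => [|n ih]; first by rewrite big_ord0 ge_min lexx.
have [h|h] := leP (n%:R + 2) X.
  rewrite big_ord_recr/= F1//; have h' : n%:R <= X - 2 by rewrite lerBrDr.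
  rewrite (min_idPl h') in ih; rewrite ge_min; apply/orP; left.
  by rewrite -natr1 lerD2r.
have h' : X - 2 <= n%:R by rewrite lerBlDr ltW.
rewrite (min_idPr h') in ih; rewrite ge_min big_ord_recr/=; apply/orP; right.
by apply: le_trans ih _; rewrite lerDl.
Qed.

(** The sum of ramps counts the interfaces to the left of [y]. It lies between [n * y - 2] and
    [n * y + 1]: the displacement [th * s 0] and the width [4 / m <= 1 / n] of a ramp each delay an
    interface by at most one spacing. The slope [- th * y] removes the mean. *)
Lemma admissible_terminal m th n : 0 < m -> 0 < th -> th <= 1 / 2 -> (0 < n)%N -> 4 / m <= n%:R^-1 ->
  admissible m th 1 n (fun=> 0) (fun=> 1).
Proof.
move=> m0 th0 th12 n0 mn; have M0 : 0 < n%:R :> R by rewrite ltr0n.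
split=> [k|s /andP[s0 s1]]; first by rewrite normr1.
split=> [k|y /andP[y0 y1]]; first by apply/andP; split; lra.
rewrite /gap mulr1.
rewrite (eq_bigr (fun k : 'I_n => th / n%:R * ramp m (k%:R / n%:R + th / n%:R * s 0%N) y)); last first.
  by move=> k _; rewrite mulr0 addr0 !mulr1.
pose F k := ramp m (k%:R / n%:R + th / n%:R * s 0%N) y.
rewrite -mulr_sumr (_ : \sum_(k < n) _ = \sum_(k < n) F k)//.
have ts : 0 <= th * s 0%N <= 1 / 2.
  by rewrite mulr_ge0 ?(ltW th0)//=; apply: le_trans th12; rewrite ler_piMr// (ltW th0).
have F01 k : 0 <= F k <= 1 by exact: ramp_01.
have le1 : \sum_(k < n) F k <= n%:R * y + 1.
  apply: sum_indicator_le => //; first by rewrite mulr_ge0// ltW.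
  move=> k yk; rewrite /F ramp_le0//.
  rewrite -(ler_pM2l M0); apply: le_trans yk _.
  rewrite (_ : n%:R * _ = k%:R + th * s 0%N); last by field; rewrite gt_eqF.
  by rewrite lerDl; case/andP: ts.
have le2 : n%:R * y - 2 <= \sum_(k < n) F k.
  apply: le_trans (@sum_indicator_ge F (n%:R * y) n _ _).
  - rewrite le_min lexx andbT; apply: le_trans (_ : n%:R * 1 <= _); last by rewrite mulr1.
    by apply: le_trans (_ : n%:R * y <= _); [rewrite gerBl|rewrite ler_wpM2l// ltW].
  - by move=> k; case/andP: (F01 k).
  move=> k ky; rewrite /F ramp_ge1//.
  apply: le_trans (_ : k%:R / n%:R + th / n%:R * s 0%N + n%:R^-1 <= _); first by rewrite lerD2l.
  rewrite -(ler_pM2l M0); apply: le_trans ky.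
  rewrite (_ : n%:R * _ = k%:R + th * s 0%N + 1); last by field; rewrite gt_eqF.
  by case/andP: ts => _; move: (th * s 0%N) (k%:R) => X Y; lra.
have tn : 0 <= th / n%:R by rewrite divr_ge0// ltW.
have -> : - th * y + th / n%:R * \sum_(k < n) F k = th / n%:R * (\sum_(k < n) F k - n%:R * y).
  by field; rewrite gt_eqF.
rewrite normrM (ger0_norm tn) (_ : 2 * th / n%:R = th / n%:R * 2); last by ring.
by rewrite ler_wpM2l// ler_norml; apply/andP; split; move: le1 le2;
  move: (\sum_(k < n) F k) (n%:R * y) => X Y; lra.
Qed.

(** The profile at rest, at which merging layers start and end and the terminal layer ends. *)
Definition pattern m th n (i j : nat) (y : R) : R := sloped m th 0 n (fun=> 1) (fun=> 0) (@one R) i j y.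

Lemma sloped_ext m th kap M (A B s s' : nat -> R) i j y : (forall k, (k <= 2)%N -> s k = s' k) ->
  (i <= 2)%N -> sloped m th kap M A B s i j y = sloped m th kap M A B s' i j y.
Proof.
move=> ss i2; have ws a b : wave m s a b i j y = wave m s' a b i j y.
  by rewrite /wave; case: i i2 => [|[|[|//]]] _; rewrite ?ss.
rewrite /sloped /layer; congr (_ + (_ * _ + _)).
  by rewrite /tilt ss.
by apply: eq_bigr => k _; rewrite !ws.
Qed.

Lemma wave_frozen m s (a b : R) i j y : s 1%N = 0 -> s 2%N = 0 ->
  wave m s a b i j y = wave m (@one R) (a + b * s 0%N) 0 i j y.
Proof.
move=> s1 s2; by case: i => [|[|i]] /=; rewrite ?s1 ?s2 ?mulr1 ?addr0 ?mulr0 ?mul0r//.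
Qed.

Lemma layer_start m th n i j y :
  sloped m th 0 n.*2 (fun=> 1) alt (fun=> 0) i j y = pattern m th n.*2 i j y.
Proof.
rewrite /pattern /sloped /layer !mulr0 oppr0 !mul0r; congr (_ + (_ + _)).
by apply: eq_bigr => k _; congr (_ - _); rewrite wave_frozen// mulr0 addr0.
Qed.

(** At [s 0 = 1] the teeth of even index have twice the width [th / (2 n)], and those of odd index
    have width 0, so that their two waves cancel. *)
Lemma layer_end m th n i j y : (0 < n)%N ->
  sloped m th 0 n.*2 (fun=> 1) alt (@one R) i j y = pattern m th n i j y.
Proof.
move=> n0; have M0 : n%:R != 0 :> R by rewrite pnatr_eq0 -lt0n.
rewrite /pattern /sloped /layer !mulr0 oppr0 !mul0r; congr (_ + (_ + _)).
rewrite (@sum_pairs n (fun k => wave m (@one R) (k%:R / n.*2%:R) 0 i j y -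
    wave m (@one R) (k%:R / n.*2%:R + th / n.*2%:R * 1) (th / n.*2%:R * alt k) i j y)).
apply: eq_bigr => k _.
rewrite alt_even alt_odd !mulr1 (@wave_frozen _ _ _ (th / n.*2%:R))// (@wave_frozen _ _ _ (_ * -1))//=.
rewrite mulrN1 !mulr1 addrK subrr addr0.
rewrite -!muln2 !natrM -addrA.
rewrite (_ : k%:R * 2 / (n%:R * 2) = k%:R / n%:R); last by field.
by rewrite (_ : th / (n%:R * 2) + th / (n%:R * 2) = th / n%:R)//; field.
Qed.

Lemma terminal_end m th n i j y :
  sloped m th 1 n (fun=> 0) (fun=> 1) (@one R) i j y = pattern m th n i j y.
Proof.
rewrite /pattern /sloped /layer !mulr0 subrr subr0 !mulr0 oppr0 !mul0r !add0r.
congr (_ + _); apply: eq_bigr => k _; congr (_ - _).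
by rewrite !mulr1 addr0 wave_frozen//= mulr1.
Qed.

Lemma terminal_start m th n y : sloped m th 1 n (fun=> 0) (fun=> 1) (fun=> 0) 0 0 y = 0.
Proof.
rewrite /sloped /layer /= subrr mulr0 oppr0 !mul0r mulr0 !add0r big1// => k _.
by rewrite !mulr0 !addr0 subrr.
Qed.

End branching.

(** * Induction on the generations *)

Section branching_induction.
Context {R : realType}.
Local Notation mu2 := (leb2 R).
Lemma branching_base_arith (G X T w de l B : R) : 0 <= G -> 0 <= X -> 0 <= l -> 0 <= B -> B < 1 ->
  2 * w <= de ->
  (G + X * T + X * 2 * w) * l <= G * l / (1 - B) + X * (de * l) + X * T * (1 * l).
Proof.
move=> G0 X0 l0 B0 B1 wde.
have h1 : G * l <= G * l / (1 - B).
  rewrite ler_pdivlMr ?subr_gt0//; apply: ler_piMr; first exact: mulr_ge0.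
  by rewrite gerBl.
have h2 : X * l * (2 * w) <= X * l * de by apply: ler_wpM2l => //; exact: mulr_ge0.
have -> : (G + X * T + X * 2 * w) * l = G * l + X * l * (2 * w) + X * T * (1 * l) by ring.
have -> : X * (de * l) = X * l * de by ring.
by rewrite lerD2r; apply: lerD.
Qed.

(** The geometric series in fixed-point form: [g / (1 - B)] is [B * g / (1 - B) + g]. *)
Lemma branching_step_arith (g g' X T w de l B r t : R) : 0 <= X -> 0 <= l -> r <= 1 -> B < 1 ->
  2 * w <= de -> g' <= g ->
  B * g / (1 - B) + X * (de * (r * l)) + T * t + (g' + X * 2 * w * ((1 - r) * l)) <=
  g / (1 - B) + X * (de * l) + T * t.
Proof.
move=> X0 l0 r1 B1 wde gg.
have h2 : X * ((1 - r) * l) * (2 * w) <= X * ((1 - r) * l) * de.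
  by apply: ler_wpM2l => //; rewrite !mulr_ge0// subr_ge0.
have -> : g / (1 - B) = B * g / (1 - B) + g by field; rewrite gt_eqF// subr_gt0.
have -> : X * (de * l) = X * (de * (r * l)) + X * ((1 - r) * l) * de by ring.
have -> : X * 2 * w * ((1 - r) * l) = X * ((1 - r) * l) * (2 * w) by ring.
move: (B * g / (1 - B)) (X * (de * (r * l))) (X * ((1 - r) * l) * (2 * w)) (X * ((1 - r) * l) * de)
  (T * t) h2 => a b c d e h2; lra.
Qed.

Lemma surface_base_arith (Y A : R) : 0 < Y -> 0 < A -> A < 1 ->
  76 * (Y + Y^-1) <= 76 * (2 * Y / (1 - A) + (1 - A) / (1 - A) / Y).
Proof.
move=> Y0 A0 A1; have A1' : 0 < 1 - A by rewrite subr_gt0.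
rewrite ler_wpM2l// divff ?gt_eqF// div1r lerD2r ler_pdivlMr//.
by have := mulr_gt0 Y0 A0; rewrite mulrBr mulr1; move: (Y * A) => X; lra.
Qed.

(** Here [A = 1 / q]. Once the product [Z] of the new layer is replaced by [2 * Y] or [Y], both
    geometric sums close with equality. *)
Lemma surface_step_arith (Y Z q A S : R) : 0 < Y -> A * q = 1 -> A < 1 -> Y <= Z -> Z <= 2 * Y ->
  76 * (2 * (A * Y) / (1 - A) + (S - A) / (1 - A) / (A * Y)) + 76 * (Z + Z^-1) <=
  76 * (2 * Y / (1 - A) + (S * q - A) / (1 - A) / Y).
Proof.
move=> Y0 Aq A1 YZ Z2; have A1' : 0 < 1 - A by rewrite subr_gt0.
have A0 : A != 0 by apply/eqP => A0; move: Aq; rewrite A0 mul0r => /eqP; rewrite eq_sym oner_eq0.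
have -> : q = A^-1 by rewrite -[LHS](mulKf A0) Aq mulr1.
rewrite -mulrDr ler_wpM2l//.
have ZY : Z^-1 <= Y^-1 by rewrite lef_pV2// posrE// (lt_le_trans Y0).
apply: le_trans (_ : 2 * (A * Y) / (1 - A) + (S - A) / (1 - A) / (A * Y) + (2 * Y + Y^-1) <= _).
  by rewrite lerD2l lerD.
rewrite le_eqVlt; apply/orP; left; apply/eqP; field.
by rewrite A0 !gt_eqF.
Qed.

Variables (p m th : R).
Hypotheses (p1 : 1 < p) (m0 : 0 < m) (th0 : 0 < th) (th12 : th <= 1 / 2).

(** Agreement with [pattern] includes the derivatives up to order 2: it is what allows a further
    layer to be glued on at [l]. *)
Definition branching (n : nat) (l a b : R) : Prop := exists V : nat -> nat -> R * R -> R,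
  [/\ jet V, forall x y, x <= 0 -> V 0%N 0%N (x, y) = 0,
      forall x y i j, l <= x -> (i + j <= 2)%N -> V i j (x, y) = pattern m th n i j y,
      (\int[mu2]_(z in strip 0 l) (elastic p th V z)%:E <= a%:E)%E &
      (\int[mu2]_(z in strip 0 l) (surface V z)%:E <= b%:E)%E].

Lemma leq_l i j : (i + j <= 2)%N -> (i <= 2)%N.
Proof. by apply: leq_trans; exact: leq_addr. Qed.

Lemma jet_sloped kap M (A B : nat -> R) (S : R -> nat -> R) : time S ->
  jet (fun i j z => sloped m th kap M A B (S z.1) i j z.2).
Proof.
move=> tS; apply: jetD; last exact: jet_layer.
apply: jetZ; exact: (jet_tilt (time_cst (erefl : @one R 1%N = 0) (erefl : @one R 2%N = 0))).
Qed.

Lemma branching0 n l : (0 < n)%N -> 0 < l -> 4 / m <= n%:R^-1 ->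
  branching n l (((8 * th / (l * n%:R)) `^ p + 2 `^ p * th `^ p +
    2 `^ p * 2 * (n%:R * (2 * (4 / m)))) * l) (76 * (l * n%:R + (l * n%:R)^-1)).
Proof.
move=> n0 l0 mn; have tS := time_stime (4 / l) 0.
have adm := admissible_terminal m0 th0 th12 n0 mn.
pose V i j z := sloped m th 1 n (fun=> 0) (fun=> 1) (stime (4 / l) 0 z.1) i j z.2 : R.
have jV : jet V by exact: jet_sloped.
have k01 : ((0 : R) <= 1) && ((1 : R) <= 1) by rewrite ler01 lexx.
exists V; split => //.
- move=> x y x0; rewrite /V /= (@sloped_ext _ _ _ _ _ _ _ _ (fun=> 0)) ?terminal_start//.
  by move=> k k2; exact: stime_before.
- move=> x y i j lx ij; rewrite /V /= (@sloped_ext _ _ _ _ _ _ _ _ (@one R)) ?terminal_end ?(leq_l ij)//.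
  by move=> k k2; apply: stime_after => //; rewrite add0r.
- have := @strip_elastic R p m th 1 l 0 n _ _ V p1 m0 th0 th12 l0 k01 n0 adm jV.
  by rewrite add0r mulr1; apply.
have := @strip_surface R m th 1 l 0 n _ _ V m0 th0 th12 l0 k01 n0 adm jV.
by rewrite add0r; apply.
Qed.

Lemma branchingS n l r a b : (0 < n)%N -> 0 < l -> 0 < r -> r < 1 ->
  branching n.*2 (r * l) a b ->
  branching n l
    (a + ((8 * th / (((1 - r) * l) * n.*2%:R)) `^ p +
      2 `^ p * 2 * (n.*2%:R * (2 * (4 / m)))) * ((1 - r) * l))
    (b + 76 * ((1 - r) * l * n.*2%:R + ((1 - r) * l * n.*2%:R)^-1)).
Proof.
move=> n0 l0 r0 r1 [U [jU U0 UE Ua Ub]].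
have la0 : 0 < (1 - r) * l by rewrite mulr_gt0// subr_gt0.
have laE : r * l + (1 - r) * l = l by ring.
have rl0 : 0 < r * l by rewrite mulr_gt0.
have rl : r * l <= l by rewrite -[leLHS]addr0 -{2}laE lerD2l ltW.
move: ((1 - r) * l) la0 laE => la la0 laE.
pose S := stime (4 / la) (r * l).
have tS : time S by exact: time_stime.
have t0 : time (fun _ : R => fun _ : nat => 0 : R) by exact: time_cst.
(* Left of [r * l] the two layers agree and [V] is [U]; right of it [U] is the pattern of [2 n]
   teeth, which cancels the layer at rest and leaves the moving one. As a sum of jets, [V] is a jet
   without any matching at the junction. *)
pose V i j z := U i j z + (layer m th 0 n.*2 (fun=> 1) alt (S z.1) i j z.2 -
  layer m th 0 n.*2 (fun=> 1) alt (fun=> 0) i j z.2) : R.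
have jV : jet V.
  apply: jetD => //; apply: jetB; first exact: jet_layer.
  exact: (jet_layer m th 0 n.*2 (fun=> 1) alt t0).
have VS x y i j : r * l <= x -> (i + j <= 2)%N ->
    V i j (x, y) = sloped m th 0 n.*2 (fun=> 1) alt (S x) i j y.
  by move=> xl ij; rewrite /V /= UE// -layer_start /sloped; ring.
have VU x y i j : x <= r * l -> (i + j <= 2)%N -> V i j (x, y) = U i j (x, y).
  move=> xl ij; have E : sloped m th 0 n.*2 (fun=> 1) alt (S x) i j y =
      sloped m th 0 n.*2 (fun=> 1) alt (fun=> 0) i j y.
    by apply: sloped_ext => [k k2|]; [exact: stime_before|exact: leq_l ij].
  by move: E => /addrI E; rewrite /V /= E subrr addr0.
have adm := admissible_layer m0 th0 th12 n0.
have M0 : (0 < n.*2)%N by rewrite double_gt0.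
have k01 : ((0 : R) <= 0) && ((0 : R) <= 1) by rewrite ler01 lexx.
have mS (c d : R) : measurable (strip c d).
  by apply: measurableX; [exact: measurable_itv|exact: measurable_unit_interval].
have sU : strip 0 l = strip 0 (r * l) `|` strip (r * l) l.
  apply/seteqP; split=> [[x y] [/= x0 y0]|[x y] [[/= x0 y0]|[/= x0 y0]]].
  - move: x0; rewrite /= in_itv/= => /andP[x0 xl].
    have [h|h] := ltP x (r * l); [left|right]; split => //=; rewrite in_itv/= ?x0 ?h//.
  - split => //=; move: x0; rewrite /= !in_itv/= => /andP[-> h]/=; exact: lt_le_trans h rl.
  - split => //=; move: x0; rewrite /= !in_itv/= => /andP[h ->]; rewrite andbT.
    exact: le_trans (ltW rl0) h.
have split_int (f : plane R -> R) : measurable_fun setT f -> (forall z, 0 <= f z) ->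
    (\int[mu2]_(z in strip 0 l) (f z)%:E =
     \int[mu2]_(z in strip 0 (r * l)) (f z)%:E + \int[mu2]_(z in strip (r * l) l) (f z)%:E)%E.
  move=> mf f0; rewrite sU ge0_integral_setU//.
  - by apply/measurable_EFinP; exact: measurable_funTS.
  - by move=> z _; rewrite lee_fin.
  apply/disj_setPS => -[x y] [[/= + _] [/= + _]]; rewrite !in_itv/=.
  by move=> /andP[_ h1] /andP[h2 _]; move: (lt_le_trans h1 h2); rewrite ltxx.
have inU z : z \in strip 0 (r * l) -> z.1 <= r * l.
  by move=> /set_mem[]; rewrite /= in_itv/= => /andP[_ /ltW].
exists V; split => //.
- by move=> x y x0; rewrite VU ?U0// (le_trans x0)// ltW.
- move=> x y i j lx ij; rewrite VS ?(le_trans rl)//.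
  rewrite (@sloped_ext _ _ _ _ _ _ _ _ (@one R)) ?layer_end ?(leq_l ij)// => k k2.
  by apply: stime_after => //; rewrite laE.
- rewrite split_int; [|exact: measurable_elastic|by move=> z; exact: elastic_ge0].
  rewrite EFinD; apply: leeD.
    apply: le_trans Ua; rewrite le_eqVlt; apply/orP; left; apply/eqP.
    apply: eq_integral => -[x y] /inU/= xl; by rewrite /elastic !VU.
  have := @strip_elastic R p m th 0 la (r * l) n.*2 _ _ V p1 m0 th0 th12 la0 k01 M0 adm jV.
  rewrite laE mulr0 powR0; last by rewrite gt_eqF// (lt_trans ltr01).
  rewrite mulr0 addr0; apply => x y i j /andP[xl _]; exact: VS.
- rewrite split_int; [|exact: measurable_surface|by move=> z; exact: surface_ge0].
  rewrite EFinD; apply: leeD.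
    apply: le_trans Ub; rewrite le_eqVlt; apply/orP; left; apply/eqP.
    apply: eq_integral => -[x y] /inU/= xl; by rewrite /surface !VU.
  have := @strip_surface R m th 0 la (r * l) n.*2 _ _ V m0 th0 th12 la0 k01 M0 adm jV.
  rewrite laE; apply => x y i j /andP[xl _]; exact: VS.
Qed.

Lemma branching_le n l a b a' b' : branching n l a b -> a <= a' -> b <= b' -> branching n l a' b'.
Proof.
move=> [V [jV V0 VE Va Vb]] aa bb; exists V; split => //.
  by apply: le_trans Va _; rewrite lee_fin.
by apply: le_trans Vb _; rewrite lee_fin.
Qed.

Variables (q de : R).
Hypotheses (q1 : 1 < q) (qp : q `^ (p - 1) < 2) (de01 : 0 <= de <= 1).
Let r : R := (2 * q)^-1.
Let Bq : R := q `^ (p - 1) / 2.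

(** Doubling the teeth on a length multiplied by [r = 1 / (2 q)] multiplies the elastic term by
    [Bq < 1] and the product of length and number of teeth by [1 / q]. Only the terms in the inverse
    of that product grow, like [q ^ N]. The condition on [m] bounds the total width of the smoothed
    interfaces in the finest generation by [de]. *)
Lemma branching_rec N n l : (0 < n)%N -> 0 < l -> 16 * ((2 ^ N * n)%:R / m) <= de ->
  branching n l
    ((8 * th / (l * n%:R)) `^ p * l / (1 - Bq) + 2 `^ p * (de * l) + 2 `^ p * th `^ p * (r ^+ N * l))
    (76 * (2 * (l * n%:R) / (1 - q^-1) + (q ^+ N - q^-1) / (1 - q^-1) / (l * n%:R))).
Proof.
have q0 : 0 < q by exact: lt_trans q1.
have qV0 : 0 < q^-1 by rewrite invr_gt0.
have qV1 : q^-1 < 1 by rewrite invf_lt1.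
have B0 : 0 <= Bq by rewrite divr_ge0 ?powR_ge0.
have B1 : 0 < 1 - Bq by rewrite subr_gt0 ltr_pdivrMr// mul1r.
have A1 : 0 < 1 - q^-1 by rewrite subr_gt0.
have r0 : 0 < r by rewrite invr_gt0 mulr_gt0.
have r12 : r <= 1 / 2.
  by rewrite /r div1r lef_pV2 ?posrE ?mulr_gt0// ler_pMr// ltW.
have r1 : r < 1 by lra.
have p20 : 0 <= 2 `^ p :> R by exact: powR_ge0.
elim: N n l => [|N ih] n l n0 l0 nm; have n0' : 0 < n%:R :> R by rewrite ltr0n.
  rewrite expn0 mul1n in nm; have ln0 : 0 < l * n%:R by rewrite mulr_gt0.
  have mn : 4 / m <= n%:R^-1.
    rewrite -(ler_pM2l n0') mulfV ?gt_eqF//.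
    have -> : n%:R * (4 / m) = 16 * (n%:R / m) / 4 by field; rewrite gt_eqF.
    rewrite ler_pdivrMr// mul1r; apply: le_trans nm _.
    by case/andP: de01 => _ /le_trans; apply; rewrite ler1n.
  apply: branching_le (branching0 n0 l0 mn) _ _.
    rewrite expr0; apply: branching_base_arith => //; rewrite ?powR_ge0 ?(ltW l0)//.
      by rewrite -subr_gt0.
    by apply: le_trans nm; rewrite le_eqVlt; apply/orP; left; apply/eqP; field; rewrite gt_eqF.
  by rewrite expr0; exact: surface_base_arith.
have nm' : 16 * ((2 ^ N * n.*2)%:R / m) <= de by rewrite -mul2n mulnA -expnSr.
have := ih n.*2 (r * l) _ _ nm'; rewrite double_gt0 mulr_gt0// => /(_ n0 isT) hb.
have d2 : n.*2%:R = 2 * n%:R :> R by rewrite -mul2n natrM.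
have ln0 : 0 < l * n%:R by rewrite mulr_gt0.
have rq : 2 * r = q^-1 by rewrite /r invfM mulrA divff ?mul1r.
have r1h : 1 <= 2 * (1 - r) by lra.
apply: branching_le (branchingS n0 l0 r0 r1 hb) _ _.
  have -> : 8 * th / (r * l * n.*2%:R) = 8 * th / (l * n%:R) * q.
    by rewrite d2 /r; field; rewrite !gt_eqF.
  have P0 : 0 <= 8 * th / (l * n%:R) by rewrite divr_ge0 ?(ltW ln0)// mulr_ge0// ltW.
  rewrite powRM ?(ltW q0)//.
  have -> : (8 * th / (l * n%:R)) `^ p * q `^ p * (r * l) = Bq * ((8 * th / (l * n%:R)) `^ p * l).
    rewrite -(powRB1 p q0) /Bq /r; field; rewrite gt_eqF//.
  rewrite [r ^+ N * (r * l)]mulrA -exprSr [X in _ + X <= _]mulrDl.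
  have w2 : 2 * (n.*2%:R * (2 * (4 / m))) <= de.
    apply: le_trans nm'; rewrite (_ : 2 * _ = 16 * (n.*2%:R / m)); last first.
      by field; rewrite gt_eqF.
    rewrite ler_wpM2l// ler_pM2r ?invr_gt0// ler_nat.
    by rewrite leq_pmull// expn_gt0.
  have gg : (8 * th / ((1 - r) * l * n.*2%:R)) `^ p * ((1 - r) * l) <=
      (8 * th / (l * n%:R)) `^ p * l.
    have e1 : (1 - r) * l <= l by rewrite ler_piMl ?(ltW l0)// gerBl ltW.
    have e2 : 0 <= (1 - r) * l by rewrite mulr_ge0 ?(ltW l0)// subr_ge0 ltW.
    apply: ler_pM => //; first exact: powR_ge0.
    have th8 : 0 <= 8 * th by rewrite mulr_ge0// ltW.
    have e3 : 0 < (1 - r) * l * n.*2%:R by rewrite !mulr_gt0 ?subr_gt0// ltr0n double_gt0.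
    apply: ge0_ler_powR; rewrite ?nnegrE//; first by rewrite (le_trans ler01)// ltW.
      by rewrite divr_ge0// ltW.
    rewrite ler_wpM2l// lef_pV2 ?posrE//.
    rewrite d2 (_ : (1 - r) * l * (2 * n%:R) = 2 * (1 - r) * (l * n%:R)); last by ring.
    by rewrite ler_peMl// ltW.
  have B1' : Bq < 1 by rewrite -subr_gt0.
  exact: (branching_step_arith (2 `^ p * th `^ p) (r ^+ N.+1 * l) p20 (ltW l0) (ltW r1) B1' w2 gg).
have -> : r * l * n.*2%:R = q^-1 * (l * n%:R) by rewrite -rq d2; ring.
rewrite exprSr; apply: surface_step_arith => //; first by rewrite mulVf// gt_eqF.
  rewrite d2 (_ : (1 - r) * l * (2 * n%:R) = 2 * (1 - r) * (l * n%:R)); last by ring.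
  by rewrite ler_peMl// ltW.
rewrite d2 (_ : (1 - r) * l * (2 * n%:R) = (1 - r) * (2 * (l * n%:R))); last by ring.
by apply: ler_piMl; [rewrite mulr_ge0// ltW|rewrite gerBl ltW].
Qed.

End branching_induction.

(** * Choice of the parameters of the construction *)

Section upper_bound.
Context {R : realType}.
Local Notation mu2 := (leb2 R).

Lemma powR_exprC (q s : R) N : 0 <= q -> (q ^+ N) `^ s = (q `^ s) ^+ N.
Proof.
move=> q0; elim: N => [|N IH]; first by rewrite !expr0 powR1.
by rewrite !exprS powRM ?exprn_ge0// IH.
Qed.

(** [N] is the first generation at which the terminal length [(2 q) ^ (- N)] is at most [X ^ (- p)].
    As [2 q = q ^ (2 p - 1)] and [2 p - 1 >= p], having [q ^ (N - 1) > X] would contradict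
    minimality. *)
Lemma depth_choice (p q X : R) : 1 < p -> 1 < q -> q `^ (2 * (p - 1)) = 2 -> 1 <= X ->
  exists N, X `^ p <= (2 * q) ^+ N /\ q ^+ N <= q * X.
Proof.
move=> p1 q1 q2 X1; have q0 : 0 < q by exact: lt_trans q1.
have X0 : 0 < X by exact: lt_le_trans X1.
have : exists N, X `^ p <= (2 * q) ^+ N.
  exists (Num.truncn (X `^ p)).+1.
  have /andP[_ h] := truncn_itv (powR_ge0 X p); apply: le_trans (ltW h) _.
  apply: le_trans (_ : 2 ^+ (Num.truncn (X `^ p)).+1 <= _).
    by rewrite -natrX ler_nat ltnW// ltn_expl.
  by apply: lerXn2r; rewrite ?nnegrE ?mulr_ge0 ?(ltW q0)// ler_peMr// ltW.
move=> /ex_minnP[N hN minN]; exists N; split => //.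
case: N hN minN => [|N] hN minN.
  by rewrite expr0; apply: le_trans (_ : 1 * 1 <= _); [rewrite mulr1|apply: ler_pM => //; exact: ltW].
rewrite exprS ler_wpM2l ?(ltW q0)// leNgt; apply/negP => Xq.
have : X `^ p <= (2 * q) ^+ N.
  have s0 : 0 <= 2 * (p - 1) + 1 by rewrite addr_ge0// mulr_ge0// subr_ge0 ltW.
  have -> : (2 * q) ^+ N = (q ^+ N) `^ (2 * (p - 1) + 1).
    by rewrite powR_exprC ?(ltW q0)// powRS// q2.
  apply: le_trans (_ : X `^ (2 * (p - 1) + 1) <= _).
    by rewrite ler_powR//; lra.
  by apply: ge0_ler_powR; rewrite ?nnegrE ?exprn_ge0 ?(ltW X0) ?(ltW q0) ?(ltW Xq).
by move=> /minN; rewrite ltnn.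
Qed.

Lemma square_strip : square R `<=` strip 0 1.
Proof.
move=> z [z1 z2]; split => //=; move: z1; rewrite /unit_interval/= !in_itv/=.
by move=> /andP[/ltW -> ->].
Qed.

Lemma classB_branching (p m th a b : R) n : 1 < p -> branching p m th n 1 a b ->
  exists v : classB p, forall eps : R, 0 <= eps -> (energy eps th v <= (a + eps * b)%:E)%E.
Proof.
move=> p1 [V [jV V0 _ Va Vb]].
have V00 y : V 0%N 0%N (0, y) = 0 by exact: V0.
have [v hv] := classB_of_jet p1 jV V00; exists v => eps eps0.
apply: le_trans (hv th eps eps0) _; rewrite EFinD EFinM.
have mS : measurable (strip (0:R) 1).
  by apply: measurableX; [exact: measurable_itv|exact: measurable_unit_interval].
have sub (f : plane R -> R) : measurable_fun setT f -> (forall z, 0 <= f z) ->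
    (\int[mu2]_(z in square R) (f z)%:E <= \int[mu2]_(z in strip 0 1) (f z)%:E)%E.
  move=> mf f0; apply: ge0_subset_integral => //.
  - exact: measurable_square.
  - by apply/measurable_EFinP; exact: measurable_funTS.
  - by move=> z _; rewrite lee_fin.
  - exact: square_strip.
apply: leeD.
  by apply: le_trans Va; apply: sub; [exact: measurable_elastic|move=> z; exact: elastic_ge0].
apply: lee_wpmul2l; first by rewrite lee_fin.
by apply: le_trans Vb; apply: sub; [exact: measurable_surface|move=> z; exact: surface_ge0].
Qed.

Lemma classB_zero (p th eps : R) : 1 < p -> 0 < th -> 0 <= eps ->
  exists v : classB p, (energy eps th v <= (th `^ p)%:E)%E.
Proof.
move=> p1 th0 eps0; have p0 : p != 0 by rewrite gt_eqF// (lt_trans ltr01).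
have j0 : jet (fun i j (z : R * R) => 0 : R).
  have := jetZ 0 (jet_tilt (time_cst (erefl : @one R 1%N = 0) (erefl : @one R 2%N = 0))).
  by rewrite (_ : (fun i j z => _) = (fun i j z => 0))//;
    apply/funext => i; apply/funext => j; apply/funext => z; rewrite mul0r.
have [v hv] := classB_of_jet p1 j0 (fun=> erefl); exists v.
apply: le_trans (hv th eps eps0) _.
rewrite [X in (_ + _ * X)%E]integral0_eq ?mule0 ?adde0; last first.
  by move=> z _; rewrite /surface normr0 mulr0 !addr0.
apply: (@le_trans _ _ (\int[mu2]_(z in square R) (th `^ p)%:E)%E).
  apply: ge0_le_integral => //.
  - exact: measurable_square.
  - by move=> z _; rewrite lee_fin elastic_ge0.
  - by apply/measurable_EFinP; apply: measurable_funTS; exact: measurable_elastic.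
  - move=> z _; rewrite lee_fin /elastic normr0 powR0// add0r /well add0r.
    by rewrite ge_min gtr0_norm// lexx.
rewrite integral_cst; last exact: measurable_square.
by have := @leb2_square R => /= ->; rewrite mule1.
Qed.

(** For the application, [w] is [n ^ (- p)], [y] is [Y ^ (- p)], [rN] is the terminal length, [D]
    and [a] are the sums of the geometric series, and [S] is the growing factor;
    [eps * n <= 2 * (t * y)] is the balance of surface and elastic energy. *)
Lemma upper_arith (E T t w y D a q S n eps rN : R) : 0 <= E -> 0 <= T -> 0 <= t -> 0 <= D ->
  0 <= a -> 0 <= q -> 1 <= n -> 0 <= eps -> w <= y -> rN <= w -> S <= q * n -> eps * n <= 2 * (t * y) ->
  E * t * w * D + T * (t * w) + T * t * rN + eps * (76 * (2 * n * a + S * a / n)) <=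
  (E * D + 2 * T + 2 * (76 * a * (2 + q))) * (t * y).
Proof.
move=> E0 T0 t0 D0 a0 q0 n1 eps0 wy rw Sq en; have n0 : 0 < n by exact: lt_le_trans n1.
have h1 : t * w <= t * y by exact: ler_wpM2l.
have h2 : E * D * (t * w) <= E * D * (t * y) by apply: ler_wpM2l => //; exact: mulr_ge0.
have h3 : T * (t * w) <= T * (t * y) by exact: ler_wpM2l.
have h4 : T * (t * rN) <= T * (t * y) by apply: ler_wpM2l => //; apply: ler_wpM2l => //; exact: le_trans wy.
have h5 : S * a / n <= a * (q * n).
  rewrite ler_pdivrMr//; apply: le_trans (_ : q * n * a <= _); first exact: ler_wpM2r.
  rewrite (_ : a * (q * n) * n = q * n * a * n); last by ring.
  by rewrite ler_peMr// !mulr_ge0// ltW.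
have h6 : 76 * (2 * n * a + S * a / n) <= 76 * a * (2 + q) * n.
  rewrite (_ : 76 * a * (2 + q) * n = 76 * (2 * n * a + a * (q * n))); last by ring.
  by rewrite ler_wpM2l// lerD2l.
have h7 : eps * (76 * (2 * n * a + S * a / n)) <= 76 * a * (2 + q) * (2 * (t * y)).
  apply: le_trans (ler_wpM2l eps0 h6) _.
  rewrite (_ : eps * (76 * a * (2 + q) * n) = 76 * a * (2 + q) * (eps * n)); last by ring.
  by apply: ler_wpM2l => //; rewrite !mulr_ge0// addr_ge0.
have -> : (E * D + 2 * T + 2 * (76 * a * (2 + q))) * (t * y) =
  E * D * (t * y) + T * (t * y) + T * (t * y) + 76 * a * (2 + q) * (2 * (t * y)) by ring.
have -> : E * t * w * D = E * D * (t * w) by ring.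
rewrite -[T * t * rN]mulrA; apply: lerD => //; apply: lerD => //; exact: lerD.
Qed.

Lemma div_swap (t e x y : R) : e != 0 -> x != 0 -> x * y = t / e -> t / x = e * y.
Proof.
move=> e0 x0 E; have -> : t = e * (x * y) by rewrite E mulrC divfK.
by field.
Qed.

Lemma energy_upper (p : R) : 1 < p -> exists2 C : R, 0 < C &
  forall th eps : R, 0 < th -> th <= 1 / 2 -> 0 < eps -> exists v : classB p,
    (energy eps th v <=
      (C * (th `^ p * Num.min 1 ((eps / th `^ p) `^ (p / (p + 1)))))%:E)%E.
Proof.
move=> p1; have p0 : 0 < p by exact: lt_trans p1.
have p10 : 0 < p + 1 by rewrite addr_gt0.
have pm1 : 0 < p - 1 by rewrite subr_gt0.
(* Then [q ^ (p - 1)] is the square root of 2, which makes the elastic ratio less than 1. *)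
pose q : R := 2 `^ (2 * (p - 1))^-1.
have q0 : 0 < q by exact: powR_gt0.
have q2 : q `^ (2 * (p - 1)) = 2.
  by rewrite -powRrM mulVf ?powRr1// gt_eqF// mulr_gt0.
have q1 : 1 < q.
  rewrite ltNge; apply/negP => qle.
  have : q `^ (2 * (p - 1)) <= 1.
    have := @ge0_ler_powR R (2 * (p - 1)) _ q 1; rewrite powR1; apply => //.
    - by rewrite mulr_ge0// ltW.
    - by rewrite nnegrE ltW.
    - by rewrite nnegrE ler01.
  by rewrite q2; lra.
have qp : q `^ (p - 1) < 2.
  rewrite ltNge; apply/negP => h.
  have : q `^ (p - 1) * q `^ (p - 1) = 2.
    by rewrite -powRD ?(gt_eqF q0) ?implybT// -q2 mulr_natl mulr2n.
  have := ler_pM (ler0n _ 2) (ler0n _ 2) h h; move=> + E; rewrite E; lra.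
pose B := q `^ (p - 1) / 2.
have B1 : 0 < 1 - B by rewrite subr_gt0 ltr_pdivrMr// mul1r.
have A1 : 0 < 1 - q^-1 by rewrite subr_gt0 invf_lt1.
pose C1 := 8 `^ p / (1 - B) + 2 * 2 `^ p.
pose C2 := 76 / (1 - q^-1) * (2 + q).
have C10 : 1 <= C1.
  apply: le_trans (_ : 0 + 1 * 1 <= _); first by rewrite add0r mulr1.
  apply: lerD; first by rewrite divr_ge0 ?powR_ge0// ltW.
  by apply: ler_pM => //; rewrite ?ler1n// le1_powR ?ler1n// ltW.
have C20 : 0 <= C2.
  by rewrite mulr_ge0 ?addr_ge0 ?(ltW q0)// divr_ge0// ltW.
have CC : 1 <= C1 + 2 * C2 by rewrite (le_trans C10)// lerDl mulr_ge0.
exists (C1 + 2 * C2); first exact: lt_le_trans CC.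
move=> th eps th0 th12 eps0.
have t0 : 0 < th `^ p by exact: powR_gt0.
(* In the first case the minimum is 1, and the energy [th ^ p] of the zero function is admissible
   because the constant is at least 1. *)
have [te|et] := leP (th `^ p) eps.
  have [v hv] := classB_zero p1 th0 (ltW eps0); exists v; apply: le_trans hv _.
  rewrite lee_fin min_l; last first.
    by apply: le1_powR; [rewrite ler_pdivlMr// mul1r|rewrite divr_ge0// ltW].
  by rewrite mulr1 ler_peMl// ltW.
set t := th `^ p in t0 et *.
pose Y := (t / eps) `^ (p + 1)^-1.
have te1 : 1 <= t / eps by rewrite ler_pdivlMr// mul1r ltW.
have te0 : 0 < t / eps by exact: lt_le_trans te1.
have Y1 : 1 <= Y by apply: le1_powR => //; rewrite invr_ge0 ltW.
have Y0 : 0 < Y by exact: lt_le_trans Y1.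
have Yp : Y `^ p * Y = t / eps.
  by rewrite -powRS// -powRrM mulVf ?gt_eqF// powRr1// ltW.
have YpN : (Y `^ p)^-1 = (eps / t) `^ (p / (p + 1)).
  rewrite -powRN -powRrM (_ : eps / t = (t / eps)^-1); last by rewrite invf_div.
  rewrite -(powR_inv1 (ltW te0)) -powRrM; congr (_ `^ _).
  by rewrite mulN1r mulrN mulrC.
have Yp0 : 0 < Y `^ p by exact: powR_gt0.
rewrite -YpN min_r; last by rewrite invf_le1// le1_powR// ltW.
pose n := (Num.truncn Y).+1.
have /andP[nY1 nY2] : (Num.truncn Y)%:R <= Y < n%:R by apply: truncn_itv; exact: ltW.
have n2Y : n%:R <= 2 * Y by rewrite /n -natr1 mulr_natl mulr2n; exact: lerD.
have n0 : 0 < n%:R :> R by rewrite ltr0n.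
have n1 : 1 <= n%:R :> R by rewrite ler1n.
have np0 : 0 < n%:R `^ p :> R by exact: powR_gt0.
have np1 : 1 <= n%:R `^ p :> R by apply: le1_powR => //; exact: ltW.
have [N [N1 N2]] := depth_choice p1 q1 q2 n1.
have t1 : t <= 1.
  have := @ge0_ler_powR R p (ltW p0) th 1; rewrite powR1; apply; rewrite ?nnegrE ?(ltW th0)//.
  by apply: le_trans th12 _; rewrite ler_pdivrMr// mul1r ler1n.
(* The smoothing is allowed to cost as much as the elastic energy of the teeth, of order
   [th ^ p / n ^ p]; [m] is then taken such that the condition of [branching_rec] is an equality. *)
pose de := t / n%:R `^ p.
have de0 : 0 < de by rewrite divr_gt0.
have de01 : 0 <= de <= 1.
  by rewrite (ltW de0)/= ler_pdivrMr// mul1r (le_trans t1).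
have M0 : 0 < (2 ^ N * n)%:R :> R by rewrite ltr0n muln_gt0 expn_gt0.
pose m := 16 * (2 ^ N * n)%:R / de.
have m0 : 0 < m by rewrite divr_gt0// mulr_gt0.
have hm : 16 * ((2 ^ N * n)%:R / m) <= de.
  rewrite le_eqVlt; apply/orP; left; apply/eqP; rewrite /m.
  by move: (_%:R) M0 => X X0; field; rewrite !gt_eqF.
have br := branching_rec p1 m0 th0 th12 q1 qp de01 (isT : (0 < n)%N) ltr01 hm.
have [v hv] := classB_branching p1 br; exists v; apply: le_trans (hv _ (ltW eps0)) _.
rewrite lee_fin !mul1r !mulr1 powRM ?mulr_ge0 ?invr_ge0 ?(ltW n0) ?(ltW th0)//.
rewrite powRM ?(ltW th0)// -/t -/B.
have -> : n%:R^-1 `^ p = (n%:R `^ p)^-1.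
  by rewrite -[in LHS](powR_inv1 (ltW n0)) -powRrM mulN1r powRN.
rewrite [(q ^+ N - q^-1) / _]mulrC [_ * (q ^+ N - _)]mulrC.
apply: upper_arith; rewrite ?powR_ge0 ?invr_ge0 ?(ltW t0) ?(ltW B1) ?(ltW A1) ?(ltW q0) ?(ltW eps0)//.
- rewrite lef_pV2 ?posrE//; apply: ge0_ler_powR; rewrite ?nnegrE ?(ltW p0) ?(ltW Y0) ?(ltW n0)//.
  exact: ltW.
- by rewrite exprVn lef_pV2 ?posrE// exprn_gt0// mulr_gt0.
- by apply: le_trans N2; rewrite gerBl invr_ge0 ltW.
rewrite (div_swap (lt0r_neq0 eps0) (lt0r_neq0 Yp0) Yp).
by rewrite mulrCA ler_wpM2l// ltW.
Qed.

End upper_bound.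

Unset Implicit Arguments.

Theorem theorem1p1 (R : realType) (p : R) (hp : 1 < p) :
  exists2 c : R, 0 < c &
    forall theta eps : R, 0 < theta -> theta <= 1 / 2 -> 0 < eps ->
      ((c^-1 * (theta `^ p
          * Num.min 1 ((eps / theta `^ p) `^ (p / (p + 1)))))%:E
        <= ereal_inf (range (fun v : classB p => energy eps theta v)))%E /\
      (ereal_inf (range (fun v : classB p => energy eps theta v))
        <= (c * (theta `^ p
          * Num.min 1 ((eps / theta `^ p) `^ (p / (p + 1)))))%:E)%E.
Proof.
have [C C0 hC] := energy_upper hp.
have c0 : 0 < 2 * 512 `^ p :> R by apply: mulr_gt0; [|apply: powR_gt0; rewrite ltr0n].
exists (Num.max C (2 * 512 `^ p)); first by rewrite lt_max C0.
move=> th eps th0 th12 eps0.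
set W := th `^ p * _; have W0 : 0 <= W.
  by rewrite mulr_ge0 ?powR_ge0// le_min ler01 powR_ge0.
split.
  apply: le_ereal_inf_tmp => _ [v _ <-]; apply: le_trans (energy_lower v hp th0 th12 eps0).
  rewrite lee_fin; apply: (ler_wpM2r W0).
  move: (2 * 512 `^ p) c0 => K K0.
  by rewrite lef_pV2 ?posrE ?lt_max ?C0// le_max lexx orbT.
have [v hv] := hC th eps th0 th12 eps0.
apply: le_trans (ereal_inf_lbound _) _; first by exists v.
by apply: le_trans hv _; rewrite lee_fin ler_wpM2r// le_max lexx.
Qed.
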